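(* Let $h$ be distributionally integrable on $[a,b]$ and let $\{g_n\}_{n=1}^\infty$ be a sequence of measurable functions on $[a,b]$ that satisfies, for every $n$, $g_n(x)\ge h(x)$ almost everywhere. Suppose that $$\liminf_{n\to\infty}(\mathfrak{dist})\int_a^bg_n(x)\,dx<\infty .$$ Then the function defined by $g_*(x)=\liminf_{n\to\infty}g_n(x)$ is distributionally integrable over $[a,b]$ and $$(\mathfrak{dist})\int_a^bg_*(x)\,dx\le\liminf_{n\to\infty}(\mathfrak{dist})\int_a^bg_n(x)\,dx .$$
   Context: Infinite integrals. If $k$ is measurable on $[a,b]$ and $k=k_1+k_2$ with $k_1$ distributionally integrable over $[a,b]$ and $k_2\ge0$ a.e. measurable and not distributionally integrable, one writes $(\mathfrak{dist})\int_a^bk(x)\,dx=\infty$. If $k$ is measurable and $k\ge h$ a.e. with $h$ distributionally integrable, then either $k$ is distributionally integrable or $(\mathfrak{dist})\int_a^bk(x)\,dx=\infty$; so $(\mathfrak{dist})\int_a^bg_n(x)\,dx\in\mathbb R\cup\{\infty\}$ is defined for each $n$. Distributions are real. Notation: $\overline{\mathbb R}=\mathbb R\cup\{-\infty,\infty\}$; $\mathcal E'[a,b]$ is the space of distributions on $\mathbb R$ with support contained in $[a,b]$; $\langle \mathsf g(x+ty),\phi(y)\rangle:=|t|^{-1}\langle \mathsf g(y),\phi((y-x)/t)\rangle$ for $t\ne0$. Point values. For $\mathsf g\in\mathcal D'(\mathbb R)$, the distributional (Łojasiewicz) point value $\mathsf g(x_0)$ exists and equals $\gamma\in\mathbb R$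 if $\lim_{\varepsilon\to0}\langle \mathsf g(x_0+\varepsilon y),\phi(y)\rangle=\gamma\int_{-\infty}^\infty\phi(y)\,dy$ for every $\phi\in\mathcal D(\mathbb R)$. A Łojasiewicz distribution is one having a point value at every point of $\mathbb R$. Test classes. $\mathcal T_0$: functions $\phi\in C^\infty(\mathbb R)$, $\phi\ge0$, $\int\phi=1$, such that for some $\alpha<-1$, $\phi^{(m)}(x)=O(|x|^{\alpha-m})$ as $|x|\to\infty$ for all $m\ge0$. $\mathcal T_1$: those $\phi\in\mathcal T_0$ with $x\phi'(x)\le0$ for all $x$. For $\mathsf g\in\mathcal E'(\mathbb R)$, $\phi\in\mathcal T_0$: $\mathsf g^{+}_{\phi,0}(x)=\limsup_{t\to0^+}\langle \mathsf g(x+ty),\phi(y)\rangle$ and $\mathsf g^{-}_{\phi,0}(x)=\liminf_{t\to0^+}\langle \mathsf g(x+ty),\phi(y)\rangle$. Integral. Let $f:[a,b]\to\overline{\mathbb R}$. A major distributional pair $(\mathsf u,\mathsf U)$ for $f$ consists of $\mathsf u\in\mathcal E'[a,b]$ and a Łojasiewicz distribution $\mathsf U$ with $\mathsf U'=\mathsf u$, $\mathsf U(a)=0$, such that there exist a countable set $E$ and a Lebesgue null set $Z$ with $\mathsf u^-_{\phi,0}(x)\ge f(x)$ for all $x\in[a,b]\setminus Z$, $\phi\in\mathcal T_0$, and $\mathsf u^-_{\phi,0}(x)>-\infty$ for all $x\in[a,b]\setminus E$, $\phi\in\mathcal T_1$. A minor distributional pair $(\mathsf v,\mathsf V)$ for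 $f$ consists of $\mathsf v\in\mathcal E'[a,b]$ and a Łojasiewicz distribution $\mathsf V$ with $\mathsf V'=\mathsf v$, $\mathsf V(a)=0$, such that there exist a countable set $E$ and a null set $Z$ with $\mathsf v^+_{\phi,0}(x)\le f(x)$ for all $x\in[a,b]\setminus Z$, $\phi\in\mathcal T_0$, and $\mathsf v^+_{\phi,0}(x)<\infty$ for all $x\in[a,b]\setminus E$, $\phi\in\mathcal T_1$. The function $f$ is distributionally integrable over $[a,b]$ if it has both major and minor pairs and $\sup\mathsf V(b)=\inf\mathsf U(b)$ (sup over minor pairs, inf over major pairs); the common value is $(\mathfrak{dist})\int_a^bf(x)\,dx$. Integrability and the integral do not change if $f$ is modified on a null set; integrable functions are finite almost everywhere. *)

(* Defs.v *)
From HB Require Import structures.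
From mathcomp Require Import all_boot all_order all_algebra.
From mathcomp Require Import all_classical all_reals all_analysis.
From mathcomp Require Import measurable_realfun.
Set Implicit Arguments.
Unset Strict Implicit.
Unset Printing Implicit Defensive.
Import Order.TTheory GRing.Theory Num.Theory.
Import numFieldNormedType.Exports.
Local Open Scope classical_set_scope.
Local Open Scope ring_scope.

Section Distributions.
Context {R : realType}.
Implicit Types (phi psi chi : R -> R) (K : set R) (x y t : R).

Definition smooth phi := forall n x, derivable (derive1n n phi) x 1.

Definition tsupport phi : set R := closure [set x | phi x != 0].

Definition test_function phi := smooth phi /\ compact (tsupport phi).

(* Continuity on D(R) is expressed by the usual seminorm estimates on each
   compact set.  The functional is total on [R -> R], but its values outside
   D(R) carry no information. *)
Record schwartz_dist := SchwartzDist {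
  dist_fun :> (R -> R) -> R ;
  dist_linear : forall (c : R) phi psi,
    test_function phi -> test_function psi ->
    dist_fun (fun x => c * phi x + psi x) = c * dist_fun phi + dist_fun psi ;
  dist_continuous : forall K, compact K ->
    exists (N : nat) (C : R), forall phi (M : R),
      test_function phi -> tsupport phi `<=` K ->
      (forall n x, (n <= N)%N -> `|derive1n n phi x| <= M) ->
      `|dist_fun phi| <= C * M }.

Implicit Types u v U V : schwartz_dist.

Definition supported_in K u := forall phi, test_function phi ->
  tsupport phi `&` K = set0 -> u phi = 0.

Definition is_derivative U u :=
  forall phi, test_function phi -> u phi = - U (derive1 phi).

Definition cutoff K chi := test_function chi /\
  exists W : set R, [/\ open W, K `<=` W & forall x, W x -> chi x = 1].

(* The canonical extension to C^oo(R) of a compactly supported distribution: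
   <u, psi> := <u, chi psi> for any chi in D(R) equal to 1 near a compact set
   that carries u; the value does not depend on the choices. *)
Definition pairing u psi : R :=
  get [set r | exists K chi, [/\ compact K, supported_in K u,
    cutoff K chi & r = u (fun y => chi y * psi y)]].

(* y |-> phi ((y - x) / t), so that <g(x + ty), phi(y)> is
   |t|^-1 <g, rescale x t phi> *)
Definition rescale x t phi : R -> R := fun y => phi ((y - x) / t).

Definition point_value U x (c : R) := forall phi, test_function phi ->
  (fun e : R => `|e|^-1 * U (rescale x e phi)) @ 0^' -->
  c * \int[lebesgue_measure]_y phi y.

Definition lojasiewicz U := forall x, exists c, point_value U x c.

Definition T0 phi := [/\ smooth phi, (forall x, 0 <= phi x),
  (\int[lebesgue_measure]_x (phi x)%:E = 1)%E &
  exists2 alpha : R, alpha < -1 & forall m : nat, exists C A : R,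
    forall x, A < `|x| -> `|derive1n m phi x| <= C * `|x| `^ (alpha - m%:R)].

Definition T1 phi := T0 phi /\ forall x, x * derive1 phi x <= 0.

Definition upper_value u phi x : \bar R :=
  limf_esup (fun t : R => (`|t|^-1 * pairing u (rescale x t phi))%:E) 0^'+.

Definition lower_value u phi x : \bar R :=
  limf_einf (fun t : R => (`|t|^-1 * pairing u (rescale x t phi))%:E) 0^'+.

End Distributions.
Arguments schwartz_dist R : clear implicits.

Section Integral.
Context {R : realType}.
Implicit Types (a b : R) (f k : R -> \bar R) (u v U V : schwartz_dist R).
Local Open Scope ereal_scope.

(* Only the values of f on [a, b] are used. *)
Definition major_pair a b f u U :=
  [/\ supported_in `[a, b] u, lojasiewicz U, is_derivative U u,
      point_value U a 0 &
      exists E Z : set R,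
        [/\ countable E, lebesgue_measure.-negligible Z,
            (forall x phi, `[a, b]%classic x -> ~ Z x -> T0 phi ->
               f x <= lower_value u phi x) &
            (forall x phi, `[a, b]%classic x -> ~ E x -> T1 phi ->
               -oo < lower_value u phi x)]].

Definition minor_pair a b f v V :=
  [/\ supported_in `[a, b] v, lojasiewicz V, is_derivative V v,
      point_value V a 0 &
      exists E Z : set R,
        [/\ countable E, lebesgue_measure.-negligible Z,
            (forall x phi, `[a, b]%classic x -> ~ Z x -> T0 phi ->
               upper_value v phi x <= f x) &
            (forall x phi, `[a, b]%classic x -> ~ E x -> T1 phi ->
               upper_value v phi x < +oo)]].

Definition major_values a b f : set (\bar R) :=
  [set c%:E | c in [set c : R |
    exists u U, major_pair a b f u U /\ point_value U b c]].

Definition minor_values a b f : set (\bar R) :=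
  [set c%:E | c in [set c : R |
    exists v V, minor_pair a b f v V /\ point_value V b c]].

Definition dist_integrable a b f :=
  [/\ major_values a b f !=set0, minor_values a b f !=set0 &
      ereal_sup (minor_values a b f) = ereal_inf (major_values a b f)].

(* Lebesgue (not merely Borel) measurability on [a, b]. *)
Definition lmeasurable a b f :=
  @measurable_fun _ _
    (g_sigma_algebraType (completed_algebra_gen (@lebesgue_measure R)))
    (\bar R) `[a, b] f.

(* The equality k = k1 + k2 is read almost everywhere: k1 is finite a.e., and
   on the exceptional null set the sum might be of the form oo - oo. *)
Definition dist_infinite a b k :=
  lmeasurable a b k /\
  exists k1 k2 : R -> \bar R,
    [/\ {ae lebesgue_measure, forall x, `[a, b]%classic x -> k x = k1 x + k2 x},
        dist_integrable a b k1,
        {ae lebesgue_measure, forall x, `[a, b]%classic x -> 0 <= k2 x},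
        lmeasurable a b k2 &
        ~ dist_integrable a b k2].

(* The default value 0 is never reached for a measurable k bounded below a.e.
   by an integrable function. *)
Definition dist_integral a b k : \bar R :=
  if `[< dist_integrable a b k >] then ereal_sup (minor_values a b k)
  else if `[< dist_infinite a b k >] then +oo else 0.

End Integral.

(* Main.v *)
(** The crux is a monotonicity theorem.  Let [u] be the derivative of a
    Lojasiewicz distribution [U], and suppose that the averages
    [t^-1 * u (rescale x t kernel)] of [u] have lower limit at least 0 at almost
    every [x] and greater than -oo outside a countable set; then all these averages are
    nonnegative.  A gliding hump turns the existence of a point value into a
    uniform bound on rescaled test functions.  Where this bound is locally
    uniform, [U] is the derivative of a Lipschitz function [W], and the
    hypotheses bound the second differences of [W] from below well enough to
    make [W] convex.  Baire's theorem then rules out points near which the bound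
    is not uniform.

    Applied to [u - v] for a major pair of [g] and a minor pair of [f <= g],
    this gives nonnegative averages of total mass [U b - V b], so that by Fatou's
    lemma [g - f] has an L^1 majorant of integral at most [U b - V b].  Hence
    integrable functions are finite and measurable, and [g - f] is in L^1 with
    integral at most the difference of the integrals.  Conversely, if
    [s >= 0] is in L^1 then [h + s] is integrable: the derivative of
    [int_a^x s] completes major pairs of [h], and that of [int_a^x min(s, N)]
    completes minor pairs.  The theorem is thus the classical Fatou lemma for
    [g_n - h]. *)

Require Import Defs.
From mathcomp Require Import all_boot all_order all_algebra.
From mathcomp Require Import all_classical all_reals all_analysis.
From mathcomp Require Import measurable_realfun ring lra.
Set Implicit Arguments.
Unset Strict Implicit.
Unset Printing Implicit Defensive.
Import Order.TTheory GRing.Theory Num.Theory.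
Import numFieldNormedType.Exports.
Local Open Scope classical_set_scope.
Local Open Scope ring_scope.

(** * Calculus of smooth functions *)

(** A single test function carries the monotonicity theorem. [kernel] lies in [T1] and its second
    derivative at x is curv(x) - 2 curv(2 x), with [curv] nonnegative. Where U is the derivative of
    W, the square of t times the average of u at scale t is therefore the difference between scales
    t and t/2 of one quantity, the second differences of W weighted by [curv]. Along dyadic scales
    this telescopes, and lower bounds on averages of u become lower bounds on second differences.
    The two exceptional sets need different tools. The null set is absorbed by a small convex
    function whose second derivative is infinite there. On the countable set nothing is known of u,
    but the point values of U exclude concave corners of W, so that each exceptional point can stop
    only one slope. Truncation enters for minor pairs only: off a countable set their upper values
    must be finite, which bounded densities guarantee, while for major pairs nonnegative averages
    are enough to keep lower values above -oo. *)

Definition has_deriv {R : realType} (f g : R -> R) :=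
  forall x : R, is_derive x (1 : R) f (g x).

Section Derivatives.
Context {R : realType}.
Implicit Types (f g : R -> R) (c d x : R).

Lemma has_deriv_derive1 f g : has_deriv f g -> derive1 f = g.
Proof.
by move=> fg; apply/funext => x; rewrite derive1E; have [_ ->] := fg x.
Qed.

Lemma has_deriv_derivable f g x : has_deriv f g -> derivable f x 1.
Proof. by move=> fg; have [] := fg x. Qed.

Lemma has_deriv_continuous f g : has_deriv f g -> continuous f.
Proof.
move=> fg x; apply: differentiable_continuous.
by apply/derivable1_diffP/has_deriv_derivable.
Qed.

Lemma has_derivP f : (forall x, derivable f x 1) -> has_deriv f (derive1 f).
Proof. by move=> df x; rewrite derive1E; exact: DeriveDef. Qed.

Lemma has_deriv_eq f g g' : has_deriv f g -> g =1 g' -> has_deriv f g'.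
Proof. by move=> + /funext <-. Qed.

Lemma has_deriv_cst c : has_deriv (fun=> c) (fun=> 0).
Proof. by move=> x; exact: is_derive_cst. Qed.

Lemma has_deriv_id : has_deriv (fun x : R => x) (fun=> 1).
Proof. by move=> x; exact: is_derive_id. Qed.

Lemma has_derivD f f' g g' : has_deriv f f' -> has_deriv g g' ->
  has_deriv (fun x => f x + g x) (fun x => f' x + g' x).
Proof. by move=> df dg x; exact: (is_deriveD (df x) (dg x)). Qed.

Lemma has_derivM f f' g g' : has_deriv f f' -> has_deriv g g' ->
  has_deriv (fun x => f x * g x) (fun x => f' x * g x + f x * g' x).
Proof.
move=> df dg x; have := is_deriveM (df x) (dg x).
move=> h; apply: is_derive_eq h _.
by rewrite /GRing.scale/= addrC mulrC.
Qed.

Lemma has_derivZ c f f' : has_deriv f f' ->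
  has_deriv (fun x => c * f x) (fun x => c * f' x).
Proof.
move=> df; apply: has_deriv_eq (has_derivM (has_deriv_cst c) df) _ => x.
by rewrite mul0r add0r.
Qed.

Lemma has_derivN f f' : has_deriv f f' ->
  has_deriv (fun x => - f x) (fun x => - f' x).
Proof. by move=> df x; exact: (is_deriveN (df x)). Qed.

Lemma has_derivB f f' g g' : has_deriv f f' -> has_deriv g g' ->
  has_deriv (fun x => f x - g x) (fun x => f' x - g' x).
Proof. by move=> df dg; apply: has_derivD => //; exact: has_derivN. Qed.

Lemma has_deriv_comp f f' g g' : has_deriv f f' -> has_deriv g g' ->
  has_deriv (fun x => f (g x)) (fun x => g' x * f' (g x)).
Proof.
move=> df dg x; have := is_derive1_comp (df (g x)) (dg x).
by rewrite mulrC.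
Qed.

Lemma has_deriv_affine f f' c d : has_deriv f f' ->
  has_deriv (fun x => f (c * x + d)) (fun x => c * f' (c * x + d)).
Proof.
move=> df; apply: has_deriv_comp => //.
apply: has_deriv_eq (has_derivD (has_derivZ c has_deriv_id) (has_deriv_cst d)) _.
by move=> x; rewrite mulr1 addr0.
Qed.

Lemma mean_value f f' x y : has_deriv f f' -> x <= y ->
  exists c, [/\ x <= c, c <= y & f y - f x = f' c * (y - x)].
Proof.
move=> df xy; have [|c] := @MVT_segment R f f' x y xy (fun z _ => df z).
  by apply: continuous_subspaceT; exact: has_deriv_continuous df.
by rewrite in_itv/= => /andP[xc cy] e; exists c.
Qed.

Lemma has_deriv_ge0 f f' x y : has_deriv f f' -> x <= y ->
  (forall z, x <= z -> z <= y -> 0 <= f' z) -> f x <= f y.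
Proof.
move=> df xy p; have [c [xc cy e]] := mean_value df xy.
by rewrite -subr_ge0 e mulr_ge0 ?p ?subr_ge0.
Qed.

Lemma has_deriv_norm_le f f' C x y : has_deriv f f' -> x <= y ->
  (forall z, x <= z -> z <= y -> `|f' z| <= C) -> `|f y - f x| <= C * (y - x).
Proof.
move=> df xy p; have [c [xc cy e]] := mean_value df xy.
by rewrite e normrM (ger0_norm (_ : 0 <= y - x)) ?subr_ge0// ler_wpM2r ?subr_ge0 ?p.
Qed.

Lemma has_deriv_lipschitz f f' C x y : has_deriv f f' ->
  (forall z, `|f' z| <= C) -> `|f y - f x| <= C * `|y - x|.
Proof.
move=> df p; have [xy|/ltW yx] := leP x y.
  by rewrite (ger0_norm (_ : 0 <= y - x)) ?subr_ge0//; apply: has_deriv_norm_le df _ _.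
rewrite distrC (distrC y) (ger0_norm (_ : 0 <= x - y)) ?subr_ge0//.
exact: has_deriv_norm_le df _ _.
Qed.

Lemma has_deriv0_cst f x y : has_deriv f (fun=> 0) -> f x = f y.
Proof.
move=> df; apply/eqP; rewrite -subr_eq0 -normr_le0.
by have := has_deriv_lipschitz y x df (fun z => eq_ind _ (fun u => u <= 0) (lexx 0) _ (esym (normr0 R))); rewrite mul0r.
Qed.

Lemma taylor1 f f' f'' C x h : has_deriv f f' -> has_deriv f' f'' ->
  (forall z, `|f'' z| <= C) ->
  `|f (x + h) - f x - h * f' x| <= C * h ^+ 2.
Proof.
move=> df df' p.
have dg : has_deriv (fun t => f (h * t + x) - t * (h * f' x))
    (fun t => h * (f' (h * t + x) - f' x)).
  apply: has_deriv_eq (has_derivB (has_deriv_affine h x df)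
    (has_derivM has_deriv_id (has_deriv_cst (h * f' x)))) _ => t.
  by rewrite mulr0 addr0 mul1r mulrBr.
have := @has_deriv_norm_le _ _ (C * h ^+ 2) 0 1 dg ler01.
rewrite mulr1 mulr0 add0r mul0r mul1r !subr0 mulr1 (addrC h).
rewrite (_ : _ - _ - f x = f (x + h) - f x - h * f' x); last by lra.
apply => t t0 t1; rewrite normrM.
have H : `|f' (h * t + x) - f' x| <= C * `|h|.
  have := has_deriv_lipschitz x (h * t + x) df' p.
  rewrite addrK normrM (ger0_norm t0) => /le_trans; apply.
  rewrite ler_wpM2l ?(le_trans (normr_ge0 _) (p 0))//.
  by rewrite ler_piMr.
apply: le_trans (ler_wpM2l (normr_ge0 h) H) _.
by rewrite mulrCA -expr2 real_normK ?num_real.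
Qed.

(** Derivatives of a distribution along a parameter and of a series are accessible only through
    estimates; a quadratic remainder is what Taylor's formula supplies uniformly, and it survives
    limits. *)
Lemma is_derive_quadratic f z (l : R) C d : 0 < d ->
  (forall h, `|h| < d -> `|f (z + h) - f z - h * l| <= C * h ^+ 2) ->
  is_derive z (1 : R) f l.
Proof.
move=> d0 key.
have H : (fun h : R => h^-1 *: (f (h *: 1 + z) - f z)) @ 0^' --> l.
  apply/cvgrPdist_le => e e0; near=> h.
  have hN0 : h != 0 by near: h; exact: nbhs_dnbhs_neq.
  have hd : `|h| < d by near: h; exact: dnbhs0_lt.
  rewrite /GRing.scale/= mulr1 (addrC h).
  rewrite (_ : _ - _ = - h^-1 * (f (z + h) - f z - h * l)); last by field.
  rewrite normrM normrN; apply: le_trans (ler_wpM2l (normr_ge0 _) (key h hd)) _.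
  rewrite normfV mulrCA -(real_normK (num_real h)) expr2 mulKf ?normr_eq0//.
  have : `|h| <= e / (`|C| + 1).
    near: h; apply: dnbhs0_le; rewrite divr_gt0// ltr_pwDr//.
  rewrite ler_pdivlMr ?ltr_pwDr// => he; apply: le_trans he.
  rewrite mulrC ler_wpM2l//; apply: le_trans (ler_norm _) _.
  by rewrite lerDl.
by apply: DeriveDef; [apply/cvg_ex; exists l|exact/cvg_lim].
Unshelve. all: by end_near. Qed.

End Derivatives.

(** * Stability properties of smooth functions *)

Section Smooth.
Context {R : realType}.
Implicit Types (f g : R -> R) (c d x : R).

(** Avoids formulas for higher derivatives: it is enough to place the function in a class that is
    stable under differentiation. *)
Lemma smooth_coind (P : (R -> R) -> Prop) :
  (forall f, P f -> exists2 g, has_deriv f g & P g) ->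
  forall f, P f -> smooth f.
Proof.
move=> Pd f Pf n x; suff : P (derive1n n f).
  by move=> /Pd[g dg _]; exact: has_deriv_derivable dg.
elim: n => [//|n IHn]; rewrite derive1nS.
by have [g dg Pg] := Pd _ IHn; rewrite (has_deriv_derive1 dg).
Qed.

Lemma smooth_deriv f : smooth f -> has_deriv f (derive1 f).
Proof. by move=> sf; apply: has_derivP => x; exact: (sf 0%N). Qed.

Lemma smooth_derive1 f : smooth f -> smooth (derive1 f).
Proof. by move=> sf n x; have := sf n.+1 x; rewrite derive1Sn. Qed.

Lemma smooth_derive1n n f : smooth f -> smooth (derive1n n f).
Proof.
by move=> sf; elim: n => [|n IHn]; [exact: sf|rewrite derive1nS; exact: smooth_derive1 IHn].
Qed.

Lemma smooth_continuous f : smooth f -> continuous f.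
Proof. by move=> /smooth_deriv; exact: has_deriv_continuous. Qed.

Lemma smooth_antideriv f g : has_deriv f g -> smooth g -> smooth f.
Proof.
move=> fg sg [|n] x; first exact: has_deriv_derivable fg.
by rewrite derive1Sn (has_deriv_derive1 fg).
Qed.

(** The product and chain rules mix sums, products and affine substitutions, so stability under
    differentiation holds for the three operations together rather than for each alone. *)
Inductive smooth_closure : (R -> R) -> Prop :=
| smooth_closure_base f : smooth f -> smooth_closure f
| smooth_closureD f g : smooth_closure f -> smooth_closure g ->
    smooth_closure (fun x => f x + g x)
| smooth_closureM f g : smooth_closure f -> smooth_closure g ->
    smooth_closure (fun x => f x * g x)
| smooth_closure_affine c d f : smooth_closure f ->
    smooth_closure (fun x => f (c * x + d)).

Lemma smooth_cst c : smooth (fun=> c : R).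
Proof.
apply: (@smooth_coind (fun f => exists c, f = fun=> c)); last by exists c.
by move=> _ [e ->]; exists (fun=> 0); [exact: has_deriv_cst|exists 0].
Qed.

Lemma smooth_closureP f : smooth_closure f -> smooth f.
Proof.
move: f; apply: smooth_coind => f; elim=> {f}.
- move=> f sf; exists (derive1 f); first exact: smooth_deriv.
  by constructor; exact: smooth_derive1.
- move=> f g _ [f' df sf'] _ [g' dg sg'].
  by exists (fun x => f' x + g' x); [exact: has_derivD|exact: smooth_closureD].
- move=> f g sf [f' df sf'] sg [g' dg sg'].
  exists (fun x => f' x * g x + f x * g' x); first exact: has_derivM.
  by apply: smooth_closureD; exact: smooth_closureM.
- move=> c d f _ [f' df sf'].
  exists (fun x => c * f' (c * x + d)); first exact: has_deriv_affine.
  apply: smooth_closureM; last exact: smooth_closure_affine.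
  by constructor; exact: smooth_cst.
Qed.

Lemma smoothD f g : smooth f -> smooth g -> smooth (fun x => f x + g x).
Proof.
by move=> sf sg; apply: smooth_closureP; apply: smooth_closureD; constructor.
Qed.

Lemma smoothM f g : smooth f -> smooth g -> smooth (fun x => f x * g x).
Proof.
by move=> sf sg; apply: smooth_closureP; apply: smooth_closureM; constructor.
Qed.

Lemma smooth_affine c d f : smooth f -> smooth (fun x => f (c * x + d)).
Proof.
by move=> sf; apply: smooth_closureP; apply: smooth_closure_affine; constructor.
Qed.

Lemma smoothZ c f : smooth f -> smooth (fun x => c * f x).
Proof. by move=> sf; exact: smoothM (@smooth_cst c) sf. Qed.

Lemma smoothN f : smooth f -> smooth (fun x => - f x).
Proof.
move=> /(@smoothZ (-1)) sf; suff -> : (fun x => - f x) = (fun x => -1 * f x) by [].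
by apply/funext => x; rewrite mulN1r.
Qed.

Lemma smoothB f g : smooth f -> smooth g -> smooth (fun x => f x - g x).
Proof. by move=> sf sg; exact: smoothD sf (smoothN sg). Qed.

Lemma derive1nD f g n : smooth f -> smooth g ->
  derive1n n (fun x => f x + g x) = fun x => derive1n n f x + derive1n n g x.
Proof.
move=> sf sg; elim: n => // n IHn; rewrite !derive1nS IHn.
apply: has_deriv_derive1; apply: has_derivD; apply: smooth_deriv;
  exact: smooth_derive1n.
Qed.

Lemma derive1nZ f c n : smooth f ->
  derive1n n (fun x => c * f x) = fun x => c * derive1n n f x.
Proof.
move=> sf; elim: n => // n IHn; rewrite !derive1nS IHn.
by apply: has_deriv_derive1; apply: has_derivZ; apply: smooth_deriv;
  exact: smooth_derive1n.
Qed.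

Lemma derive1n_affine f c d n : smooth f ->
  derive1n n (fun x => f (c * x + d)) =
  fun x => c ^+ n * derive1n n f (c * x + d).
Proof.
move=> sf; elim: n => [|n IHn].
  by apply/funext => x; rewrite expr0 mul1r.
rewrite !derive1nS IHn; apply: has_deriv_derive1.
have /smooth_deriv/(has_deriv_affine c d)/(has_derivZ (c ^+ n)) := @smooth_derive1n n f sf.
by move=> /has_deriv_eq; apply => x; rewrite mulrA exprSr.
Qed.

Lemma derive1n_eq0 f n x : (\forall y \near x, f y = 0) -> derive1n n f x = 0.
Proof.
move=> fx; suff : \forall y \near x, derive1n n f y = 0 by move=> /nbhs_singleton.
elim: n => // n IHn.
have {IHn} /nbhs_interior := IHn; apply: filterS => y y0.
rewrite derive1nS derive1E.
rewrite (@near_eq_derive _ _ _ _ (cst 0))//; first exact: derive_cst.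
Qed.

Lemma derive1n_zero n x : derive1n n (fun _ : R => 0 : R) x = 0.
Proof.
by apply: derive1n_eq0; near=> y.
Unshelve. all: by end_near. Qed.

(* Leibniz' rule gives the factor 2 ^ n. *)
Lemma derive1nM_le f g n (A B : R) x : smooth f -> smooth g ->
  (forall k, (k <= n)%N -> `|derive1n k f x| <= A) ->
  (forall k, (k <= n)%N -> `|derive1n k g x| <= B) ->
  forall k, (k <= n)%N ->
  `|derive1n k (fun x => f x * g x) x| <= 2 ^+ n * (A * B).
Proof.
move=> sf sg fA gB.
have A0 : 0 <= A by apply: le_trans (fA 0%N _).
have B0 : 0 <= B by apply: le_trans (gB 0%N _).
suff H m f1 g1 k : smooth f1 -> smooth g1 ->
    (forall i, (i <= m)%N -> `|derive1n i f1 x| <= A) ->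
    (forall i, (i <= m)%N -> `|derive1n i g1 x| <= B) ->
    (k <= m)%N -> `|derive1n k (fun x => f1 x * g1 x) x| <= 2 ^+ k * (A * B).
  move=> k kn; apply: le_trans (H n f g k sf sg fA gB kn) _.
  by rewrite ler_wpM2r ?mulr_ge0// ler_weXn2l// ler1n.
elim: k m f1 g1 => [m|k IHk [//|m]] f1 g1 sf1 sg1 f1A g1B kn.
- by rewrite expr0 mul1r normrM ler_pM// ?(f1A 0%N)// (g1B 0%N).
rewrite derive1Sn.
rewrite (has_deriv_derive1 (has_derivM (smooth_deriv sf1) (smooth_deriv sg1))).
have [sf1' sg1'] := (smooth_derive1 sf1, smooth_derive1 sg1).
rewrite derive1nD; [|exact: smoothM sf1' sg1|exact: smoothM sf1 sg1'].
rewrite exprS -mulrA mulr_natl mulr2n; apply: le_trans (ler_normD _ _) _.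
apply: lerD.
- apply: (IHk m _ _ sf1' sg1) => //.
  + by move=> i im; rewrite -derive1Sn f1A.
  + by move=> i im; apply: g1B; exact: leqW.
- apply: (IHk m _ _ sf1 sg1') => //.
  + by move=> i im; apply: f1A; exact: leqW.
  + by move=> i im; rewrite -derive1Sn g1B.
Qed.

End Smooth.
Arguments smooth_affine {R} c d [f] _.

(** * Oriented integrals of continuous functions *)

Section ContinuousIntegral.
Context {R : realType}.
Implicit Types (f g F G : R -> R) (c d x y C : R).
Local Notation mu := (@lebesgue_measure R).

Lemma ctsD f g : continuous f -> continuous g -> continuous (fun x => f x + g x).
Proof. by move=> cf cg x; exact: (cvgD (cf x) (cg x)). Qed.

Lemma ctsN f : continuous f -> continuous (fun x => - f x).
Proof. by move=> cf x; exact: (cvgN (cf x)). Qed.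

Lemma ctsB f g : continuous f -> continuous g -> continuous (fun x => f x - g x).
Proof. by move=> cf cg; apply: ctsD => //; exact: ctsN. Qed.

Lemma ctsM f g : continuous f -> continuous g -> continuous (fun x => f x * g x).
Proof. by move=> cf cg x; exact: (cvgM (cf x) (cg x)). Qed.

Lemma cts_cst C : continuous (fun _ : R => C).
Proof. by move=> x; exact: cvg_cst. Qed.

Lemma ctsZ f C : continuous f -> continuous (fun x => C * f x).
Proof. by move=> cf; apply: ctsM => //; exact: cts_cst. Qed.

Lemma cts_affine f c d : continuous f -> continuous (fun x => f (c * x + d)).
Proof.
move=> cf x; apply: (@continuous_comp _ _ _ (fun x => c * x + d) f); last exact: cf.
by apply: (@ctsD (fun x => c * x)); [apply: ctsZ => ?; exact: cvg_id|exact: cts_cst].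
Qed.

(** An antiderivative on the whole line with base point 0. Its increments [cint] are oriented
    integrals: additivity and the change of sign under exchange of the bounds become arithmetic. *)
Definition primitive f : R -> R := fun x =>
  if 0 <= x then \int[mu]_(y in `[0, x]) f y else - \int[mu]_(y in `[x, 0]) f y.

Lemma continuous_integrable f c d : continuous f ->
  mu.-integrable `[c, d] (EFin \o f).
Proof.
move=> cf; apply: continuous_compact_integrable; first exact: segment_compact.
by apply: continuous_subspaceT.
Qed.

Lemma primitive_segment f (N x : R) : continuous f -> - N < 0 -> - N < x ->
  primitive f x = \int[mu]_(y in `[- N, x]) f y - \int[mu]_(y in `[- N, 0]) f y.
Proof.
move=> cf N0 Nx; rewrite /primitive; case: ifPn => [x0|]; last rewrite -ltNge => x0.
- have [i1 i2] := (ltW N0, ltW Nx).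
  rewrite (@Rintegral_itvB _ f (BLeft (- N)) (BRight x) 0) ?bnd_simp//; last first.
    exact: continuous_integrable.
  rewrite Rintegral_itv_obnd_cbnd//.
  apply: integrableS (@continuous_integrable f 0 x cf) => //.
  by apply: subset_itvr; rewrite bnd_simp.
- apply/eqP; rewrite eqr_oppLR opprB; apply/eqP.
  have [i1 [i2 i3]] := (ltW N0, (ltW Nx, ltW x0)).
  rewrite (@Rintegral_itvB _ f (BLeft (- N)) (BRight 0) x) ?bnd_simp//; last first.
    exact: continuous_integrable.
  rewrite Rintegral_itv_obnd_cbnd//.
  apply: integrableS (@continuous_integrable f x 0 cf) => //.
  by apply: subset_itvr; rewrite bnd_simp.
Qed.

Lemma primitive_deriv f : continuous f -> has_deriv (primitive f) f.
Proof.
(* The base point is moved to - N, to the left of both 0 and x, so that near x a single integral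
   with variable upper bound represents [primitive]. *)
move=> cf x; set N := `|x| + 1.
have N0 : - N < 0 by rewrite oppr_lt0 ltr_pwDr.
have Nx : - N < x by have := ler_norm (- x); rewrite normrN /N; lra.
have [dF F'] := @continuous_FTC1_closed R f (- N) x (x + 1)
  (ltr_pwDr ltr01 (lexx x)) (@continuous_integrable f _ _ cf) Nx (cf x).
have H : is_derive x (1 : R) (fun x => \int[mu]_(y in `[- N, x]) f y) (f x).
  by rewrite -[X in is_derive _ _ _ X]F' derive1E; exact: DeriveDef.
have := is_deriveB H (is_derive_cst (\int[mu]_(y in `[- N, 0]) f y) x (1:R)).
rewrite subr0; apply: near_eq_is_derive.
have : \forall y \near x, - N < y by exact: lt_nbhsr.
by apply: filterS => y Ny; rewrite /= (primitive_segment cf N0 Ny).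
Qed.

Definition cint f c d := primitive f d - primitive f c.

Lemma cint_deriv F f c d : continuous f -> has_deriv F f ->
  cint f c d = F d - F c.
Proof.
move=> cf dF.
have := has_deriv0_cst c d (has_deriv_eq (has_derivB (primitive_deriv cf) dF) (fun x => subrr _)).
by rewrite /cint; lra.
Qed.

Lemma cint_rint f c d : continuous f -> c <= d ->
  cint f c d = \int[mu]_(y in `[c, d]) f y.
Proof.
move=> cf; rewrite le_eqVlt => /predU1P[->|cd].
  by rewrite /cint subrr set_itv1 Rintegral_set1.
rewrite /Rintegral (@continuous_FTC2 R f (primitive f))//.
- exact: continuous_subspaceT.
- have dp := primitive_deriv cf; split=> [x _|/=|/=].
  + exact: has_deriv_derivable dp.
  + apply: cvg_at_right_filter; exact: (has_deriv_continuous dp).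
  + apply: cvg_at_left_filter; exact: (has_deriv_continuous dp).
- by move=> x _; rewrite (has_deriv_derive1 (primitive_deriv cf)).
Qed.

Lemma cint_split f c d x : cint f c d = cint f c x + cint f x d.
Proof. by rewrite /cint; lra. Qed.

Lemma cintxx f c : cint f c c = 0.
Proof. exact: subrr. Qed.

Lemma cintD f g c d : continuous f -> continuous g ->
  cint (fun x => f x + g x) c d = cint f c d + cint g c d.
Proof.
move=> cf cg; rewrite (cint_deriv (F := fun x => primitive f x + primitive g x)).
- by rewrite /cint; lra.
- exact: ctsD.
- by apply: has_derivD; exact: primitive_deriv.
Qed.

Lemma cintZ f C c d : continuous f -> cint (fun x => C * f x) c d = C * cint f c d.
Proof.
move=> cf; rewrite (cint_deriv (F := fun x => C * primitive f x)).
- by rewrite /cint; lra.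
- exact: ctsZ.
- by apply: has_derivZ; exact: primitive_deriv.
Qed.

Lemma cintB f g c d : continuous f -> continuous g ->
  cint (fun x => f x - g x) c d = cint f c d - cint g c d.
Proof.
move=> cf cg; rewrite (cint_deriv (F := fun x => primitive f x - primitive g x)).
- by rewrite /cint; lra.
- exact: ctsB.
- by apply: has_derivB; exact: primitive_deriv.
Qed.

Lemma cint_cst C c d : cint (fun=> C) c d = C * (d - c).
Proof.
rewrite (cint_deriv (F := fun x => C * x)) ?mulrBr//; first exact: cts_cst.
by apply: has_deriv_eq (has_derivZ C has_deriv_id) _ => x; rewrite mulr1.
Qed.

Lemma cint_norm_le f C c d : continuous f -> c <= d ->
  (forall x, c <= x -> x <= d -> `|f x| <= C) -> `|cint f c d| <= C * (d - c).
Proof. by move=> cf cd fC; apply: has_deriv_norm_le (primitive_deriv cf) cd fC. Qed.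

Lemma cint_ge0 f c d : continuous f -> c <= d ->
  (forall x, c <= x -> x <= d -> 0 <= f x) -> 0 <= cint f c d.
Proof.
by move=> cf cd f0; rewrite subr_ge0; apply: has_deriv_ge0 (primitive_deriv cf) cd f0.
Qed.

Lemma cint_le f g c d : continuous f -> continuous g -> c <= d ->
  (forall x, c <= x -> x <= d -> f x <= g x) -> cint f c d <= cint g c d.
Proof.
move=> cf cg cd fg; rewrite -subr_ge0 -cintB//; apply: cint_ge0 => //.
- exact: ctsB.
- by move=> x cx xd; rewrite subr_ge0 fg.
Qed.

Lemma eq_cint f g c d : continuous f -> continuous g -> c <= d ->
  (forall x, c <= x -> x <= d -> f x = g x) -> cint f c d = cint g c d.
Proof.
move=> cf cg cd fg; apply/eqP; rewrite eq_le; apply/andP.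
by split; apply: cint_le => // x cx xd; rewrite fg.
Qed.

Lemma cint_parts F f G g c d : has_deriv F f -> has_deriv G g ->
  continuous f -> continuous g ->
  cint (fun x => F x * g x) c d = F d * G d - F c * G c - cint (fun x => f x * G x) c d.
Proof.
move=> dF dG cf cg.
have cF := has_deriv_continuous dF; have cG := has_deriv_continuous dG.
have cfG := ctsM cf cG; have cFg := ctsM cF cg.
have := cint_deriv c d (ctsD cfG cFg) (has_derivM dF dG).
by rewrite cintD// => <-; lra.
Qed.

Lemma cint_affine f C x c d : continuous f ->
  cint f (C * c + x) (C * d + x) = C * cint (fun y => f (C * y + x)) c d.
Proof.
move=> cf; rewrite -cintZ; last exact: cts_affine.
rewrite [RHS](cint_deriv (F := fun y => primitive f (C * y + x)))//.
- by apply: ctsZ; exact: cts_affine.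
- by apply: has_deriv_affine; exact: primitive_deriv.
Qed.

End ContinuousIntegral.

(** * The flat functions x^-m exp(-1/x) *)

Section Flat.
Context {R : realType}.
Implicit Types (x y : R) (f : R -> R).

(** Differentiating exp(-1/x) produces negative powers of x; with them included, the linear span is
    stable under differentiation. *)
Definition flat (m : nat) x : R := if 0 < x then x^-1 ^+ m * expR (- x^-1) else 0.

Lemma flat_ge0 m x : 0 <= flat m x.
Proof.
rewrite /flat; case: ifPn => // x0.
by rewrite mulr_ge0 ?expR_ge0// exprn_ge0// invr_ge0 ltW.
Qed.

Lemma flat_gt0 m x : 0 < x -> 0 < flat m x.
Proof. by move=> x0; rewrite /flat x0 mulr_gt0 ?expR_gt0// exprn_gt0// invr_gt0. Qed.

Lemma flat_eq0 m x : x <= 0 -> flat m x = 0.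
Proof. by rewrite /flat leNgt => /negbTE ->. Qed.

(** From y^(m+2) / (m+2)! <= exp y at y = 1/x. The square is what gives derivative 0 at the
    origin. *)
Lemma flat_le m x : flat m x <= (m.+2)`!%:R * x ^+ 2.
Proof.
rewrite /flat; case: ifPn => [x0|_]; last by rewrite mulr_ge0 ?sqr_ge0.
have y0 : 0 < x^-1 by rewrite invr_gt0.
have /(le_trans (ler_wpDl ler01 (lexx _))) := expR_ge1Dxn m.+1 (ltW y0).
rewrite ler_pdivrMr ?ltr0n ?fact_gt0// => H.
rewrite expRN ler_pdivrMr ?expR_gt0// mulrAC.
have -> : x ^+ 2 = (x^-1 ^+ 2)^-1 by rewrite exprVn invrK.
by rewrite ler_pdivlMr ?exprn_gt0// -exprD addn2 mulrC.
Qed.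

Lemma flat_deriv m : has_deriv (flat m) (fun x => flat m.+2 x - m%:R * flat m.+1 x).
Proof.
move=> x; have [x0|x0|->] := ltgtP x 0.
- apply: near_eq_is_derive (_ : is_derive x 1 (cst 0) _).
    have : \forall y \near x, y < 0 by exact: lt_nbhsl.
    by apply: filterS => y /ltW y0; rewrite flat_eq0.
  by rewrite !flat_eq0 ?mulr0 ?subrr ?(ltW x0)//; exact: is_derive_cst.
- have xN0 : x != 0 by rewrite gt_eqF.
  apply: (@near_eq_is_derive _ _ _ (fun y => y^-1 ^+ m * expR (- y^-1))).
    have : \forall y \near x, 0 < y by exact: lt_nbhsr.
    by apply: filterS => y y0; rewrite /flat y0.
  have dI : is_derive x 1 (fun y : R => y^-1) (- x ^- 2).
    have := @is_deriveV R id x 1 1 xN0 (is_derive_id _ _).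
    by move=> h; apply: is_derive_eq h _; rewrite /GRing.scale/= mulr1.
  have dX : is_derive x 1 (fun y : R => y^-1 ^+ m) (m%:R * x^-1 ^+ m.-1 * - x ^- 2).
    rewrite (_ : (fun y : R => y^-1 ^+ m) = (fun y : R => y^-1) ^+ m).
      by apply: is_derive_eq (is_deriveX m dI) _; rewrite /GRing.scale.
    by apply/funext => y; rewrite exprfctE.
  have dE : is_derive x 1 (fun y : R => expR (- y^-1)) (expR (- x^-1) * x ^- 2).
    have dN : is_derive x 1 (fun y : R => - y^-1) (x ^- 2).
      by apply: is_derive_eq (is_deriveN dI) _; rewrite opprK.
    exact: (@is_derive1_comp _ expR (fun y : R => - y^-1) _ _ _ (is_derive_expR (- x^-1)) dN).
  have := is_deriveM dX dE; move=> h; apply: is_derive_eq h _.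
  rewrite /GRing.scale/= /flat x0 -exprVn.
  case: m {dX} => [|m]; first by rewrite !mul0r mulr0 addr0 subr0; lra.
  by rewrite -pred_Sn !exprS; lra.
rewrite !flat_eq0// mulr0 subr0.
have H : (fun h : R => h^-1 *: (flat m (h *: 1 + 0) - flat m 0)) @ 0^' --> (0 : R).
  apply/cvgrPdist_le => e e0; near=> h.
  rewrite sub0r normrN /GRing.scale/= mulr1 addr0 (flat_eq0 m (lexx 0)) subr0 normrM.
  have hN0 : h != 0 by near: h; exact: nbhs_dnbhs_neq.
  rewrite (ger0_norm (flat_ge0 m h)).
  apply: le_trans (ler_wpM2l (normr_ge0 _) (flat_le m h)) _.
  rewrite normfV mulrCA -(real_normK (num_real h)) expr2 mulKf ?normr_eq0//.
  rewrite -ler_pdivlMl ?ltr0n ?fact_gt0//.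
  near: h; apply: dnbhs0_le; rewrite mulr_gt0// invr_gt0 ltr0n fact_gt0//.
by apply: DeriveDef; [apply/cvg_ex; exists 0|exact/cvg_lim].
Unshelve. all: by end_near. Qed.

Inductive flat_span : (R -> R) -> Prop :=
| flat_span_base m : flat_span (flat m)
| flat_spanD f g : flat_span f -> flat_span g -> flat_span (fun x => f x + g x)
| flat_spanZ c f : flat_span f -> flat_span (fun x => c * f x).

Lemma smooth_flat m : smooth (flat m).
Proof.
apply: (smooth_coind (P := flat_span)); last exact: flat_span_base.
move=> f; elim=> {f m}.
- move=> m; exists (fun x => flat m.+2 x + (- m%:R) * flat m.+1 x).
    by apply: has_deriv_eq (flat_deriv m) _ => x; rewrite mulNr.
  by apply: flat_spanD; [|apply: flat_spanZ]; exact: flat_span_base.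
- move=> f g _ [f' df sf'] _ [g' dg sg'].
  by exists (fun x => f' x + g' x); [exact: has_derivD|exact: flat_spanD].
- move=> c f _ [f' df sf'].
  by exists (fun x => c * f' x); [exact: has_derivZ|exact: flat_spanZ].
Qed.

End Flat.

(** * Bumps, smooth steps and the averaging kernel *)

Section Bumps.
Context {R : realType}.
Implicit Types (x y : R).

Let raw_bump x : R := flat 0 (x - 1 / 2) * flat 0 (1 - x).

Let smooth_raw : smooth raw_bump.
Proof.
apply: smoothM.
- by have := smooth_affine 1 (- (1 / 2)) (@smooth_flat R 0);
    under eq_fun do rewrite mul1r.
- have := smooth_affine (- 1) 1 (@smooth_flat R 0).
  by under eq_fun do rewrite mulN1r addrC.
Qed.

Let raw_ge0 x : 0 <= raw_bump x.
Proof. by rewrite mulr_ge0 ?flat_ge0. Qed.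

Let mass := cint raw_bump (1 / 2) 1.

Let mass_gt0 : 0 < mass.
Proof.
have dp := primitive_deriv (smooth_continuous smooth_raw).
have h1 : primitive raw_bump (1 / 2) <= primitive raw_bump (5 / 8).
  by apply: has_deriv_ge0 dp _ _ => //; lra.
have h3 : primitive raw_bump (7 / 8) <= primitive raw_bump 1.
  by apply: has_deriv_ge0 dp _ _ => //; lra.
have [|c [c1 c2 e]] := @mean_value _ _ _ (5 / 8) (7 / 8) dp; first lra.
have : 0 < raw_bump c by rewrite mulr_gt0// flat_gt0//; lra.
rewrite -(pmulr_rgt0 (x := 7 / 8 - 5 / 8)) -?e => [|]; last by lra.
by rewrite mulrC -e /mass /cint; lra.
Qed.

(* A smooth density carried by [1/2, 1]. *)
Definition bump x : R := mass^-1 * raw_bump x.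

Lemma smooth_bump : smooth bump. Proof. exact: smoothZ. Qed.

Lemma bump_ge0 x : 0 <= bump x.
Proof. by rewrite mulr_ge0// invr_ge0 ltW. Qed.

Lemma bump_eq0 x : x <= 1 / 2 \/ 1 <= x -> bump x = 0.
Proof.
rewrite /bump /raw_bump; case=> hx.
- by rewrite (@flat_eq0 _ _ (x - 1 / 2)) ?mul0r ?mulr0//; lra.
- by rewrite (@flat_eq0 _ _ (1 - x)) ?mulr0//; lra.
Qed.

Definition step x : R := cint bump 0 x.

Lemma step_deriv : has_deriv step bump.
Proof.
have := has_derivB (primitive_deriv (smooth_continuous smooth_bump))
  (has_deriv_cst (primitive bump 0)).
by move=> /has_deriv_eq; apply => x; rewrite subr0.
Qed.

Lemma smooth_step : smooth step.
Proof. exact: smooth_antideriv step_deriv smooth_bump. Qed.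

Lemma step_le x y : x <= y -> step x <= step y.
Proof. by move=> xy; apply: has_deriv_ge0 step_deriv xy _ => z _ _; exact: bump_ge0. Qed.

Lemma step_eq0 x : x <= 1 / 2 -> step x = 0.
Proof.
move=> x1; have step0 : step 0 = 0 by rewrite /step cintxx.
have H y z : y <= z -> z <= 1 / 2 -> step z = step y.
  move=> yz z1; have [c [yc cz e]] := mean_value step_deriv yz.
  by apply/eqP; rewrite -subr_eq0 e bump_eq0 ?mul0r//; left; lra.
rewrite -step0; have [x0|/ltW x0] := leP x 0; last exact: H.
by apply/esym/H => //; lra.
Qed.

Lemma step_eq1 x : 1 <= x -> step x = 1.
Proof.
move=> x1; have step1 : step 1 = 1.
  have : step (1 / 2) = 0 by exact: step_eq0.
  rewrite /step (cint_split _ 0 1 (1 / 2)) => ->; rewrite add0r.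
  rewrite cintZ; last exact: smooth_continuous.
  by rewrite mulVf// gt_eqF.
have [c [yc cz e]] := mean_value step_deriv x1.
by rewrite -[RHS]step1; apply/eqP; rewrite -subr_eq0 e bump_eq0 ?mul0r//; right; lra.
Qed.

Lemma cint_bump : 0 < cint bump 0 1.
Proof. by rewrite -[X in _ < X]/(step 1) step_eq1. Qed.

Lemma step_ge0 x : 0 <= step x.
Proof.
have [x0|x0] := leP x 0; first by rewrite step_eq0//; lra.
by rewrite -(@step_eq0 0) ?step_le ?ltW//; lra.
Qed.

Lemma step_le1 x : step x <= 1.
Proof.
have [x0|x0] := leP x 1; last by rewrite step_eq1// ltW.
by rewrite -(@step_eq1 1) ?step_le.
Qed.

#[local] Opaque step.

Definition ramp x : R := cint step 0 x.

Lemma ramp_deriv : has_deriv ramp step.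
Proof.
have := has_derivB (primitive_deriv (smooth_continuous smooth_step))
  (has_deriv_cst (primitive step 0)).
by move=> /has_deriv_eq; apply => x; rewrite subr0.
Qed.

Lemma ramp_eq0 x : x <= 1 / 2 -> ramp x = 0.
Proof.
move=> x1; have r0 : ramp 0 = 0 by rewrite /ramp cintxx.
have H y z : y <= z -> z <= 1 / 2 -> ramp z = ramp y.
  move=> yz z1; have [c [yc cz e]] := mean_value ramp_deriv yz.
  by apply/eqP; rewrite -subr_eq0 e step_eq0 ?mul0r//; lra.
rewrite -r0; have [x0|/ltW x0] := leP x 0; last exact: H.
by apply/esym/H => //; lra.
Qed.

Lemma ramp_ge1 x : 1 <= x -> ramp x = ramp 1 + (x - 1).
Proof.
move=> x1; have [c [yc cz e]] := mean_value ramp_deriv x1.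
by apply/eqP; rewrite addrC -subr_eq e step_eq1// mul1r.
Qed.

#[local] Opaque ramp.

Lemma ramp1_le : ramp 1 <= 1 / 2.
Proof.
have [|c [yc cz e]] := @mean_value _ _ _ (1 / 2) 1 ramp_deriv; first lra.
have := e; rewrite (@ramp_eq0 (1 / 2))// subr0 => ->.
have := step_le1 c; lra.
Qed.

(** Designed through its slope: for x >= 0 this is step x - step (2 x), which is nonpositive and
    vanishes near 0 and beyond 1. The constant term makes the function itself vanish from 1 on. *)
Let raw_kernel x : R :=
  ramp x - ramp (2 * x) / 2 - ramp (- 2 * x) / 2 + ramp (- x) + (1 - ramp 1) / 2.

Let raw_slope x : R := step x - step (2 * x) + step (- 2 * x) - step (- x).

Let raw_curv x : R := bump x + bump (- x) - 2 * (bump (2 * x) + bump (- (2 * x))).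

Let deriv_scale (f g : R -> R) c : has_deriv f g ->
  has_deriv (fun x => f (c * x)) (fun x => c * g (c * x)).
Proof.
move=> df; have := has_deriv_affine c 0 df.
under eq_fun do rewrite addr0; move=> /has_deriv_eq; apply=> x.
by rewrite addr0.
Qed.

Let deriv_opp (f g : R -> R) : has_deriv f g ->
  has_deriv (fun x => f (- x)) (fun x => - g (- x)).
Proof.
move=> /(deriv_scale (-1)); under eq_fun do rewrite mulN1r.
by move=> /has_deriv_eq; apply=> x; rewrite !mulN1r.
Qed.

Let raw_kernel_deriv : has_deriv raw_kernel raw_slope.
Proof.
have dr := ramp_deriv.
have := has_derivD (has_derivD (has_derivB (has_derivB dr
  (has_derivM (deriv_scale 2 dr) (has_deriv_cst 2^-1)))
  (has_derivM (deriv_scale (- 2) dr) (has_deriv_cst 2^-1))) (deriv_opp dr))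
  (has_deriv_cst ((1 - ramp 1) / 2)).
by move=> /has_deriv_eq; apply=> x; rewrite /raw_slope; lra.
Qed.

Let raw_slope_deriv : has_deriv raw_slope raw_curv.
Proof.
have ds := step_deriv.
have := has_derivB (has_derivD (has_derivB ds (deriv_scale 2 ds))
  (deriv_scale (- 2) ds)) (deriv_opp ds).
by move=> /has_deriv_eq; apply=> x; rewrite /raw_curv (mulNr 2 x); lra.
Qed.

Let raw_kernel_even x : raw_kernel (- x) = raw_kernel x.
Proof. by rewrite /raw_kernel opprK !mulrN !mulNr opprK; lra. Qed.

Let raw_kernel_ge1 x : 1 <= x -> raw_kernel x = 0.
Proof.
move=> x1; rewrite /raw_kernel (ramp_ge1 x1) (@ramp_ge1 (2 * x)); last lra.
by rewrite (@ramp_eq0 (- 2 * x)) ?(@ramp_eq0 (- x)); lra.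
Qed.

Let raw_slope_le0 x : x * raw_slope x <= 0.
Proof.
rewrite /raw_slope; have [x0|/ltW x0] := leP 0 x.
- have e1 : step (- 2 * x) = 0 by apply: step_eq0; lra.
  have e2 : step (- x) = 0 by apply: step_eq0; lra.
  have h : step x <= step (2 * x) by apply: step_le; lra.
  by rewrite mulr_ge0_le0// e1 e2; lra.
- have e1 : step (2 * x) = 0 by apply: step_eq0; lra.
  have e2 : step x = 0 by apply: step_eq0; lra.
  have h : step (- x) <= step (- 2 * x) by apply: step_le; lra.
  by rewrite mulr_le0_ge0// e1 e2; lra.
Qed.

Let raw_kernel_ge0 x : 0 <= raw_kernel x.
Proof.
wlog x0 : x / 0 <= x.
  move=> H; have [/H//|/ltW x0] := leP 0 x.
  by rewrite -raw_kernel_even H// oppr_ge0.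
have [/raw_kernel_ge1 -> //|x1] := leP 1 x.
rewrite -(raw_kernel_ge1 (lexx 1)) -lerN2.
apply: has_deriv_ge0 (has_derivN raw_kernel_deriv) (ltW x1) _ => z xz _.
have z0 := le_trans x0 xz; rewrite oppr_ge0.
have := raw_slope_le0 z; move: z0; rewrite le_eqVlt => /predU1P[<-|z0].
  by rewrite /raw_slope mulr0 oppr0 mulr0; lra.
by rewrite pmulr_rle0.
Qed.

Let raw_mass := cint raw_kernel (- 1) 1.

Let smooth_raw_slope : smooth raw_slope.
Proof.
have ss c := smooth_affine c 0 smooth_step.
have H c : smooth (fun x : R => step (c * x)).
  by have := ss c; under eq_fun do rewrite addr0.
apply: smoothB; last first.
  by have := H (-1); under eq_fun do rewrite mulN1r.
by apply: smoothD; [apply: smoothB; [exact: smooth_step|exact: H]|exact: H].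
Qed.

Let smooth_raw_kernel : smooth raw_kernel.
Proof. exact: smooth_antideriv raw_kernel_deriv smooth_raw_slope. Qed.

Let raw_mass_gt0 : 0 < raw_mass.
Proof.
have dp := primitive_deriv (smooth_continuous smooth_raw_kernel).
have h1 : primitive raw_kernel (- 1) <= primitive raw_kernel 0.
  by apply: has_deriv_ge0 dp _ _ => //; lra.
have h3 : primitive raw_kernel (1 / 4) <= primitive raw_kernel 1.
  by apply: has_deriv_ge0 dp _ _ => //; lra.
have [|c [c1 c2 e]] := @mean_value _ _ _ 0 (1 / 4) dp; first lra.
(* Near 0 all four ramps vanish, and ramp 1 <= 1/2 leaves a constant of at least 1/4. *)
have : 1 / 4 <= raw_kernel c.
  have e1 : ramp c = 0 by apply: ramp_eq0; lra.
  have e2 : ramp (2 * c) = 0 by apply: ramp_eq0; lra.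
  have e3 : ramp (- 2 * c) = 0 by apply: ramp_eq0; lra.
  have e4 : ramp (- c) = 0 by apply: ramp_eq0; lra.
  by rewrite /raw_kernel e1 e2 e3 e4; have := ramp1_le; lra.
move=> h; have : 0 < raw_kernel c * (1 / 4 - 0) by apply: mulr_gt0; lra.
by rewrite -e /raw_mass /cint; lra.
Qed.

(* Even, constant near 0 and unimodal; its second derivative is
   [curv x - 2 * curv (2 * x)] with [curv] nonnegative, which makes the
   averages below telescope along dyadic scales. *)
Definition kernel x : R := raw_mass^-1 * raw_kernel x.
Definition kernel_slope x : R := raw_mass^-1 * raw_slope x.
Definition curv x : R := raw_mass^-1 * (bump x + bump (- x)).

Lemma kernel_deriv : has_deriv kernel kernel_slope.
Proof. exact: has_derivZ. Qed.

Lemma kernel_slope_deriv :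
  has_deriv kernel_slope (fun x => curv x - 2 * curv (2 * x)).
Proof.
apply: has_deriv_eq (has_derivZ _ raw_slope_deriv) _ => x.
by rewrite /curv /raw_curv; lra.
Qed.

Lemma smooth_kernel : smooth kernel. Proof. exact: smoothZ. Qed.

Lemma kernel_ge0 x : 0 <= kernel x.
Proof. by rewrite mulr_ge0// invr_ge0 ltW. Qed.

Lemma kernel_eq0 x : 1 <= `|x| -> kernel x = 0.
Proof.
rewrite /kernel => x1; have [x0|x0] := leP 0 x.
  by rewrite raw_kernel_ge1 ?mulr0// -(ger0_norm x0).
by rewrite -raw_kernel_even raw_kernel_ge1 ?mulr0// -(ltr0_norm x0).
Qed.

Lemma kernel_slope_le0 x : x * kernel_slope x <= 0.
Proof. by rewrite /kernel_slope mulrCA mulr_ge0_le0// invr_ge0 ltW. Qed.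

Lemma cint_kernel : cint kernel (- 1) 1 = 1.
Proof.
by rewrite cintZ ?mulVf ?gt_eqF//; exact: smooth_continuous.
Qed.

Lemma smooth_curv : smooth curv.
Proof.
apply: smoothZ; apply: smoothD; first exact: smooth_bump.
by have := smooth_affine (-1) 0 smooth_bump;
  under eq_fun do rewrite mulN1r addr0.
Qed.

Lemma curv_ge0 x : 0 <= curv x.
Proof.
by apply: mulr_ge0; [rewrite invr_ge0 ltW|rewrite addr_ge0 ?bump_ge0].
Qed.

Lemma curv_even x : curv (- x) = curv x.
Proof. by rewrite /curv opprK addrC. Qed.

Lemma curv_eq0 x : `|x| <= 1 / 2 \/ 1 <= `|x| -> curv x = 0.
Proof.
move=> hx; rewrite /curv !bump_eq0 ?addr0 ?mulr0//; case: hx => hx.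
- by left; have := ler_norm (- x); rewrite normrN; lra.
- have [x0|x0] := leP 0 x; first by left; lra.
  by right; rewrite -(ltr0_norm x0).
- by left; have := ler_norm x; lra.
- have [x0|x0] := leP 0 x; first by right; rewrite -(ger0_norm x0).
  by left; lra.
Qed.

Definition curv_mass := cint curv 0 1.

Lemma curv_mass_gt0 : 0 < curv_mass.
Proof.
rewrite /curv_mass cintZ; last first.
  apply: ctsD; first exact: smooth_continuous smooth_bump.
  have := smooth_continuous (smooth_affine (-1) 0 smooth_bump).
  by under eq_fun do rewrite mulN1r addr0.
rewrite mulr_gt0 ?invr_gt0//.
rewrite (@eq_cint _ _ bump); last 4 first.
- apply: ctsD; first exact: smooth_continuous smooth_bump.
  have := smooth_continuous (smooth_affine (-1) 0 smooth_bump).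
  by under eq_fun do rewrite mulN1r addr0.
- exact: smooth_continuous smooth_bump.
- exact: ler01.
- by move=> x x0 x1; rewrite (@bump_eq0 (- x)) ?addr0//; left; lra.
exact: cint_bump.
Qed.

End Bumps.

#[global] Opaque bump step ramp kernel kernel_slope curv.

(** * Test functions and distributions *)

Section TestFunctions.
Context {R : realType}.
Implicit Types (phi psi theta : R -> R) (K : set R) (x y t r : R).

Lemma tsupport_sub phi K : closed K -> (forall x, ~ K x -> phi x = 0) ->
  tsupport phi `<=` K.
Proof.
move=> cK phiK; rewrite [X in _ `<=` X](closure_id K).1//; apply: closure_subset.
by move=> x /eqP phix; apply: contrapT => /phiK.
Qed.

Lemma tsupport_out phi x : ~ tsupport phi x -> phi x = 0.
Proof.
by move=> sx; apply/eqP/negPn/negP => phix; apply: sx; exact: subset_closure.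
Qed.

Lemma tsupport_near phi x : ~ tsupport phi x -> \forall y \near x, phi y = 0.
Proof.
move=> sx; have : open (~` tsupport phi) by apply: closed_openC; exact: closed_closure.
by rewrite openE => /(_ x sx); apply: filterS => y; exact: tsupport_out.
Qed.

Lemma derive1n_out phi n x : ~ tsupport phi x -> derive1n n phi x = 0.
Proof. by move=> /tsupport_near; exact: derive1n_eq0. Qed.

Lemma norm_le_itv x r : `|x| <= r -> `[- r, r]%classic x.
Proof. by rewrite ler_norml /= in_itv. Qed.

Lemma test_functionP phi : test_function phi <->
  smooth phi /\ exists r, forall x, r < `|x| -> phi x = 0.
Proof.
split=> [[sphi cphi]|[sphi [r phir]]]; split=> //.
  have [M [_ MP]] := compact_bounded cphi; exists (M + 1) => x Mx.
  apply: tsupport_out => sx.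
  have : `|x| <= M + 1 by apply: (MP (M + 1)) => //; rewrite ltrDl.
  by rewrite leNgt Mx.
apply: subclosed_compact (@segment_compact _ (- r) r) _; first exact: closed_closure.
apply: tsupport_sub; first exact: itv_closed.
move=> x nx; apply: phir; rewrite ltNge; apply/negP => xr; apply: nx.
exact: norm_le_itv.
Qed.

Lemma test_smooth phi : test_function phi -> smooth phi.
Proof. by case. Qed.

Lemma derive1n_vanish phi n r x : (forall x, r < `|x| -> phi x = 0) ->
  r < `|x| -> derive1n n phi x = 0.
Proof.
move=> phir rx; apply: derive1n_eq0.
have : \forall y \near x, r < `|y|.
  apply/nbhs_ballP; exists (`|x| - r) => /=; first by rewrite subr_gt0.
  by move=> y; rewrite /ball/=; have := lerB_dist x y; lra.
by apply: filterS => y; exact: phir.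
Qed.

Lemma test_derive1 phi : test_function phi -> test_function (derive1 phi).
Proof.
move=> /test_functionP[sphi [r phir]]; apply/test_functionP; split.
  exact: smooth_derive1.
by exists r => x rx; rewrite -derive1n1; exact: derive1n_vanish phir rx.
Qed.

Lemma testM phi psi : test_function phi -> smooth psi ->
  test_function (fun x => phi x * psi x).
Proof.
move=> /test_functionP[sphi [r phir]] spsi; apply/test_functionP; split.
  exact: smoothM.
by exists r => x rx; rewrite phir ?mul0r.
Qed.

Lemma testMr phi psi : smooth phi -> test_function psi ->
  test_function (fun x => phi x * psi x).
Proof.
move=> sphi /test_functionP[spsi [r psir]]; apply/test_functionP; split.
  exact: smoothM.
by exists r => x rx; rewrite psir ?mulr0.
Qed.

Lemma testD phi psi : test_function phi -> test_function psi ->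
  test_function (fun x => phi x + psi x).
Proof.
move=> /test_functionP[sphi [r phir]] /test_functionP[spsi [r' psir]].
apply/test_functionP; split; first exact: smoothD.
exists (Num.max r r') => x; rewrite gt_max => /andP[rx rx'].
by rewrite phir ?psir ?addr0.
Qed.

Lemma testZ c phi : test_function phi -> test_function (fun x => c * phi x).
Proof. by move=> tphi; apply: testMr => //; exact: smooth_cst. Qed.

Lemma testB phi psi : test_function phi -> test_function psi ->
  test_function (fun x => phi x - psi x).
Proof.
move=> tphi /(testZ (-1)) tpsi; have := testD tphi tpsi.
by under eq_fun do rewrite mulN1r.
Qed.

Lemma test0 : test_function (fun=> 0 : R).
Proof. by apply/test_functionP; split; [exact: smooth_cst|exists 0]. Qed.

Lemma rescale_affine x t phi :
  rescale x t phi = fun y => phi (t^-1 * y + - (x / t)).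
Proof. by apply/funext => y; rewrite /rescale mulrBl mulrC. Qed.

Lemma smooth_rescale x t phi : smooth phi -> smooth (rescale x t phi).
Proof. by rewrite rescale_affine; exact: smooth_affine. Qed.

Lemma rescale_deriv x t phi psi : has_deriv phi psi ->
  has_deriv (rescale x t phi) (fun y => t^-1 * rescale x t psi y).
Proof. by move=> d; rewrite !rescale_affine; exact: has_deriv_affine. Qed.

Lemma derive1n_rescale x t phi n : smooth phi ->
  derive1n n (rescale x t phi) = fun y => t^-1 ^+ n * derive1n n phi ((y - x) / t).
Proof.
move=> sphi; rewrite rescale_affine derive1n_affine//; apply/funext => y.
by rewrite mulrBl [y / t]mulrC.
Qed.

Lemma rescale_vanish x t phi r : 0 < t -> (forall y, r < `|y| -> phi y = 0) ->
  forall y, `|x| + r * t < `|y| -> rescale x t phi y = 0.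
Proof.
move=> t0 phir y ry; apply: phir; rewrite normrM normfV (gtr0_norm t0).
by rewrite ltr_pdivlMr//; have := lerB_dist y x; lra.
Qed.

Lemma test_rescale x t phi : t != 0 -> test_function phi ->
  test_function (rescale x t phi).
Proof.
move=> t0 /test_functionP[sphi [r phir]]; apply/test_functionP; split.
  exact: smooth_rescale.
exists (`|x| + r * `|t|) => y ry; apply: phir; rewrite normrM normfV.
rewrite ltr_pdivlMr ?normr_gt0//; have := lerB_dist y x; lra.
Qed.

(** Constants and [step] are not compactly supported, yet cutoffs times their rescalings are test
    functions; bounded derivatives are what the estimates of such products require. *)
Definition derivs_bounded psi := forall n, exists M, forall k x,
  (k <= n)%N -> `|derive1n k psi x| <= M.

Lemma derivs_boundedP psi :
  (forall n, exists M, forall x, `|derive1n n psi x| <= M) ->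
  derivs_bounded psi.
Proof.
move=> H; elim=> [|n [M MP]].
  have [M MP] := H 0%N; exists M => k x; rewrite leqn0 => /eqP ->; exact: MP.
have [M' MP'] := H n.+1; exists (Num.max M M') => k x.
rewrite leq_eqVlt ltnS => /predU1P[->|kn]; rewrite le_max ?MP' ?orbT//.
by rewrite MP.
Qed.

Lemma derivs_bounded_cst c : derivs_bounded (fun=> c).
Proof.
apply: derivs_boundedP => -[|n]; first by exists `|c| => x.
exists 0 => x; rewrite derive1Sn (has_deriv_derive1 (has_deriv_cst c)).
by rewrite derive1n_zero normr0.
Qed.

Lemma continuous_bounded (f : R -> R) r : continuous f ->
  exists M, forall x, `|x| <= r -> `|f x| <= M.
Proof.
move=> cf; have [r0|r0] := leP 0 r; last first.
  by exists 0 => x xr; have := le_trans (normr_ge0 x) xr; rewrite leNgt r0.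
have cf' : {within `[- r, r], continuous (fun x => `|f x|)}.
  apply: continuous_subspaceT => x.
  by apply: (@continuous_comp _ _ _ f Num.norm); [exact: cf|exact: norm_continuous].
have [|c _ cP] := @EVT_max R (fun x => `|f x|) (- r) r _ cf'; first lra.
by exists `|f c| => x /norm_le_itv xr; exact: cP.
Qed.

Lemma test_derivs_bounded phi : test_function phi -> derivs_bounded phi.
Proof.
move=> /test_functionP[sphi [r phir]]; apply: derivs_boundedP => n.
have [M MP] := @continuous_bounded (derive1n n phi) r
  (smooth_continuous (@smooth_derive1n _ n _ sphi)).
exists `|M| => x; have [xr|xr] := leP `|x| r.
  exact: le_trans (MP x xr) (ler_norm _).
by rewrite (derive1n_vanish _ phir xr) normr0.
Qed.

Lemma derivs_bounded_ge0 psi n M :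
  (forall k x, (k <= n)%N -> `|derive1n k psi x| <= M) -> 0 <= M.
Proof. by move=> /(_ 0%N 0 isT); apply: le_trans. Qed.

Lemma test_bump : test_function (@bump R).
Proof.
apply/test_functionP; split; first exact: smooth_bump.
exists 1 => x x1; apply: bump_eq0; have [x0|x0] := leP 0 x.
  by right; move: x1; rewrite ger0_norm// => /ltW.
by left; lra.
Qed.

Lemma test_kernel : test_function (@kernel R).
Proof.
apply/test_functionP; split; first exact: smooth_kernel.
by exists 1 => x x1; apply: kernel_eq0; exact: ltW.
Qed.

Lemma derivs_bounded_step : derivs_bounded (@step R).
Proof.
apply: derivs_boundedP => -[|n].
  by exists 1 => x; rewrite derive1n0 ger0_norm ?step_ge0 ?step_le1.
have [M MP] := test_derivs_bounded test_bump n; exists M => x.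
by rewrite derive1Sn (has_deriv_derive1 step_deriv) MP.
Qed.

Definition plateau r x : R := step (x + r + 1) * step (r + 1 - x).

Lemma test_plateau r : test_function (plateau r).
Proof.
apply/test_functionP; split.
  apply: smoothM.
  - by have := smooth_affine 1 (r + 1) (@smooth_step R);
      under eq_fun do rewrite mul1r addrA.
  - by have := smooth_affine (-1) (r + 1) (@smooth_step R);
      under eq_fun do rewrite mulN1r addrC.
exists (`|r| + 1) => x rx; rewrite /plateau.
have := ler_norm r; have [x0|x0] := leP 0 x.
  move: rx; rewrite (ger0_norm x0) => rx rr.
  by rewrite (@step_eq0 _ (r + 1 - x)) ?mulr0//; lra.
move: rx; rewrite (ltr0_norm x0) => rx rr.
by rewrite (@step_eq0 _ (x + r + 1)) ?mul0r//; lra.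
Qed.

Lemma plateau_eq1 r x : `|x| <= r -> plateau r x = 1.
Proof.
rewrite ler_norml => /andP[xr rx].
by rewrite /plateau !step_eq1 ?mulr1//; lra.
Qed.

End TestFunctions.

#[global] Opaque test_function derivs_bounded.

(** * Distributions along families of test functions *)

Section Distributions.
Context {R : realType}.
Implicit Types (phi psi theta : R -> R) (U u v V : schwartz_dist R) (x y t r : R).

Lemma dist0 U : U (fun=> 0) = 0.
Proof.
have := dist_linear U 1 test0 test0.
by under eq_fun do rewrite mulr0 addr0; rewrite mul1r; lra.
Qed.

Lemma distZ U c phi : test_function phi -> U (fun x => c * phi x) = c * U phi.
Proof.
move=> tphi; have := dist_linear U c tphi test0.
by under eq_fun do rewrite addr0; rewrite dist0 addr0.
Qed.

Lemma distD U phi psi : test_function phi -> test_function psi ->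
  U (fun x => phi x + psi x) = U phi + U psi.
Proof.
move=> tphi tpsi; have := dist_linear U 1 tphi tpsi.
by under eq_fun do rewrite mul1r; rewrite mul1r.
Qed.

Lemma distB U phi psi : test_function phi -> test_function psi ->
  U (fun x => phi x - psi x) = U phi - U psi.
Proof.
move=> tphi tpsi; have := dist_linear U (-1) tpsi tphi.
by under eq_fun do rewrite mulN1r addrC; rewrite mulN1r addrC.
Qed.

Lemma dist_bound U r : exists N C, 0 <= C /\ forall phi M, smooth phi ->
  (forall x, r < `|x| -> phi x = 0) ->
  (forall n x, (n <= N)%N -> `|derive1n n phi x| <= M) -> `|U phi| <= C * M.
Proof.
have [N [C NC]] := dist_continuous U (@segment_compact R (- r) r).
exists N, `|C|; split=> // phi M sphi phir phiM.
have M0 := derivs_bounded_ge0 phiM.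
apply: le_trans (ler_wpM2r M0 (ler_norm C)); apply: NC => //.
- by apply/test_functionP; split => //; exists r.
- apply: tsupport_sub; first exact: itv_closed.
  move=> x nx; apply: phir; rewrite ltNge; apply/negP => xr; apply: nx.
  exact: norm_le_itv.
Qed.

(** Differentiation under the distribution. The remainder is controlled in every seminorm because
    the order of U on the ball of radius r is not known beforehand. *)
Lemma dist_param_deriv U (F : R -> R -> R) (G : R -> R) (z r d : R) : 0 < d ->
  (forall h, `|h| < d -> smooth (F (z + h)) /\
     forall y, r < `|y| -> F (z + h) y = 0) ->
  smooth G -> (forall y, r < `|y| -> G y = 0) ->
  (forall N, exists C, forall h, `|h| < d -> forall n y, (n <= N)%N ->
     `|derive1n n (fun y => F (z + h) y - F z y - h * G y) y| <= C * h ^+ 2) ->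
  is_derive z (1 : R) (fun z => U (F z)) (U G).
Proof.
move=> d0 sF sG G0 bF; have [N [C [C0 NC]]] := dist_bound U r.
have [M MP] := bF N.
have [sFz Fz0] : smooth (F z) /\ forall y, r < `|y| -> F z y = 0.
  by have := sF 0; rewrite addr0 normr0; apply.
have tF phi : smooth phi -> (forall y, r < `|y| -> phi y = 0) -> test_function phi.
  by move=> sphi phir; apply/test_functionP; split => //; exists r.
have key h : `|h| < d -> `|U (F (z + h)) - U (F z) - h * U G| <= C * M * h ^+ 2.
  move=> hd; have [sFh Fh0] := sF h hd.
  have tFz := tF _ sFz Fz0; have tFh := tF _ sFh Fh0; have tG := tF _ sG G0.
  rewrite -(distB _ tFh tFz) -(distZ _ _ tG) -(distB _ (testB tFh tFz) (testZ _ tG)).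
  rewrite -mulrA; apply: NC.
  - by apply: smoothB; [exact: smoothB|exact: smoothZ].
  - by move=> y ry; rewrite Fh0// Fz0// G0// mulr0 !subr0.
  - by move=> n y nN; exact: MP.
exact: is_derive_quadratic d0 key.
Qed.

(* Differentiation of a distribution along translates of the test function;
   [psi] is either a cutoff or the constant 1. *)
Lemma dist_translate_deriv U psi theta theta' t r z (d : R) : t != 0 -> 0 < d ->
  smooth psi -> derivs_bounded psi ->
  smooth theta -> derivs_bounded theta -> has_deriv theta theta' ->
  (forall w y, `|w - z| < d -> r < `|y| ->
     psi y * rescale w t theta y = 0 /\ psi y * rescale w t theta' y = 0) ->
  is_derive z (1 : R) (fun z => U (fun y => psi y * rescale z t theta y))
    (- t^-1 * U (fun y => psi y * rescale z t theta' y)).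
Proof.
move=> t0 d0 spsi bpsi sth bth dth supp.
have sth' : smooth theta' by rewrite -(has_deriv_derive1 dth); exact: smooth_derive1.
have H0 y : r < `|y| -> psi y * rescale z t theta' y = 0.
  by move=> /(supp z y); rewrite subrr normr0 => /(_ d0)[].
rewrite -distZ; last first.
  apply/test_functionP; split; last by exists r.
  by apply: smoothM; [exact: spsi|exact: smooth_rescale].
apply: (@dist_param_deriv U (fun z y => psi y * rescale z t theta y) _ z r d d0).
- move=> h hd; split; first by apply: smoothM; [exact: spsi|exact: smooth_rescale].
  by move=> y ry; have [|//] := supp (z + h) y _ ry; rewrite addrAC subrr add0r.
- by apply: smoothZ; apply: smoothM; [exact: spsi|exact: smooth_rescale].
- by move=> y ry; rewrite H0 ?mulr0.
move=> N; have [A AP] := bpsi N; have [B BP] := bth N.+2.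
have B0 := derivs_bounded_ge0 BP.
(* Dominates the powers of |t^-1| up to N at once, whether t is below or above 1. *)
pose T := Num.max 1 `|t^-1| ^+ N.
have T1 : 1 <= T by rewrite exprn_ege1// le_max lexx.
exists (2 ^+ N * (A * (T * (B * `|t^-1| ^+ 2)))) => h hd n y nN.
(* The first-order Taylor remainder of theta at (y - z) / t for the increment - h / t. Its
   derivatives are remainders of the same kind, hence quadratic in h. *)
pose D (h : R) y := theta ((y - (z + h)) / t) - theta ((y - z) / t) + h / t * theta' ((y - z) / t).
have sD w : smooth (D w).
  apply: smoothD.
    by apply: smoothB; exact: (@smooth_rescale _ _ _ _ sth).
  by apply: smoothZ; exact: (@smooth_rescale _ _ _ _ sth').
have -> : (fun y => psi y * rescale (z + h) t theta y - psi y * rescale z t theta y -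
    h * (- t^-1 * (psi y * rescale z t theta' y))) = fun y => psi y * D h y.
  by apply/funext => w; rewrite /D /rescale; ring.
rewrite (_ : _ * h ^+ 2 = 2 ^+ N * (A * (T * (B * (`|t^-1| ^+ 2 * h ^+ 2))))); last by rewrite -!mulrA.
apply: (derive1nM_le (n := N)); [exact: spsi|exact: sD|by move=> k; exact: AP| |exact: nN] => k kN; set w := y.
have -> : derive1n k (D h) w = t^-1 ^+ k *
    (derive1n k theta ((w - z) / t + - (h / t)) - derive1n k theta ((w - z) / t)
     - (- (h / t)) * derive1n k.+1 theta ((w - z) / t)).
  rewrite /D derive1nD; last 2 first.
    by apply: smoothB; exact: (@smooth_rescale _ _ _ _ sth).
    by apply: smoothZ; exact: (@smooth_rescale _ _ _ _ sth').
  rewrite derive1nZ; last exact: (@smooth_rescale _ _ _ _ sth').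
  have E phi x : smooth phi -> derive1n k (fun y => phi ((y - x) / t)) = fun y => t^-1 ^+ k * derive1n k phi ((y - x) / t).
    by move=> sphi; exact: derive1n_rescale.
  rewrite (E theta' z sth').
  have -> : derive1n k (fun y => theta ((y - (z + h)) / t) - theta ((y - z) / t)) =
      fun y => t^-1 ^+ k * derive1n k theta ((y - (z + h)) / t) + (-1) * (t^-1 ^+ k * derive1n k theta ((y - z) / t)).
    transitivity (derive1n k (fun y => theta ((y - (z + h)) / t) + (-1) * theta ((y - z) / t))).
      by congr (derive1n k _); apply/funext => v; rewrite mulN1r.
    rewrite derive1nD; [|exact: (@smooth_rescale _ _ _ _ sth)|by apply: smoothZ; exact: (@smooth_rescale _ _ _ _ sth)].
    by rewrite derive1nZ; [rewrite !E|exact: (@smooth_rescale _ _ _ _ sth)].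
  rewrite derive1Sn (has_deriv_derive1 dth).
  rewrite (_ : (w - (z + h)) / t = (w - z) / t + - (h / t)); last by field.
  ring.
rewrite normrM normrX ler_pM ?exprn_ge0//.
  rewrite /T (le_trans (_ : _ <= Num.max 1 `|t^-1| ^+ k))//.
    by rewrite lerXn2r ?nnegrE ?le_max ?lexx ?orbT ?ler01.
  by rewrite ler_weXn2l// le_max lexx.
have := @taylor1 _ (derive1n k theta) (derive1n k.+1 theta) (derive1n k.+2 theta)
  B ((w - z) / t) (- (h / t)).
rewrite sqrrN exprMn -(real_normK (num_real t^-1)) [h ^+ 2 * _]mulrC; apply.
- by rewrite derive1nS; apply: smooth_deriv; exact: smooth_derive1n.
- by rewrite [derive1n k.+2 _]derive1nS; apply: smooth_deriv; exact: smooth_derive1n.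
- by move=> v; apply: BP.
Qed.

Lemma dist_translate_cutoff U psi theta theta' t : t != 0 ->
  test_function psi -> smooth theta -> derivs_bounded theta ->
  has_deriv theta theta' ->
  has_deriv (fun z => U (fun y => psi y * rescale z t theta y))
    (fun z => - t^-1 * U (fun y => psi y * rescale z t theta' y)).
Proof.
move=> t0 tpsi sth bth dth z; have [_ [r psir]] := (test_functionP psi).1 tpsi.
apply: (dist_translate_deriv U (r := r) t0 ltr01 (test_smooth tpsi)
  (test_derivs_bounded tpsi) sth bth dth).
by move=> w y _ ry; rewrite psir ?mul0r.
Qed.

Lemma dist_translate U theta t : 0 < t -> test_function theta ->
  has_deriv (fun z => U (rescale z t theta))
    (fun z => - t^-1 * U (rescale z t (derive1 theta))).
Proof.
move=> t0 tth z; have [sth [r thr]] := (test_functionP theta).1 tth.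
have tN0 : t != 0 by rewrite gt_eqF.
have := @dist_translate_deriv U (fun=> 1) theta (derive1 theta) t (`|z| + 1 + r * t) z 1 tN0 ltr01
  (@smooth_cst R 1) (derivs_bounded_cst 1) sth (test_derivs_bounded tth) (smooth_deriv sth).
have E phi w : (fun y => 1 * rescale w t phi y) = rescale w t phi.
  by apply/funext => y; rewrite mul1r.
rewrite E (_ : (fun z => U (fun y => 1 * rescale z t theta y)) = fun z => U (rescale z t theta)); last first.
  by apply/funext => w; rewrite E.
apply=> w y wz ry; rewrite !mul1r.
have wr : `|w| + r * t < `|y| by have := lerB_dist w z; lra.
split; first exact: (rescale_vanish t0 thr wr).
apply: (rescale_vanish t0 _ wr) => v rv.
by rewrite -derive1n1; exact: derive1n_vanish thr rv.
Qed.

End Distributions.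

(** * Uniform bounds from point values *)

Section SmoothSeries.
Context {R : realType}.

Lemma sum_third_le (a : nat -> R) B i J : (forall j, `|a j| <= B * 3^-1 ^+ j) ->
  (i <= J)%N ->
  `|\sum_(j < J) a j - \sum_(j < i) a j| <= B * (3 / 2) * (3^-1 ^+ i - 3^-1 ^+ J).
Proof.
move=> aB; elim: J => [|J IHJ].
  by rewrite leqn0 => /eqP ->; rewrite !subrr normr0 mulr0.
rewrite leq_eqVlt ltnS => /predU1P[->|/IHJ {}IHJ].
  by rewrite !subrr normr0 mulr0.
rewrite big_ord_recr/= addrAC; apply: le_trans (ler_normD _ _) _.
by have := aB J; rewrite exprS; lra.
Qed.

Lemma third_ge0 n : 0 <= 3^-1 ^+ n :> R.
Proof. by rewrite exprn_ge0// invr_ge0. Qed.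

Lemma third_to0 : (fun n => 3^-1 ^+ n : R) @ \oo --> (0 : R).
Proof. by apply: cvg_expr; rewrite ger0_norm ?invr_ge0// invf_lt1; lra. Qed.

Lemma le_third (x y K : R) i :
  (forall J, (i <= J)%N -> x <= y + K * 3^-1 ^+ J) -> x <= y.
Proof.
move=> H; apply/ler_addgt0Pr => e e0.
have /cvgrPdist_lt/(_ (e / (`|K| + 1))) := third_to0.
have K0 : 0 < `|K| + 1 by rewrite ltr_pwDr.
rewrite divr_gt0// => /(_ isT)[N _ NP].
have /= := NP (maxn N i) (leq_maxl _ _).
rewrite sub0r normrN ger0_norm ?third_ge0// ltr_pdivlMr// => h.
apply: le_trans (H _ (leq_maxr N i)) _; rewrite lerD2l.
apply: le_trans (ltW h); rewrite mulrC ler_wpM2l ?third_ge0//.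
by apply: le_trans (ler_norm _) _; rewrite lerDl.
Qed.

Lemma third_series (a : nat -> R) B : (forall j, `|a j| <= B * 3^-1 ^+ j) ->
  exists L, forall J, `|L - \sum_(j < J) a j| <= B * (3 / 2) * 3^-1 ^+ J.
Proof.
move=> aB.
have B0 : 0 <= B by have := le_trans (normr_ge0 _) (aB 0%N); rewrite expr0 mulr1.
have : cvgn (series a).
  apply: normed_cvg; apply: (@series_le_cvg _ _ (geometric B 3^-1)).
  - by move=> n /=.
  - by move=> n /=; rewrite mulr_ge0// third_ge0.
  - by move=> n /=; exact: aB.
  - by apply: is_cvg_geometric_series; rewrite ger0_norm ?invr_ge0// invf_lt1; lra.
move=> /cvg_ex[L /= aL]; exists L => i; apply/ler_addgt0Pr => e e0.
have /cvgrPdist_lt/(_ _ e0)[N _ NP] := aL.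
have /= := NP (maxn N i) (leq_maxl _ _).
rewrite /series/= big_mkord => h.
have := sum_third_le aB (leq_maxr N i).
have := ler_distD (\sum_(j < maxn N i) a j) L (\sum_(j < i) a j).
have : 0 <= B * (3 / 2) * 3^-1 ^+ maxn N i.
  by rewrite !mulr_ge0// ?third_ge0//; lra.
lra.
Qed.

Lemma derive1n_sum (f : nat -> R -> R) (c : nat -> R) J : (forall j, smooth (f j)) ->
  smooth (fun y => \sum_(j < J) c j * f j y) /\
  forall n, derive1n n (fun y => \sum_(j < J) c j * f j y) =
    fun y => \sum_(j < J) c j * derive1n n (f j) y.
Proof.
move=> sf; elim: J => [|J [sJ IHJ]].
  have E : (fun y : R => \sum_(j < 0) c j * f j y) = fun=> 0.
    by apply/funext => y; rewrite big_ord0.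
  rewrite E; split; first exact: smooth_cst.
  move=> n; apply/funext => y; by rewrite big_ord0 derive1n_zero.
have E : (fun y : R => \sum_(j < J.+1) c j * f j y) =
    fun y => \sum_(j < J) c j * f j y + c J * f J y.
  by apply/funext => y; rewrite big_ord_recr.
have sc : smooth (fun y => c J * f J y) by apply: smoothZ; exact: sf.
rewrite E; split; first exact: smoothD sJ sc.
move=> n; rewrite (derive1nD n sJ sc) IHJ (derive1nZ (c J) n (sf J)).
by apply/funext => y; rewrite big_ord_recr.
Qed.

(** Bounds on each derivative that are uniform in j allow termwise differentiation; 3/2 is the sum
    of the powers of 1/3. *)
Lemma smooth_series (f : nat -> R -> R) (c : nat -> R) (B : nat -> R) :
  (forall j, smooth (f j)) -> (forall j, `|c j| <= 3^-1 ^+ j) ->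
  (forall n j y, `|derive1n n (f j) y| <= B n) ->
  exists2 X, smooth X & forall n J y,
    `|derive1n n X y - \sum_(j < J) c j * derive1n n (f j) y| <=
      B n * (3 / 2) * 3^-1 ^+ J.
Proof.
move=> sf c3 fB.
have B0 n : 0 <= B n by exact: le_trans (normr_ge0 _) (fB n 0%N 0).
have cfB n y j : `|c j * derive1n n (f j) y| <= B n * 3^-1 ^+ j.
  by rewrite normrM mulrC ler_pM.
have /choice[X XP] : forall p : nat * R, exists L, forall J,
    `|L - \sum_(j < J) c j * derive1n p.1 (f j) p.2| <= B p.1 * (3 / 2) * 3^-1 ^+ J.
  by move=> p; exact: third_series (cfB p.1 p.2).
have dX n : has_deriv (fun y => X (n, y)) (fun y => X (n.+1, y)).
  move=> y; apply: (@is_derive_quadratic _ (fun y => X (n, y)) y _ (B n.+2 * (3 / 2)) 1 ltr01).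
  move=> h _.
  apply: (@le_third _ _ (B n * (3 / 2) + B n * (3 / 2) + `|h| * (B n.+1 * (3 / 2))) 0%N).
  move=> J _.
  (* The remainder for the limit is that for the partial sum, quadratic in h uniformly in J, up to
     errors of order 3^-J. *)
  set S := fun n y => \sum_(j < J) c j * derive1n n (f j) y.
  have E : X (n, y + h) - X (n, y) - h * X (n.+1, y) =
      (X (n, y + h) - S n (y + h)) - (X (n, y) - S n y) - h * (X (n.+1, y) - S n.+1 y)
      + (S n (y + h) - S n y - h * S n.+1 y) by ring.
  rewrite E; apply: le_trans (ler_normD _ _) _; rewrite addrC lerD//.
    rewrite /S mulr_sumr -!sumrB; apply: le_trans (ler_norm_sum _ _ _) _.
    apply: (@le_trans _ _ (\sum_(j < J) (B n.+2 * h ^+ 2) * 3^-1 ^+ j)).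
      apply: ler_sum => j _.
      rewrite (_ : _ - _ - _ = c j * (derive1n n (f j) (y + h) - derive1n n (f j) y -
        h * derive1n n.+1 (f j) y)); last by ring.
      rewrite normrM mulrC; apply: ler_pM => //.
      apply: (@taylor1 _ (derive1n n (f j)) (derive1n n.+1 (f j)) (derive1n n.+2 (f j))).
      - by rewrite derive1nS; apply: smooth_deriv; exact: smooth_derive1n.
      - by rewrite [derive1n n.+2 _]derive1nS; apply: smooth_deriv; exact: smooth_derive1n.
      - by move=> z; exact: fB.
    have K0 : 0 <= B n.+2 * h ^+ 2 by rewrite mulr_ge0// sqr_ge0.
    have := @sum_third_le (fun j => (B n.+2 * h ^+ 2) * 3^-1 ^+ j) (B n.+2 * h ^+ 2) 0 J _ (leq0n _).
    rewrite big_ord0 subr0 expr0 => H.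
    apply: le_trans (ler_norm _) _; apply: le_trans (H _) _.
      by move=> j; rewrite ger0_norm// mulr_ge0// third_ge0.
    have : 0 <= B n.+2 * h ^+ 2 * (3 / 2) * 3^-1 ^+ J.
      by rewrite mulr_ge0 ?third_ge0// mulr_ge0//; lra.
    set t := 3^-1 ^+ J; lra.
  have h1 := XP (n, y + h) J; have h2 := XP (n, y) J.
  have h3 := ler_wpM2l (normr_ge0 h) (XP (n.+1, y) J).
  apply: le_trans (ler_normB _ _) _; rewrite normrM.
  rewrite [leRHS](_ : _ = B n * (3 / 2) * 3^-1 ^+ J + B n * (3 / 2) * 3^-1 ^+ J +
    `|h| * (B n.+1 * (3 / 2) * 3^-1 ^+ J)); last by ring.
  by apply: lerD h3; apply: le_trans (ler_normB _ _) _; exact: lerD h1 h2.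
exists (fun y => X (0%N, y)).
  apply: (smooth_coind (P := fun g => exists n, g = fun y => X (n, y))); last by exists 0%N.
  by move=> g [n ->]; exists (fun y => X (n.+1, y)); [exact: dX|exists n.+1].
have dnX n : derive1n n (fun y => X (0%N, y)) = fun y => X (n, y).
  by elim: n => // n IHn; rewrite derive1nS IHn; exact: has_deriv_derive1.
by move=> n J y; rewrite dnX; exact: (XP (n, y)).
Qed.

End SmoothSeries.

(** * Uniform boundedness by a gliding hump *)

Section UniformBoundedness.
Context {R : realType}.
Implicit Types (U : schwartz_dist R) (theta phi : R -> R) (z t M : R).

(** Equiboundedness of the functionals t^-1 U(z + t .) on test functions of the unit ball. The one
    number n is order, constant and threshold for the scale, so that the conditions increase with n,
    as Baire's argument requires. *)
Definition scaled_bound U n z := forall t theta M, 0 < t -> t < n.+1%:R^-1 ->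
  smooth theta -> (forall x, 1 < `|x| -> theta x = 0) ->
  (forall k x, (k <= n)%N -> `|derive1n k theta x| <= M) ->
  `|U (rescale z t theta)| <= n%:R * t * M.

Lemma test_unit theta : smooth theta -> (forall x, 1 < `|x| -> theta x = 0) ->
  test_function theta.
Proof. by move=> sth th1; apply/test_functionP; split => //; exists 1. Qed.

Lemma rescaled_dist_bound U z t : 0 < t -> exists N K, 0 <= K /\
  forall theta M, smooth theta -> (forall x, 1 < `|x| -> theta x = 0) ->
  (forall k x, (k <= N)%N -> `|derive1n k theta x| <= M) ->
  `|t^-1 * U (rescale z t theta)| <= K * M.
Proof.
move=> t0; have [N [C [C0 NC]]] := dist_bound U (`|z| + 1 * t).
pose T := Num.max 1 t^-1 ^+ N.
have ti0 : 0 <= t^-1 by rewrite invr_ge0 ltW.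
have T0 : 0 <= T by rewrite exprn_ge0// le_max ler01.
exists N, (t^-1 * (C * T)); split; first by rewrite !mulr_ge0.
move=> theta M sth th1 thM; rewrite normrM (ger0_norm ti0) -!mulrA ler_wpM2l//.
apply: NC.
- exact: smooth_rescale sth.
- by move=> x xz; apply: (rescale_vanish t0 th1 xz).
move=> n x nN; rewrite (derive1n_rescale _ _ _ sth) normrM normrX (ger0_norm ti0).
apply: ler_pM => //; first by rewrite exprn_ge0.
  rewrite /T (le_trans (_ : _ <= Num.max 1 t^-1 ^+ n))//.
    by rewrite lerXn2r ?nnegrE ?le_max ?lexx ?orbT ?ler01 ?ti0.
  by rewrite ler_weXn2l// le_max lexx.
exact: thM.
Qed.

Lemma near_supremum (f : nat -> R) K : (forall m, `|f m| <= K) ->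
  forall m0, 0 < `|f m0| ->
  exists a m, [/\ forall i, `|f i| <= a & 2 / 3 * a <= `|f m|].
Proof.
move=> fK m0 m0P; pose S := [set `|f m| | m in setT].
have hS : has_sup S.
  by split; [exists `|f 0%N|, 0%N|exists K => _ [m _ <-]].
have up i : `|f i| <= sup S by apply: (ub_le_sup hS.2); exists i.
have a0 : 0 < sup S := lt_le_trans m0P (up m0).
have a3 : 0 < sup S / 3 by rewrite divr_gt0.
have [_ [m _ <-] h] := sup_adherent a3 hS.
by exists (sup S), m; split; [exact: up|move: (sup S) h => q h; lra].
Qed.

(** Of x + y and x - y one has modulus at least |y|; signs chosen in succession thus keep the j-th
    functional at least as large as its j-th term. *)
Lemma exists_signs (s : nat -> nat -> R) : exists c : nat -> R,
  (forall j, `|c j| <= 3^-1 ^+ j) /\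
  forall j, 3^-1 ^+ j * `|s j j| <= `|\sum_(i < j.+1) c i * s j i|.
Proof.
pose sgn (x y : R) : R := if `|x + y| < `|y| then -1 else 1.
have sgnP x y : `|y| <= `|x + sgn x y * y|.
  rewrite /sgn; case: ltP => [h|]; last by rewrite mul1r.
  rewrite mulN1r; have := ler_normB (x + y) (x - y).
  rewrite (_ : x + y - (x - y) = 2 * y); last by ring.
  by rewrite normrM (ger0_norm (_ : 0 <= 2 :> R)); lra.
(* [C j] holds the first j coefficients, on all of which the sign of the next one depends. *)
pose C := fix C j : nat -> R := if j is j'.+1 then fun i =>
  if i == j' then 3^-1 ^+ j' * sgn (\sum_(i < j') C j' i * s j' i) (3^-1 ^+ j' * s j' j')
  else C j' i else fun=> 0.
pose c i := C i.+1 i.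
have CE j i : (i < j)%N -> C j i = c i.
  elim: j => // j IHj; rewrite ltnS leq_eqVlt => /predU1P[->//|ij].
  by rewrite /= ltn_eqF// IHj.
have cE j : c j = 3^-1 ^+ j * sgn (\sum_(i < j) c i * s j i) (3^-1 ^+ j * s j j).
  rewrite {1}/c /= eqxx; congr (_ * sgn _ _).
  by apply: eq_bigr => i _; rewrite CE.
exists c; split=> [j|j].
  rewrite cE normrM ger0_norm ?third_ge0// ler_piMr ?third_ge0//.
  by rewrite /sgn; case: ifP; rewrite ?normrN normr1.
rewrite big_ord_recr/= cE.
have := sgnP (\sum_(i < j) c i * s j i) (3^-1 ^+ j * s j j).
rewrite normrM (ger0_norm (third_ge0 j)) => /le_trans; apply.
by rewrite le_eqVlt; apply/orP; left; apply/eqP; congr (`|_ + _|); ring.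
Qed.

Lemma four_thirds_ge j : 1 + j%:R / 3 <= (4 / 3) ^+ j :> R.
Proof.
elim: j => [|j IHj]; first by rewrite mul0r addr0 expr0.
rewrite exprS; apply: le_trans (ler_wpM2l _ IHj); last by lra.
by rewrite -natr1; have : 0 <= j%:R :> R by []; lra.
Qed.

(* A gliding hump: if the bound fails for every [n], signed sums of
   counterexamples with weights 3 ^- j converge to a test function along whose
   rescalings [U] is unbounded. *)
Lemma point_value_scaled_bound U z c : point_value U z c ->
  exists n, scaled_bound U n z.
Proof.
move=> Uc; apply: contrapT => nb.
(* Counterexamples to the bound with n = 4^j, normalized to M = 1. The growth 4^j has to win against
   the weights 3^-j. *)
have /choice[p pP] : forall j : nat, exists p : R * (R -> R),
    [/\ 0 < p.1, p.1 < (4 ^ j).+1%:R^-1, smooth p.2,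
        forall x, 1 < `|x| -> p.2 x = 0 &
        (forall k x, (k <= 4 ^ j)%N -> `|derive1n k p.2 x| <= 1) /\
        (4 ^ j)%:R < `|p.1^-1 * U (rescale z p.1 p.2)|].
  move=> j; have : ~ scaled_bound U (4 ^ j) z by move=> h; apply: nb; exists (4 ^ j)%N.
  move=> /existsNP[t] /existsNP[th] /existsNP[M] /not_implyP[t0] /not_implyP[tj].
  move=> /not_implyP[sth] /not_implyP[th1] /not_implyP[thM] /negP; rewrite -ltNge => H.
  have tth : test_function (rescale z t th).
    by apply: test_rescale; [rewrite gt_eqF|exact: test_unit].
  have M0 : 0 < M.
    rewrite lt_neqAle (derivs_bounded_ge0 thM) andbT; apply/eqP => M0.
    have E : rescale z t th = fun=> 0.
      apply/funext => x; apply/eqP; rewrite -normr_le0 [leRHS]M0.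
      exact: (thM 0%N).
    by move: H; rewrite E dist0 normr0 -M0 mulr0 ltxx.
  exists (t, fun x => M^-1 * th x); split; [exact: t0|exact: tj|exact: smoothZ sth| |].
    by move=> x /= /th1 ->; rewrite mulr0.
  split=> [k x kj|] /=.
    rewrite (derive1nZ M^-1 k sth) normrM gtr0_norm ?invr_gt0//.
    by rewrite mulrC ler_pdivrMr// mul1r thM.
  rewrite (_ : rescale z t _ = fun x => M^-1 * rescale z t th x)//.
  rewrite distZ// !normrM !normfV (gtr0_norm t0) (gtr0_norm M0).
  by rewrite ltr_pdivlMl// ltr_pdivlMl//; lra.
pose t j := (p j).1; pose th j := (p j).2.
have t0 j : 0 < t j by have [] := pP j.
have sth j : smooth (th j) by have [] := pP j.
have th1 j x : 1 < `|x| -> th j x = 0 by have [_ _ _ + _] := pP j; exact.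
pose l j phi := (t j)^-1 * U (rescale z (t j) phi).
(* If n <= 4^j, the normalization bounds the n-th derivative by 1; the other j are less than n,
   hence finitely many. *)
have /choice[B BP] : forall n, exists B, forall j x, `|derive1n n (th j) x| <= B.
  move=> n; have /choice[M MP] : forall j, exists M, forall x, `|derive1n n (th j) x| <= M.
    move=> j; have [M MP] := test_derivs_bounded (test_unit (sth j) (@th1 j)) n.
    by exists M => x; apply: MP.
  exists (1 + \sum_(i < n) `|M i|) => j x; have [nj|jn] := leqP n (4 ^ j).
    have [_ _ _ _ [h _]] := pP j; apply: le_trans (h _ _ nj) _.
    by rewrite lerDl sumr_ge0.
  have jn' : (j < n)%N by apply: leq_ltn_trans jn; rewrite ltnW// ltn_expl.
  apply: le_trans (MP j x) _; apply: le_trans (ler_norm _) _.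
  rewrite (bigD1 (Ordinal jn'))//= addrCA lerDl addr_ge0// sumr_ge0//.
have B0 n : 0 <= B n by exact: le_trans (normr_ge0 _) (BP n 0%N 0).
have lB j : exists K, forall m, `|l j (th m)| <= K.
  have [N [K [K0 KP]]] := rescaled_dist_bound U z (t0 j).
  exists (K * \sum_(k < N.+1) B k) => m; apply: KP => //; first exact: th1.
  move=> k x kN; apply: le_trans (BP k m x) _.
  by rewrite (bigD1 (Ordinal (kN : (k < N.+1)%N)))//= lerDl sumr_ge0.
(* No subsequence is extracted. The j-th hump is a member of the family at which the j-th functional
   almost attains its supremum a; then a controls all later terms too, and the hump's 2/3 a 3^-j
   exceeds their total, at most 1/2 a 3^-j. *)
have /choice[am amP] : forall j, exists q : R * nat,
    (forall i, `|l j (th i)| <= q.1) /\ 2 / 3 * q.1 <= `|l j (th q.2)|.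
  move=> j; have [K KP] := lB j; have [_ _ _ _ [_ h]] := pP j.
  have [|a [m [h1 h2]]] := near_supremum KP (m0 := j).
    by apply: le_lt_trans h.
  by exists (a, m).
pose eta j := th (am j).2.
have seta j : smooth (eta j) by exact: sth.
have [cc [cc3 ccP]] := exists_signs (fun j i => l j (eta i)).
have [X sX XP] := smooth_series (f := eta) seta cc3 (fun n j y => BP n (am j).2 y).
have X1 x : 1 < `|x| -> X x = 0.
  move=> x1; apply/eqP; rewrite -normr_le0.
  apply: (@le_third _ _ _ (B 0 * (3 / 2)) 0%N) => J _.
  have := XP 0%N J x; rewrite big1 ?subr0 ?add0r//.
  by move=> i _; rewrite derive1n0 /eta (th1 _ _ x1) mulr0.
have tX := test_unit sX X1.
have lsum j J : l j (fun y => \sum_(i < J) cc i * eta i y) = \sum_(i < J) cc i * l j (eta i).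
  have tn0 : t j != 0 by rewrite gt_eqF.
  elim: J => [|J IHJ].
    rewrite big_ord0 /l (_ : rescale _ _ _ = fun=> 0) ?dist0 ?mulr0//.
    by apply/funext => y; rewrite /rescale big_ord0.
  rewrite big_ord_recr -IHJ /= /l.
  rewrite (_ : rescale _ _ _ = fun y => rescale z (t j) (fun y => \sum_(i < J) cc i * eta i y) y
     + cc J * rescale z (t j) (eta J) y); last first.
    by apply/funext => y; rewrite /rescale big_ord_recr.
  have te : test_function (rescale z (t j) (eta J)).
    by apply: (test_rescale _ tn0); apply: test_unit; [exact: seta|exact: th1].
  rewrite distD; [|apply: (test_rescale _ tn0); apply: test_unit|exact: testZ te].
  - by rewrite (distZ _ _ te) mulrDr mulrCA.
  - by have [] := @derive1n_sum _ eta cc J seta.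
  - by move=> y y1; rewrite big1// => i _; rewrite /eta (th1 _ _ y1) mulr0.
have lX j : 6^-1 * (4 / 3) ^+ j <= `|l j X|.
  have [N [K [K0 KP]]] := rescaled_dist_bound U z (t0 j).
  have [aj ajm] := amP j; set a := (am j).1 in aj ajm.
  have a4 : 4 ^+ j <= a.
    have [_ _ _ _ [_ h]] := pP j; rewrite -natrX; apply: le_trans (ltW h) _.
    exact: aj.
  have tj := third_ge0 (R := R) j.
  have E : (4 / 3) ^+ j = 4 ^+ j * 3^-1 ^+ j :> R by rewrite -exprMn.
  apply: (@le_trans _ _ (3^-1 ^+ j * (6^-1 * a))).
    by rewrite E; have := ler_wpM2r tj a4; move: (3^-1 ^+ j) (4 ^+ j) => x y; lra.
  apply: (@le_third _ _ _ (K * (\sum_(k < N.+1) B k * (3 / 2)) + 3 / 2 * a) j.+1) => J jJ.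
  have e1 : `|l j X - \sum_(i < J) cc i * l j (eta i)| <= K * (\sum_(k < N.+1) B k * (3 / 2)) * 3^-1 ^+ J.
    rewrite -lsum; set Y := (fun y : R => \sum_(i < J) cc i * eta i y).
    have [sY dY] := @derive1n_sum _ eta cc J seta.
    have Y1 x : 1 < `|x| -> Y x = 0.
      by move=> x1; rewrite /Y big1// => i _; rewrite /eta (th1 _ _ x1) mulr0.
    have tn0 : t j != 0 by rewrite gt_eqF.
    rewrite /l -mulrBr -distB; [|exact: test_rescale tn0 tX|exact: test_rescale tn0 (test_unit sY Y1)].
    rewrite -mulrA; apply: (KP (fun y => X y - Y y)).
    - exact: smoothB.
    - by move=> x x1; rewrite X1// Y1// subr0.
    - move=> k x kN.
      have -> : derive1n k (fun y => X y - Y y) x = derive1n k X x - derive1n k Y x.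
        have -> : (fun y => X y - Y y) = fun y => X y + (-1) * Y y.
          by apply/funext => y; rewrite mulN1r.
        by rewrite (derive1nD k sX (@smoothZ _ (-1) _ sY)) (derive1nZ (-1) k sY) mulN1r.
      rewrite dY; apply: le_trans (XP k J x) _; rewrite ler_wpM2r ?third_ge0//.
      rewrite (bigD1 (Ordinal (kN : (k < N.+1)%N)))//= lerDl sumr_ge0// => i _.
      by rewrite mulr_ge0//; lra.
  have e2 : `|\sum_(i < J) cc i * l j (eta i) - \sum_(i < j.+1) cc i * l j (eta i)| <= a * (3 / 2) * (3^-1 ^+ j.+1 - 3^-1 ^+ J).
    apply: (@sum_third_le _ (fun i => cc i * l j (eta i))); last exact: jJ.
    move=> i; rewrite normrM mulrC; apply: ler_pM; [exact: normr_ge0|exact: normr_ge0| |exact: cc3].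
    exact: aj.
  have e3 := ccP j; have e4 := ler_wpM2l tj ajm.
  have n1 := ler_distD (\sum_(i < J) cc i * l j (eta i)) (l j X) (\sum_(i < j.+1) cc i * l j (eta i)).
  have n2 := lerB_dist (\sum_(i < j.+1) cc i * l j (eta i)) (l j X).
  rewrite distrC in n2; rewrite exprS in e2.
  have e4' : 3^-1 ^+ j * (2 / 3 * a) <= `|\sum_(i < j.+1) cc i * l j (eta i)|.
    exact: le_trans e4 e3.
  have eA : a * (3 / 2) * (3^-1 * 3^-1 ^+ j - 3^-1 ^+ J) = 3^-1 ^+ j * (a / 2) - 3 / 2 * a * 3^-1 ^+ J by field.
  rewrite eA in e2; rewrite mulrDl.
  have eB : 3^-1 ^+ j * (6^-1 * a) = 3^-1 ^+ j * (2 / 3 * a) - 3^-1 ^+ j * (a / 2) by field.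
  rewrite eB.
  have aJ : 0 <= 3 / 2 * a * 3^-1 ^+ J.
    by rewrite mulr_ge0 ?third_ge0// mulr_ge0 ?(le_trans _ a4) ?exprn_ge0//; lra.
  move: e1 e2 n1 n2 e4' aJ; lra.
have /cvgrPdist_lt/(_ 1 ltr01) := Uc X tX.
rewrite /dnbhs/= => /nbhs_ballP[d /= d0 dP].
set Y := c * _ in dP.
(* For such j the scale t j is below d, where the values are within 1 of Y, whereas (4/3)^j / 6
   exceeds |Y| + 1. *)
have [j jP] : exists j : nat, 6 * 3 * (`|Y| + 1) + d^-1 < j%:R.
  exists (Num.truncn (6 * 3 * (`|Y| + 1) + d^-1)).+1; exact: truncnS_gt.
have dj : d^-1 < j%:R by apply: le_lt_trans jP; rewrite lerDr; have := normr_ge0 Y; lra.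
have tjd : t j < d.
  have [_ tj _ _ _] := pP j; apply: lt_trans tj _.
  rewrite -[ltRHS]invrK ltf_pV2 ?posrE ?invr_gt0//; apply: lt_trans dj _.
  by rewrite ltr_nat ltnS ltnW// ltn_expl.
have /= := dP (t j); rewrite /ball/= sub0r normrN (gtr0_norm (t0 j)) => /(_ tjd).
rewrite gt_eqF// => /(_ isT); rewrite -/(l j X) => h.
have := le_trans (ler_wpM2l _ (four_thirds_ge j)) (lX j).
rewrite invr_ge0 => /(_ ltac:(lra)).
have := lerB_dist (l j X) Y; rewrite distrC.
have di : 0 < d^-1 by rewrite invr_gt0.
move: h jP di; set q := `|Y - _|; set w := `|l j X|; set jr : R := j%:R; set y := `|Y|; lra.
Qed.

End UniformBoundedness.

Section ScaledBounds.
Context {R : realType}.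
Implicit Types (U : schwartz_dist R) (theta phi psi : R -> R) (z y t M : R).

Lemma scaled_boundS U m n z : (m <= n)%N -> scaled_bound U m z ->
  scaled_bound U n z.
Proof.
move=> mn Um t th M t0 tn sth th1 thM; have M0 := derivs_bounded_ge0 thM.
apply: le_trans (Um t th M t0 _ sth th1 _) _.
- by apply: lt_le_trans tn _; rewrite lef_pV2 ?posrE// ler_nat.
- by move=> k x km; apply: thM; exact: leq_trans mn.
- by rewrite ler_wpM2r// ler_wpM2r ?ler_nat// ltW.
Qed.

(** A translation by at most k t is absorbed by looking from y at the larger scale (k + 1) t. The
    chain rule costs (k + 1)^n and the scale one more factor. *)
Lemma scaled_bound_translate U n y z t (k : R) theta M :
  scaled_bound U n y -> 0 <= k -> `|z - y| <= k * t -> 0 < t ->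
  (k + 1) * t < n.+1%:R^-1 ->
  smooth theta -> (forall x, 1 < `|x| -> theta x = 0) ->
  (forall i x, (i <= n)%N -> `|derive1n i theta x| <= M) ->
  `|U (rescale z t theta)| <= n%:R * (k + 1) ^+ n.+1 * t * M.
Proof.
move=> Uy k0 zy t0 ktn sth th1 thM.
have M0 := derivs_bounded_ge0 thM.
have k1 : 0 < k + 1 by lra.
pose th' (w : R) := theta ((k + 1) * w + - ((z - y) / t)).
have -> : rescale z t theta = rescale y ((k + 1) * t) th'.
  apply/funext => x; rewrite /rescale /th'; congr theta.
  by field; rewrite !gt_eqF.
have := Uy ((k + 1) * t) th' ((k + 1) ^+ n * M) (mulr_gt0 k1 t0) ktn.
rewrite (_ : n%:R * _ * _ * M = n%:R * ((k + 1) * t) * ((k + 1) ^+ n * M)); last first.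
  by rewrite exprS; ring.
apply.
- exact: smooth_affine.
- move=> x x1; apply: th1.
  have e1 : `|(z - y) / t| <= k by rewrite normrM normfV (gtr0_norm t0) ler_pdivrMr.
  have e2 : `|(k + 1) * x| = (k + 1) * `|x| by rewrite normrM gtr0_norm.
  have e3 : k + 1 < (k + 1) * `|x| by rewrite ltr_pMr.
  by have := lerB_dist ((k + 1) * x) ((z - y) / t); lra.
- move=> i x ni; rewrite (derive1n_affine _ _ _ sth) normrM.
  apply: ler_pM => //; last exact: thM.
  rewrite normrX gtr0_norm// ler_weXn2l//; lra.
Qed.

(** A failure at z is witnessed by one test function, and U is continuous along its translates. *)
Lemma closed_scaled_bound U n : closed [set z | scaled_bound U n z].
Proof.
rewrite -[X in closed X]setCK; apply: open_closedC; rewrite openE => z /=.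
move=> /existsNP[t] /existsNP[th] /existsNP[M] /not_implyP[t0] /not_implyP[tn].
move=> /not_implyP[sth] /not_implyP[th1] /not_implyP[thM] /negP; rewrite -ltNge => H.
have cU := has_deriv_continuous (dist_translate U t0 (test_unit sth th1)).
have : \forall w \near z, n%:R * t * M < `|U (rescale w t th)|.
  have : (fun w => `|U (rescale w t th)|) @ z --> `|U (rescale z t th)|.
    by apply: cvg_norm; exact: cU.
  by move=> /cvgr_gt; apply.
apply: filterS => w h Uw; have := Uw t th M t0 tn sth th1 thM.
by rewrite leNgt h.
Qed.

End ScaledBounds.

(** * An antiderivative of U where the scaled bounds are uniform *)

Section Antiderivative.
Context {R : realType}.
Variables (U : schwartz_dist R) (al be : R) (n : nat).
Hypothesis albe : al < be.
Hypothesis Un : forall z, al <= z -> z <= be -> scaled_bound U n z.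

Let r := `|al| + `|be| + 2.

(** A smoothed form of minus U applied to the indicator of the half-line above z, whose derivative
    in z is an average of U. The plateau only supplies compact support. *)
Let A (t z : R) := - U (fun y => plateau r y * rescale z t step y).

Let A' (t z : R) := t^-1 * U (fun y => plateau r y * rescale z t bump y).

Let plateau1 (y : R) : al <= y -> y <= be + 1 -> plateau r y = 1.
Proof.
move=> ay yb; apply: plateau_eq1; rewrite /r ler_norml.
have := ler_norm be; have := ler_norm (- al); rewrite normrN.
have := normr_ge0 al; have := normr_ge0 be => *; apply/andP; split; lra.
Qed.

Let plateau_rescale (z t : R) (phi : R -> R) : al <= z -> z <= be -> 0 < t -> t < 1 ->
  (forall x, x < 0 -> phi x = 0) -> (forall x, 1 < x -> phi x = 0) ->
  (fun y => plateau r y * rescale z t phi y) = rescale z t phi.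
Proof.
move=> az zb t0 t1 phi0 phi1; apply/funext => y.
have [yz|yz] := ltP y z.
  by rewrite /rescale phi0 ?mulr0// pmulr_llt0 ?invr_gt0// subr_lt0.
have [yz'|yz'] := leP (y - z) t; last first.
  by rewrite /rescale phi1 ?mulr0// ltr_pdivlMr// mul1r.
by rewrite plateau1 ?mul1r//; lra.
Qed.

Let A_deriv t : 0 < t -> has_deriv (A t) (A' t).
Proof.
move=> t0; have tN0 : t != 0 by rewrite gt_eqF.
have := has_derivN (dist_translate_cutoff U tN0 (test_plateau r)
  (@smooth_step R) derivs_bounded_step step_deriv).
by move=> /has_deriv_eq; apply => z; rewrite mulNr opprK.
Qed.

Let A'_cts t : 0 < t -> continuous (A' t).
Proof.
move=> t0; have tN0 : t != 0 by rewrite gt_eqF.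
apply: ctsZ; exact: (has_deriv_continuous (dist_translate_cutoff U tN0 (test_plateau r)
  (@smooth_bump R) (test_derivs_bounded test_bump) (smooth_deriv (@smooth_bump R)))).
Qed.

Let bump1 (x : R) : 1 < `|x| -> bump x = 0.
Proof.
move=> x1; apply: bump_eq0; have [x0|x0] := leP 0 x.
  by right; move: x1; rewrite ger0_norm// => /ltW.
by left; lra.
Qed.

Let A'E t z : al <= z -> z <= be -> 0 < t -> t < 1 ->
  A' t z = t^-1 * U (rescale z t bump).
Proof.
move=> az zb t0 t1; rewrite /A' plateau_rescale//.
- by move=> x x0; apply: bump_eq0; left; lra.
- by move=> x x1; apply: bump_eq0; right; exact: ltW.
Qed.

(** Geometric scales under the threshold of [scaled_bound]; n + 2 makes the inequality strict from j
    = 0 on. *)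
Let t_ (j : nat) : R := (n.+2%:R)^-1 * 3^-1 ^+ j.

Let t_gt0 j : 0 < t_ j.
Proof. by rewrite mulr_gt0 ?invr_gt0// exprn_gt0// invr_gt0. Qed.

Let n2_lt : n.+2%:R^-1 < n.+1%:R^-1 :> R.
Proof. by rewrite ltf_pV2 ?posrE// ltr_nat. Qed.

Let t_lt j : t_ j < n.+1%:R^-1.
Proof.
apply: le_lt_trans n2_lt; rewrite ler_piMr ?invr_ge0//.
by rewrite exprn_ile1 ?invr_ge0// invf_le1//; lra.
Qed.

Let t_lt1 j : t_ j < 1.
Proof. by apply: lt_le_trans (t_lt j) _; rewrite invf_le1// ler1n. Qed.

Let tS j : t_ j.+1 = 3^-1 * t_ j.
Proof. by rewrite /t_ exprS; ring. Qed.

Let bound_bump : exists2 K, 0 <= K & forall t z, 0 < t -> t < n.+1%:R^-1 -> t < 1 ->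
  al <= z -> z <= be -> `|A' t z| <= K.
Proof.
have [M MP] := test_derivs_bounded (@test_bump R) n.
have M0 := derivs_bounded_ge0 MP.
exists (n%:R * M); first by rewrite mulr_ge0.
move=> t z t0 tn t1 az zb; rewrite A'E// normrM gtr0_norm ?invr_gt0//.
rewrite ler_pdivrMl//.
have := Un az zb t0 tn (@smooth_bump R) bump1 MP.
by rewrite (_ : n%:R * t * M = t * (n%:R * M))//; ring.
Qed.

(** The step is not compactly supported, but the difference of two steps at consecutive scales is;
    the scaled bound at z applies to it and decays like the scale. *)
Let bound_step : exists2 K, 0 <= K & forall j z, al <= z -> z <= be ->
  `|A (t_ j.+1) z - A (t_ j) z| <= K * 3^-1 ^+ j.
Proof.
pose d (x : R) := step x - step (3 * x).
have sd : smooth d.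
  apply: smoothB; first exact: smooth_step.
  by have := smooth_affine 3 0 (@smooth_step R); under eq_fun do rewrite addr0.
have d0 (x : R) : x < 0 -> d x = 0 by move=> x0; rewrite /d !step_eq0 ?subrr//; lra.
have dd1 (x : R) : 1 < x -> d x = 0 by move=> x1; rewrite /d !step_eq1 ?subrr//; lra.
have d1 (x : R) : 1 < `|x| -> d x = 0.
  move=> x1; have [x0|x0] := leP 0 x; last exact: d0.
  by apply: dd1; move: x1; rewrite ger0_norm.
have [M MP] := test_derivs_bounded (test_unit sd d1) n.
have M0 := derivs_bounded_ge0 MP.
exists (n%:R * M); first by rewrite mulr_ge0.
move=> j z az zb.
have -> : A (t_ j.+1) z - A (t_ j) z = U (rescale z (t_ j) d).
  rewrite /A opprK addrC -distB; last 2 first.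
    by apply: testM; [exact: test_plateau|apply: smooth_rescale; exact: smooth_step].
    by apply: testM; [exact: test_plateau|apply: smooth_rescale; exact: smooth_step].
  rewrite -(plateau_rescale az zb (t_gt0 j) (t_lt1 j) d0 dd1); congr (U _).
  apply/funext => y; rewrite -mulrBr; congr (_ * _).
  rewrite /rescale /d; congr (_ - step _); rewrite tS.
  by field; rewrite gt_eqF.
apply: le_trans (Un az zb (t_gt0 j) (t_lt j) sd d1 MP) _.
rewrite mulrAC ler_wpM2l ?mulr_ge0// ler_piMl ?third_ge0//.
by rewrite invf_le1// ler1n.
Qed.

Let W_exists : exists W : R -> R, exists2 K, 0 <= K & forall z, al <= z -> z <= be ->
  forall J, `|W z - A (t_ J) z| <= K * 3^-1 ^+ J.
Proof.
have [K K0 KP] := bound_step.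
have /choice[W WP] : forall z, exists w, al <= z -> z <= be ->
    forall J, `|w - A (t_ J) z| <= K * (3 / 2) * 3^-1 ^+ J.
  move=> z; have [az|] := leP al z; last by exists 0.
  have [zb|] := leP z be; last by exists 0.
  have [L LP] := third_series (fun j => KP j z az zb).
  exists (L + A (t_ 0) z) => _ _ J.
  rewrite (_ : _ - _ = L - \sum_(j < J) (A (t_ j.+1) z - A (t_ j) z))//.
  suff -> : \sum_(j < J) (A (t_ j.+1) z - A (t_ j) z) = A (t_ J) z - A (t_ 0) z by ring.
  elim: J => [|J IHJ]; first by rewrite big_ord0 subrr.
  by rewrite big_ord_recr/= IHJ addrC subrKA.
by exists W, (K * (3 / 2)); [rewrite mulr_ge0//; lra|exact: WP].
Qed.

(** [W] is the limit of [A t] for t tending to 0, and is Lipschitz because the derivatives of [A t]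
    are bounded averages of U. With psi in place of the plateau one gets functions of total
    increment U psi whose derivative is nearly that of [A t] times psi; integration by parts gives
    the formula. The smooth step rises to the right of z, which is why a margin is needed at al but
    not at be. *)
Lemma antiderivative : exists W : R -> R, continuous W /\
  forall psi c, test_function psi -> al < c ->
    (forall x, x <= c \/ be <= x -> psi x = 0) ->
    U psi = - cint (fun z => W z * derive1 psi z) al be.
Proof.
have [W0 [K K0 W0P]] := W_exists; have [Kb Kb0 KbP] := bound_bump.
have ab := ltW albe.
(* The retraction of the line onto [al, be]; being 1-Lipschitz, it extends W by constants without
   loss in the Lipschitz bound. *)
pose clamp (x : R) := Num.max al (Num.min x be).
have clampP x : al <= clamp x /\ clamp x <= be.
  by rewrite /clamp le_max lexx ge_max ab ge_min lexx orbT.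
have clamp_id x : al <= x -> x <= be -> clamp x = x.
  by move=> ax xb; rewrite /clamp min_l// max_r.
have clamp_lip x y : `|clamp x - clamp y| <= `|x - y|.
  wlog xy : x y / x <= y.
    by move=> H; have [/H//|/ltW/H] := leP x y; rewrite distrC [X in _ <= X]distrC.
  have min_mono u v : u <= v -> Num.min u be <= Num.min v be.
    by move=> uv; rewrite le_min !ge_min uv lexx orbT.
  have mono : clamp x <= clamp y.
    by rewrite ge_max le_max lexx/= le_max min_mono ?orbT.
  rewrite distrC (distrC x) !ger0_norm ?subr_ge0// /clamp.
  rewrite lerBlDr ge_max; apply/andP; split.
    have : al <= Num.max al (Num.min x be) by rewrite le_max lexx.
    by move=> h; apply: le_trans h _; rewrite lerDr subr_ge0.
  have h : Num.min x be <= Num.max al (Num.min x be) by rewrite le_max lexx orbT.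
  apply: le_trans (lerD (lexx (y - x)) h); rewrite ge_min.
  have [xb|xb] := leP x be; first by rewrite subrK lexx.
  by rewrite lerDr subr_ge0 xy orbT.
pose W x := W0 (clamp x).
have W_lip x y : `|W x - W y| <= Kb * `|x - y|.
  have [cx1 cx2] := clampP x; have [cy1 cy2] := clampP y.
  apply: (@le_trans _ _ (Kb * `|clamp x - clamp y|)); last by rewrite ler_wpM2l.
  apply: (@le_third _ _ _ (2 * K) 0%N) => J _.
  have h1 := W0P _ cx1 cx2 J; have h2 := W0P _ cy1 cy2 J.
  have h3 : `|A (t_ J) (clamp x) - A (t_ J) (clamp y)| <= Kb * `|clamp x - clamp y|.
    have dA := A_deriv (t_gt0 J).
    have key u v : al <= u -> u <= v -> v <= be ->
        `|A (t_ J) v - A (t_ J) u| <= Kb * `|v - u|.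
      move=> au uv vb; rewrite (ger0_norm (_ : 0 <= v - u)) ?subr_ge0//.
      apply: has_deriv_norm_le dA uv _ => w uw wv.
      apply: (KbP _ w (t_gt0 J) (t_lt J) (t_lt1 J)); first exact: le_trans uw.
      exact: le_trans wv vb.
    have [xy|/ltW yx] := leP (clamp y) (clamp x); first exact: key.
    by rewrite distrC (distrC (clamp x)); exact: key.
  rewrite /W (_ : _ - _ = (W0 (clamp x) - A (t_ J) (clamp x))
    - (W0 (clamp y) - A (t_ J) (clamp y))
    + (A (t_ J) (clamp x) - A (t_ J) (clamp y))); last by ring.
  apply: le_trans (ler_normD _ _) _; rewrite addrC; apply: lerD => //.
  by apply: le_trans (ler_normB _ _) _; rewrite -mulrA mulr_natl mulr2n lerD.
have cW : continuous W.
  move=> x; apply/cvgrPdist_le => e e0.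
  apply/nbhs_ballP; exists (e / (Kb + 1)) => /=; first by rewrite divr_gt0//; lra.
  move=> y; rewrite /ball/= ltr_pdivlMr; last lra.
  by have := W_lip x y; have := normr_ge0 (x - y); move: `|x - y| => q; nra.
exists W; split=> // psi c tpsi ac psi0.
have spsi := test_smooth tpsi; have bpsi := test_derivs_bounded tpsi.
have [M1 M1P] := bpsi n.+1; have M10 := derivs_bounded_ge0 M1P.
have [Mb MbP] := test_derivs_bounded (@test_bump R) n.
have Mb0 := derivs_bounded_ge0 MbP.
pose B (t z : R) := - U (fun y => psi y * rescale z t step y).
pose B' (t z : R) := t^-1 * U (fun y => psi y * rescale z t bump y).
have dB t : 0 < t -> has_deriv (B t) (B' t).
  move=> t0; have tN0 : t != 0 by rewrite gt_eqF.
  have := has_derivN (dist_translate_cutoff U tN0 tpsi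
    (@smooth_step R) derivs_bounded_step step_deriv).
  by move=> /has_deriv_eq; apply => z; rewrite mulNr opprK.
have cB t : 0 < t -> continuous (B' t).
  move=> t0; have tN0 : t != 0 by rewrite gt_eqF.
  apply: ctsZ; exact: (has_deriv_continuous (dist_translate_cutoff U tN0 tpsi
    (@smooth_bump R) (test_derivs_bounded test_bump) (smooth_deriv (@smooth_bump R)))).
(* At z = be the step lives where psi vanishes; at z = al it equals 1 on the support of psi once t <
   c - al. *)
have UB t : 0 < t -> t < c - al -> U psi = cint (B' t) al be.
  move=> t0 tc; rewrite (cint_deriv _ _ (cB t t0) (dB t t0)) /B.
  rewrite (_ : (fun y => psi y * rescale be t step y) = fun=> 0); last first.
    apply/funext => y; have [yb|yb] := leP be y; first by rewrite psi0 ?mul0r//; right.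
    rewrite /rescale step_eq0 ?mulr0// ler_pdivrMr//.
    by have := mulr_gt0 (_ : 0 < 1 / 2 :> R) t0; lra.
  rewrite (_ : (fun y => psi y * rescale al t step y) = psi); last first.
    apply/funext => y; have [yc|yc] := leP y c; first by rewrite psi0 ?mul0r//; left.
    by rewrite /rescale step_eq1 ?mulr1// ler_pdivlMr//; lra.
  by rewrite dist0 oppr0 add0r opprK.
have cpsi := smooth_continuous spsi; have cpsi' := smooth_continuous (smooth_derive1 spsi).
have AB t z : al <= z -> z <= be -> 0 < t -> t < n.+1%:R^-1 -> t < 1 ->
    `|B' t z - A' t z * psi z| <= (n%:R * (2 ^+ n * (M1 * Mb))) * t.
  move=> az zb t0 tn t1; rewrite A'E// /B' -[X in _ - X]mulrA -mulrBr.
  have ti : 0 < t^-1 by rewrite invr_gt0.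
  have tN0 : t != 0 by rewrite gt_eqF.
  (* B' - A' psi pairs U with the bump times psi - psi z at scale t; in the rescaled variable this
     factor and its derivatives are O(t). *)
  pose om y := (psi (t * y + z) + - psi z) * bump y.
  have sps : smooth (fun y => psi (t * y + z) + - psi z).
    by apply: smoothD; [exact: smooth_affine|exact: smooth_cst].
  have som : smooth om by apply: smoothM; [exact: sps|exact: smooth_bump].
  have om1 x : 1 < `|x| -> om x = 0 by move=> x1; rewrite /om bump1 ?mulr0.
  rewrite (_ : U _ - _ * _ = U (rescale z t om)); last first.
    rewrite [_ * psi z]mulrC -distZ; last exact: test_rescale tN0 test_bump.
    rewrite -distB; last 2 first.
    - by apply: testM; [exact: tpsi|apply: smooth_rescale; exact: smooth_bump].
    - by apply: testZ; exact: test_rescale tN0 test_bump.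
    congr (U _); apply/funext => y; rewrite /rescale /om.
    by rewrite (_ : t * ((y - z) / t) + z = y) ?mulrBl//; field.
  rewrite normrM (gtr0_norm ti) ler_pdivrMl//.
  have := Un az zb t0 tn som om1.
  move=> /(_ (2 ^+ n * (t * M1 * Mb))).
  rewrite (_ : n%:R * t * _ = t * (n%:R * (2 ^+ n * (M1 * Mb)) * t)); last by ring.
  apply=> k x kn; have [x1|x1] := leP `|x| 1; last first.
    rewrite (derive1n_vanish _ om1 x1) normr0 !mulr_ge0 ?exprn_ge0//; exact: ltW.
  apply: (derive1nM_le sps (@smooth_bump R) _ (fun i => MbP i x) kn).
  case=> [_|i iN].
    rewrite derive1n0; have := has_deriv_lipschitz z (t * x + z) (smooth_deriv spsi)
      (fun w => M1P 1%N w isT).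
    move=> /le_trans; apply; rewrite addrK normrM gtr0_norm// mulrC.
    by rewrite ler_wpM2r// ler_piMr// ltW.
  rewrite (derive1nD _ (smooth_affine t z spsi) (@smooth_cst R (- psi z))).
  rewrite [X in _ + X](_ : _ = 0) ?addr0; last first.
    by rewrite derive1Sn (has_deriv_derive1 (has_deriv_cst (- psi z))) derive1n_zero.
  rewrite (derive1n_affine _ _ _ spsi) normrM normrX gtr0_norm//.
  apply: ler_pM => //; first by rewrite exprn_ge0// ltW.
    by rewrite exprS ler_piMr ?(ltW t0)// exprn_ile1// ltW.
  by apply: M1P; exact: leqW.
apply/eqP; rewrite -subr_eq0 opprK -normr_le0.
pose C1 := n%:R * (2 ^+ n * (M1 * Mb)).
apply: (@le_third _ _ _ (C1 * (be - al) + K * M1 * (be - al))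
  (Num.truncn (c - al)^-1).+1) => J Jc; rewrite add0r.
have cal : 0 < c - al by rewrite subr_gt0.
have tJ : t_ J < c - al.
  apply: (@le_lt_trans _ _ (3^-1 ^+ J)).
    by rewrite ler_piMl ?third_ge0// invf_le1// ler1n.
  rewrite exprVn -[ltRHS]invrK ltf_pV2 ?posrE ?invr_gt0//.
  apply: lt_trans (truncnS_gt _) _; rewrite -natrX ltr_nat.
  by apply: leq_ltn_trans Jc _; rewrite ltn_expl.
have tJ3 : t_ J <= 3^-1 ^+ J by rewrite ler_piMl ?third_ge0// invf_le1// ler1n.
have cA := has_deriv_continuous (A_deriv (t_gt0 J)).
have cA' := A'_cts (t_gt0 J); have cB' := cB _ (t_gt0 J).
have parts := cint_parts al be (A_deriv (t_gt0 J)) (smooth_deriv spsi) cA' cpsi'.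
rewrite (psi0 be) ?(psi0 al) ?mulr0 ?subrr ?sub0r in parts; last 2 first.
- by left; exact: ltW.
- by right.
have e1 : `|cint (B' (t_ J)) al be - cint (fun z => A' (t_ J) z * psi z) al be|
    <= C1 * t_ J * (be - al).
  rewrite -(cintB _ _ cB' (ctsM cA' cpsi)).
  apply: cint_norm_le => //; first exact: ctsB cB' (ctsM cA' cpsi).
  by move=> z az zb; apply: AB.
have e2 : `|cint (fun z => W z * derive1 psi z) al be -
    cint (fun z => A (t_ J) z * derive1 psi z) al be| <= K * 3^-1 ^+ J * M1 * (be - al).
  rewrite -(cintB _ _ (ctsM cW cpsi') (ctsM cA cpsi')).
  apply: cint_norm_le => //; first exact: ctsB (ctsM cW cpsi') (ctsM cA cpsi').
  move=> z az zb; rewrite -mulrBl normrM; apply: ler_pM => //.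
    by rewrite /W clamp_id//; exact: W0P.
  exact: (M1P 1%N).
have parts' : cint (fun z => A' (t_ J) z * psi z) al be =
    - cint (fun z => A (t_ J) z * derive1 psi z) al be by rewrite parts opprK.
rewrite parts' opprK -(UB _ (t_gt0 J) tJ) in e1.
set I1 := cint (fun z => W z * _) _ _ in e2 *.
set I2 := cint (fun z => A (t_ J) z * _) _ _ in e1 e2.
have -> : U psi + I1 = (U psi + I2) + (I1 - I2) by ring.
apply: le_trans (ler_normD _ _) _; apply: le_trans (lerD e1 e2) _.
rewrite mulrDl; apply: lerD; last by rewrite le_eqVlt; apply/orP; left; apply/eqP; ring.
have C10 : 0 <= C1 * (be - al).
  by rewrite mulr_ge0 ?subr_ge0// /C1 !mulr_ge0// exprn_ge0.
by rewrite mulrAC; exact: ler_wpM2l C10 _ _ tJ3.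
Qed.

End Antiderivative.

(** * A convexity criterion *)

Definition second_diff {R : realType} (f : R -> R) (x y : R) :=
  f (x + y) + f (x - y) - 2 * f x.

Lemma cts_norm {R : realType} (f : R -> R) : continuous f -> continuous (fun x => `|f x|).
Proof. by move=> cf x; exact: (cvg_norm (cf x)). Qed.

(** * Potentials of small open sets *)

Section ConvexPotential.
Context {R : realType}.
Implicit Types (x y z c d : R) (A : set R).
Local Notation mu := (@lebesgue_measure R).

Section DistancePotential.
Variables (A : set R) (c d : R).
Hypothesis mA : measurable A.
Hypothesis Acd : A `<=` `[c, d].

Let pot x := \int[mu]_(z in A) `|x - z|.

Let intA (f : R -> R) : continuous f -> mu.-integrable A (EFin \o f).
Proof. by move=> cf; apply: integrableS (@continuous_integrable _ f c d cf). Qed.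

Let cts_dist x : continuous (fun z : R => `|x - z|).
Proof.
apply: (@cts_norm _ (fun z => x - z)).
by apply: (@ctsB _ (fun=> x)); [exact: cts_cst|move=> ?; exact: cvg_id].
Qed.

Let m := fine (mu A).

Let Rint_cst C : \int[mu]_(z in A) C = C * m.
Proof. by rewrite Rintegral_cst. Qed.

Lemma potential_lipschitz x x' : `|pot x - pot x'| <= m * `|x - x'|.
Proof.
rewrite /pot -RintegralB//; [|exact/intA/cts_dist..].
have cc := ctsB (@cts_dist x) (@cts_dist x').
apply: le_trans (@le_normr_Rintegral _ _ R mu A _ mA (intA cc)) _.
rewrite mulrC -Rint_cst; apply: le_Rintegral => //.
- exact: intA (cts_norm cc).
- by apply: intA; exact: cts_cst.
- move=> z _; apply: le_trans (ler_dist_dist _ _) _.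
  by rewrite opprB addrA addrNK.
Qed.

Lemma potential_bound x : `|pot x| <= (`|x| + `|c| + `|d|) * m.
Proof.
rewrite ger0_norm; last by apply: Rintegral_ge0.
rewrite -Rint_cst; apply: le_Rintegral => //.
- exact/intA/cts_dist.
- by apply: intA; exact: cts_cst.
- move=> z /Acd; rewrite /= in_itv/= => /andP[cz zd].
  apply: le_trans (ler_normB _ _) _; rewrite -addrA lerD2l.
  rewrite ler_norml; have := ler_norm d; have := ler_norm (- c).
  by rewrite normrN => *; apply/andP; split; have := normr_ge0 d; have := normr_ge0 c; lra.
Qed.

Let kern x y z : R := `|x + y - z| + `|x - y - z| - 2 * `|x - z|.

Let kern_cts x y : continuous (kern x y).
Proof. by apply: ctsB; [apply: ctsD; exact: cts_dist|apply: ctsZ; exact: cts_dist]. Qed.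

Let kern_ge0 x y z : 0 <= kern x y z.
Proof.
rewrite /kern; have := ler_normD (x + y - z) (x - y - z).
rewrite (_ : _ + (x - y - z) = 2 * (x - z)); last by ring.
by rewrite normrM (ger0_norm (_ : 0 <= 2 :> R))//; lra.
Qed.

Let second_diffE x y : second_diff pot x y = \int[mu]_(z in A) kern x y z.
Proof.
have h1 := @cts_dist (x + y); have h2 := @cts_dist (x - y); have h3 := @cts_dist x.
rewrite /second_diff /pot -RintegralD//; [|exact: intA h1|exact: intA h2].
rewrite -RintegralZl//; last exact: intA h3.
rewrite -RintegralB//; first exact: intA (ctsD h1 h2).
exact: intA (ctsZ h3).
Qed.

Lemma potential_second_diff_ge0 x y : 0 <= second_diff pot x y.
Proof. by rewrite second_diffE; apply: Rintegral_ge0. Qed.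

(** For |x - z| <= y/2 the integrand is at least 2 y - y, and these z fill an interval of length
    y. *)
Lemma potential_second_diff_ge x y : 0 < y -> `[x - y, x + y] `<=` A ->
  y ^+ 2 <= second_diff pot x y.
Proof.
move=> y0 xyA; rewrite second_diffE; set B := `[x - y / 2, x + y / 2]%classic.
have BA : B `<=` A.
  apply: subset_trans xyA => z; rewrite /B/= !in_itv/= => /andP[? ?].
  by apply/andP; split; lra.
have mB : measurable B by exact: measurable_itv.
have iB (f : R -> R) : continuous f -> mu.-integrable B (EFin \o f).
  by move=> cf; exact: continuous_integrable.
rewrite -(setDUK BA) Rintegral_setU//; last 3 first.
- exact: measurableD.
- by rewrite setDUK//; exact: intA (@kern_cts x y).
- by apply/disj_setPS => z [zB [_ +]].
have -> : y ^+ 2 = \int[mu]_(z in B) y.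
  rewrite Rintegral_cst//= lebesgue_measure_itv/= lte_fin ifT; last lra.
  by rewrite -EFinB/= expr2; congr (_ * _); lra.
rewrite -[leLHS]addr0; apply: lerD; last exact: Rintegral_ge0.
apply: le_Rintegral => //.
- by apply: iB; exact: cts_cst.
- by apply: iB; exact: kern_cts.
move=> z; rewrite /B/= in_itv/= => /andP[z1 z2].
have h : `|x - z| <= y / 2 by rewrite ler_norml; apply/andP; split; lra.
have := ler_norm (x + y - z); have := ler_norm (- (x - y - z)).
by rewrite normrN /kern; lra.
Qed.

End DistancePotential.

(* Small convex functions whose second derivative is infinite on [Z]. *)
Lemma convex_penalty (Z : set R) c d (eta : R) : 0 < eta -> mu.-negligible Z ->
  exists Om : R -> R, [/\ continuous Om,
    forall x, c <= x -> x <= d -> `|Om x| <= eta,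
    forall x y, 0 <= second_diff Om x y &
    forall x, Z x -> c < x -> x < d -> forall K, exists2 e, 0 < e &
      forall y, 0 < y -> y < e -> K * y ^+ 2 <= second_diff Om x y].
Proof.
move=> eta0 [N [mN N0 ZN]].
(* L bounds |x| + |c| + |d| on [c, d], so that the potentials sum up to at most (3/2) L e0 = (3/4)
   eta. *)
pose L := (`|c| + `|d|) * 2 + 1.
have L1 : 1 <= L by rewrite /L; have := normr_ge0 c; have := normr_ge0 d; lra.
pose e0 := eta / (L * 2).
have e00 : 0 < e0 by rewrite divr_gt0//; lra.
(* Open neighbourhoods of N of summable measure. A point of N belongs to all of them, and each adds
   at least y^2 to its second difference for small y. *)
have /choice[Q QP] : forall n : nat, exists Q : set R,
    [/\ open Q, N `<=` Q & (mu Q < (e0 * 3^-1 ^+ n)%:E)%E].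
  move=> n; have [| |Q [oQ NQ mQ]] := @lebesgue_regularity_outer R N (e0 * 3^-1 ^+ n) mN.
  - by rewrite [X in (X < _)%E](N0 : lebesgue_measure N = 0%E).
  - by rewrite mulr_gt0// exprn_gt0// invr_gt0.
  exists Q; split=> //; rewrite -(setDUK NQ) measureU//; last 2 first.
  - by apply: measurableD => //; exact: open_measurable.
  - by rewrite setDE setICA setICr setI0.
  rewrite [X in (X + _ < _)%E](N0 : lebesgue_measure N = 0%E) add0e.
  exact: mQ.
pose A n := Q n `&` `[c, d].
have mA n : measurable (A n).
  by apply: measurableI => //; apply: open_measurable; have [] := QP n.
have Acd n : A n `<=` `[c, d] by move=> x [].
have mAn n : fine (mu (A n)) <= e0 * 3^-1 ^+ n.
  have [oQ _ mQ] := QP n.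
  have h : (mu (A n) <= (e0 * 3^-1 ^+ n)%:E)%E.
    apply: le_trans (ltW mQ); apply: le_measure; rewrite ?inE.
    - exact: mA.
    - exact: open_measurable oQ.
    - exact: subIsetl.
  rewrite -lee_fin fineK// ge0_fin_numE//.
  by apply: le_lt_trans h _; rewrite ltry.
have m0 n : 0 <= fine (mu (A n)) by rewrite fine_ge0.
pose pot n x := \int[mu]_(z in A n) `|x - z|.
have potB n x : `|pot n x| <= (`|x| + `|c| + `|d|) * e0 * 3^-1 ^+ n.
  apply: le_trans (potential_bound (mA n) (Acd n) x) _.
  by rewrite -mulrA ler_wpM2l// !addr_ge0.
have /choice[Om OmP] : forall x, exists l, forall J,
    `|l - \sum_(j < J) pot j x| <= (`|x| + `|c| + `|d|) * e0 * (3 / 2) * 3^-1 ^+ J.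
  by move=> x; exact: third_series (fun j => potB j x).
pose K x := (`|x| + `|c| + `|d|) * e0 * (3 / 2).
have sdJ x y J : `|second_diff Om x y - \sum_(j < J) second_diff (pot j) x y| <=
    (K (x + y) + K (x - y) + 2 * K x) * 3^-1 ^+ J.
  have -> : \sum_(j < J) second_diff (pot j) x y = second_diff (fun x => \sum_(j < J) pot j x) x y.
    by rewrite /second_diff sumrB big_split/= mulr_sumr.
  have h1 := OmP (x + y) J; have h2 := OmP (x - y) J; have h3 := OmP x J.
  have h4 := normrM 2 (Om x - \sum_(j < J) pot j x).
  rewrite (ger0_norm (_ : 0 <= 2 :> R))// in h4.
  rewrite /second_diff (_ : _ - _ = (Om (x + y) - \sum_(j < J) pot j (x + y)) +
    (Om (x - y) - \sum_(j < J) pot j (x - y)) - 2 * (Om x - \sum_(j < J) pot j x)); last by ring.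
  apply: le_trans (ler_normB _ _) _; rewrite h4.
  apply: le_trans (lerD (ler_normD _ _) (lexx _)) _.
  rewrite [leRHS](_ : _ = (K (x + y) * 3^-1 ^+ J + K (x - y) * 3^-1 ^+ J) +
    2 * (K x * 3^-1 ^+ J)); last by ring.
  by apply: lerD; [exact: lerD h1 h2|exact: ler_wpM2l h3].
exists Om; split.
- move=> x; apply/cvgrPdist_le => e ee.
  pose q := e0 * (3 / 2).
  have q0 : 0 < q by rewrite mulr_gt0//; lra.
  apply/nbhs_ballP; exists (e / q) => /=; first by rewrite divr_gt0.
  move=> y; rewrite /ball/= ltr_pdivlMr// => xy.
  apply: (@le_third _ _ _ (K x + K y) 0%N) => J _.
  have h1 := OmP x J; have h2 := OmP y J.
  have h3 : `|\sum_(j < J) pot j x - \sum_(j < J) pot j y| <= `|x - y| * q.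
    rewrite -sumrB; apply: le_trans (ler_norm_sum _ _ _) _.
    apply: (@le_trans _ _ (\sum_(j < J) (e0 * `|x - y|) * 3^-1 ^+ j)).
      apply: ler_sum => j _; apply: le_trans (potential_lipschitz (mA j) (Acd j) x y) _.
      by rewrite mulrAC ler_wpM2r.
    have := @sum_third_le _ (fun j => (e0 * `|x - y|) * 3^-1 ^+ j) (e0 * `|x - y|) 0 J.
    rewrite big_ord0 subr0 expr0 => H.
    apply: le_trans (ler_norm _) _; apply: le_trans (H _ _) _ => //.
      by move=> j; rewrite ger0_norm// mulr_ge0 ?third_ge0// mulr_ge0// ltW.
    have : 0 <= e0 * `|x - y| * (3 / 2) * 3^-1 ^+ J.
      have h : 0 <= e0 * `|x - y| by rewrite mulr_ge0// ltW.
      by rewrite mulr_ge0 ?third_ge0// mulr_ge0//; lra.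
    rewrite /q; move: (3^-1 ^+ J) `|x - y| => t1 t2; lra.
  rewrite (_ : Om x - Om y = (Om x - \sum_(j < J) pot j x) - (Om y - \sum_(j < J) pot j y) +
    (\sum_(j < J) pot j x - \sum_(j < J) pot j y)); last by ring.
  apply: le_trans (ler_normD _ _) _; rewrite addrC; apply: lerD; first by apply: le_trans h3 (ltW xy).
  by apply: le_trans (ler_normB _ _) _; rewrite mulrDl lerD.
- move=> x cx xd; have := OmP x 0%N; rewrite big_ord0 subr0 expr0 mulr1 => /le_trans; apply.
  have xL : `|x| + `|c| + `|d| <= L.
    have : `|x| <= `|c| + `|d|.
      have := ler_norm d; have := ler_norm (- c); rewrite normrN ler_norml.
      by have := normr_ge0 c; have := normr_ge0 d => *; apply/andP; split; lra.
    by rewrite /L; lra.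
  apply: (@le_trans _ _ (L * e0 * (3 / 2))).
    by apply: ler_wpM2r; [lra|exact: ler_wpM2r (ltW e00) _ _ xL].
  rewrite /e0 (_ : _ * (3 / 2) = 3 / 4 * eta); last by field; lra.
  by lra.
- move=> x y; apply: (@le_third _ _ _ (K (x + y) + K (x - y) + 2 * K x) 0%N) => J _.
  have := sdJ x y J; have : 0 <= \sum_(j < J) second_diff (pot j) x y.
    by apply: sumr_ge0 => j _; exact: potential_second_diff_ge0 (mA j) (Acd j) _ _.
  by rewrite ler_norml => ? /andP[? ?]; lra.
move=> x /ZN Nx cx xd K0.
(* The first n neighbourhoods contain a common ball around x, which yields n y^2 with n above K0. *)
pose n := (Num.truncn K0).+1.
have Kn : K0 <= n%:R by apply/ltW/truncnS_gt.
have : \forall z \near x, forall j : 'I_n, A j z.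
  have : \forall z \near x, (forall j : 'I_n, Q j z) /\ (c <= z <= d).
    near=> z; split; last first.
      by apply/andP; split; apply: ltW; near: z; [exact: lt_nbhsr|exact: lt_nbhsl].
    near: z; apply: filter_forall => j; have [oQ NQ _] := QP j.
    by move: oQ; rewrite openE; apply; exact: NQ.
  apply: filterS => z [Qz cd] j; split; first exact: Qz.
  by rewrite /= in_itv.
move=> /nbhs_ballP[e /= ee eP]; exists e => // y y0 ye.
apply: (@le_third _ _ _ (K (x + y) + K (x - y) + 2 * K x) n) => J nJ.
have := sdJ x y J.
have : n%:R * y ^+ 2 <= \sum_(j < J) second_diff (pot j) x y.
  have -> : n%:R * y ^+ 2 = \sum_(j < n) y ^+ 2.
    by rewrite sumr_const card_ord mulr_natl.
  rewrite -(big_mkord xpredT (fun=> y ^+ 2)) -(big_mkord xpredT (fun j => second_diff (pot j) x y)).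
  rewrite [leRHS](big_cat_nat (n := n))//=.
  rewrite -[leLHS]addr0; apply: lerD; last first.
    by apply: sumr_ge0 => j _; exact: potential_second_diff_ge0 (mA j) (Acd j) _ _.
  apply: ler_sum_nat => j /andP[_ jn].
  apply: (potential_second_diff_ge (mA j) (Acd j) y0) => z; rewrite /= in_itv/= => /andP[z1 z2].
  apply: (eP z _ (Ordinal jn)); rewrite /ball/= ltr_norml.
  by apply/andP; split; lra.
have : K0 * y ^+ 2 <= n%:R * y ^+ 2 by rewrite ler_wpM2r// sqr_ge0.
rewrite ler_norml; move: (K (x + y)) (K (x - y)) (K x) (3^-1 ^+ J) => k1 k2 k3 t.
by move=> ? ? /andP[? ?]; lra.
Unshelve. all: by end_near. Qed.

End ConvexPotential.

Section ConvexityCriterion.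
Context {R : realType}.
Implicit Types (W : R -> R) (E Z : set R) (x y z e : R).
Local Notation mu := (@lebesgue_measure R).

Definition eventually_le W x (k : R -> R) :=
  exists2 e, 0 < e & forall y, 0 < y -> y < e -> second_diff W x y <= k y.

(* Subtracting lines from a nonconvex perturbation of [W] produces interior
   maxima for uncountably many slopes; such a maximum can only lie in [E], and
   a point of [E] cannot serve two slopes. *)
Lemma convexity_criterion W E Z (al be : R) : continuous W -> countable E ->
  mu.-negligible Z ->
  (forall x, al < x -> x < be -> ~ E x -> ~ Z x -> forall e, 0 < e ->
     ~ eventually_le W x (fun y => - e * y ^+ 2)) ->
  (forall x, al < x -> x < be -> ~ E x -> exists C,
     ~ eventually_le W x (fun y => - C * y ^+ 2)) ->
  (forall x, al < x -> x < be -> forall e, 0 < e ->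
     ~ eventually_le W x (fun y => - e * y)) ->
  forall x y z, al < x -> x < y -> y < z -> z < be ->
  W y * (z - x) <= W x * (z - y) + W z * (y - x).
Proof.
move=> cW cE nZ C1 C2 C3 x y z ax xy yz zb; rewrite leNgt; apply/negP => H.
have xz := lt_trans xy yz; have [xyl yzl xzl] := And3 (ltW xy) (ltW yz) (ltW xz).
have zx : 0 < z - x by rewrite subr_gt0.
pose s := (W z - W x) / (z - x).
have sE : s * (z - x) = W z - W x by rewrite divfK ?gt_eqF.
(* The excess of W over the chord at y. Each perturbation below is at most h / 16 on [x, z], so the
   value at y still exceeds those at both ends. *)
pose h := W y - W x - s * (y - x).
have hE : h = W y - W x - s * (y - x) by [].
have h0 : 0 < h.
  rewrite -(pmulr_lgt0 _ zx) /h mulrBl.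
  rewrite (_ : s * (y - x) * (z - x) = (s * (z - x)) * (y - x)); last by ring.
  by rewrite sE; lra.
clearbody s h.
have h16 : 0 < h / 16 by lra.
have stay w e : x < w -> w < z -> 0 < e -> e < w - x -> e < z - w ->
    (forall (P : R -> R) c, (forall w', x <= w' -> w' <= z -> P w' <= c) -> P (w - e) <= c) /\
    (forall (P : R -> R) c, (forall w', x <= w' -> w' <= z -> P w' <= c) -> P (w + e) <= c).
  by clear -R => xw wz e0 ex ez; split=> P c; apply; lra.
have [Om [cOm Om_le Om_ge0 OmZ]] := convex_penalty x z h16 nZ.
(* The parabola makes the second difference of W at a maximum at most - 2 q e^2; a bound by 0 alone
   would not contradict the first hypothesis. *)
pose q := h / 16 / (z - x) ^+ 2.
have q0 : 0 < q by rewrite divr_gt0// exprn_gt0.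
have qle w : x <= w -> w <= z -> 0 <= q * (w - y) ^+ 2 <= h / 16.
  move=> xw wz; rewrite mulr_ge0 ?sqr_ge0 ?(ltW q0)//=.
  rewrite (_ : q * _ = h / 16 * ((w - y) ^+ 2 / (z - x) ^+ 2)); last by rewrite /q; ring.
  rewrite ger_pMr// ler_pdivrMr ?exprn_gt0// mul1r -real_normK ?num_real//.
  have wy : `|w - y| <= z - x by rewrite ler_norml; apply/andP; split; lra.
  by rewrite lerXn2r ?nnegrE// (ltW zx).
pose F w := W w + Om w + q * (w - y) ^+ 2.
pose mbar := h / 16 / (z - x).
have mb0 : 0 < mbar by rewrite divr_gt0.
pose G m w := F w - (s + m) * w.
have cF : continuous F.
  have cs : continuous (fun w : R => w - y).
    by apply: ctsB; [move=> ?; exact: cvg_id|exact: cts_cst].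
  apply: ctsD; first exact: ctsD.
  apply: ctsZ; exact: (ctsM cs cs).
have sdF w e : second_diff F w e = second_diff W w e + second_diff Om w e + 2 * q * e ^+ 2.
  by rewrite /second_diff /F; ring.
have maxG m : `|m| < mbar -> exists w, [/\ x < w, w < z, E w &
    forall w', x <= w' -> w' <= z -> G m w' <= G m w].
  move=> mm; have mz w : x <= w -> w <= z -> `|m * (y - w)| <= h / 16.
    move=> xw wz; rewrite normrM; apply: (@le_trans _ _ (mbar * (z - x))).
      apply: ler_pM => //; first exact: ltW.
      by rewrite ler_norml; apply/andP; split; lra.
    by rewrite /mbar divfK ?gt_eqF.
  have [| |w wxz wmax] := @EVT_max R (G m) x z; first lra.
    apply: continuous_subspaceT; apply: ctsB => //.
    by apply: ctsZ => ?; exact: cvg_id.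
  move: wxz; rewrite in_itv/= => /andP[xw wz].
  have max w' : x <= w' -> w' <= z -> G m w' <= G m w.
    by move=> h1 h2; apply: wmax; rewrite in_itv/= h1.
  have Omx := Om_le x (lexx _) xzl.
  have Omy := Om_le y xyl yzl.
  have Omz := Om_le z xzl (lexx _).
  have yx : G m x < G m y.
    have := mz x (lexx _) xzl; have /andP[_] := qle x (lexx _) xzl.
    move: Omx Omy; rewrite !ler_norml => /andP[? ?] /andP[? ?] ? /andP[? ?].
    by rewrite /G /F subrr expr0n/= mulr0 addr0; lra.
  have yz' : G m z < G m y.
    have := mz z xzl (lexx _); have /andP[_] := qle z xzl (lexx _).
    move: Omz Omy; rewrite !ler_norml => /andP[? ?] /andP[? ?] ? /andP[? ?].
    by rewrite /G /F subrr expr0n/= mulr0 addr0; lra.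
  have Gy := max y (ltW xy) (ltW yz).
  have xw' : x < w by rewrite lt_neqAle xw andbT; apply/eqP => xw'; have := lt_le_trans yx Gy; rewrite -xw' ltxx.
  have wz' : w < z by rewrite lt_neqAle wz andbT; apply/eqP => xz'; have := lt_le_trans yz' Gy; rewrite xz' ltxx.
  exists w; split=> //; apply: contrapT => nE.
  have [aw wb] := (lt_trans ax xw', lt_trans wz' zb).
  pose e1 := Num.min (w - x) (z - w).
  have e10 : 0 < e1 by rewrite lt_min !subr_gt0 xw'.
  have sdG e : 0 < e -> e < e1 -> second_diff W w e + second_diff Om w e + 2 * q * e ^+ 2 <= 0.
    move=> e0; rewrite lt_min => /andP[ex ez].
    have [xe ez'] := stay w e xw' wz' e0 ex ez.
    have := xe (G m) (G m w) max; have := ez' (G m) (G m w) max.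
    by rewrite -sdF /second_diff /G; lra.
  (* On Z the infinite second derivative of Om forces the second difference of W below - C e^2 for
     the C of the second hypothesis; off Z the parabola contradicts the first one. *)
  have [Zw|nZw] := pselect (Z w).
    have [C CP] := C2 w aw wb nE.
    have [e2 e20 e2P] := OmZ w Zw xw' wz' C.
    apply: CP; exists (Num.min e1 e2); first by rewrite lt_min e10.
    move=> e e0; rewrite lt_min => /andP[ee1 ee2].
    have := sdG e e0 ee1; have := e2P e e0 ee2.
    have : 0 <= q * e ^+ 2 by rewrite mulr_ge0 ?sqr_ge0 ?ltW.
    lra.
  apply: (C1 w aw wb nE nZw (2 * q)); first by lra.
  exists e1 => // e e0 ee1; have := sdG e e0 ee1; have := Om_ge0 w e; lra.
have /choice[f fP] : forall m, exists w, `|m| < mbar -> [/\ x < w, w < z, E w &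
    forall w', x <= w' -> w' <= z -> G m w' <= G m w].
  move=> m; have [/maxG[w wP]|] := pselect (`|m| < mbar); first by exists w.
  by exists 0.
(* A common maximum for two slopes is a concave corner of F, hence of W, because the added functions
   are convex. *)
have finj m m' : `|m| < mbar -> `|m'| < mbar -> m < m' -> f m <> f m'.
  move=> mm mm' lt ff; have [xw wz Ew max] := fP m mm; have [_ _ _ max'] := fP m' mm'.
  rewrite -ff in max'; set w := f m in xw wz Ew max max'.
  apply: (C3 w (lt_trans ax xw) (lt_trans wz zb) (m' - m)); first by rewrite subr_gt0.
  exists (Num.min (w - x) (z - w)); first by rewrite lt_min !subr_gt0 xw.
  move=> e e0; rewrite lt_min => /andP[ex ez].
  have [xe ez'] := stay w e xw wz e0 ex ez.
  have h1 := ez' (G m) (G m w) max; have h2 := xe (G m') (G m' w) max'.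
  have h3 := sdF w e; have h4 := Om_ge0 w e.
  have h5 : 0 <= q * e ^+ 2 by rewrite mulr_ge0 ?sqr_ge0 ?ltW.
  move: h1 h2 h3; rewrite /G [second_diff F w e]/second_diff; lra.
have /countable_injP[g gP] := cE.
have cI : countable `]- mbar, mbar[%classic.
  apply/countable_injP; exists (g \o f) => m m'; rewrite !inE/= !in_itv/= -!ltr_norml => mm mm' gg.
  have [_ _ Em _] := fP m mm; have [_ _ Em' _] := fP m' mm'.
  have ff : f m = f m' by apply: gP; rewrite ?inE.
  have [lt|lt|e] := ltgtP m m'; last exact: e.
    by exfalso; exact: finj mm mm' lt ff.
  by exfalso; exact: finj mm' mm lt (esym ff).
have := countable_lebesgue_measure0 cI.
rewrite lebesgue_measure_itv/= lte_fin ifT; last lra.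
by rewrite -EFinB => -[]; lra.
Qed.

End ConvexityCriterion.

(** * Monotonicity *)

Section Kernel.
Context {R : realType}.
Implicit Types (f : R -> R) (x t : R).

Lemma cts_id : continuous (fun x : R => x).
Proof. by move=> x; exact: cvg_id. Qed.

Lemma cint_supp f c d c' d' : continuous f -> c <= c' -> c' <= d' -> d' <= d ->
  (forall x, x <= c' \/ d' <= x -> f x = 0) -> cint f c d = cint f c' d'.
Proof.
move=> cf cc cd dd f0.
rewrite (cint_split f c d c') (cint_split f c' d d').
rewrite (@eq_cint _ f (fun=> 0) c c')//; [|exact: cts_cst|by move=> x _ xc; apply: f0; left].
rewrite (@eq_cint _ f (fun=> 0) d' d)//; [|exact: cts_cst|by move=> x xd _; apply: f0; right].
by rewrite !cint_cst !mul0r add0r addr0.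
Qed.

Lemma cint_swap f c d : cint f c d = - cint f d c.
Proof. by rewrite /cint opprB. Qed.

Lemma Rintegral_cint f c d : continuous f -> c <= d ->
  (forall x, x < c \/ d < x -> f x = 0) ->
  \int[lebesgue_measure]_x f x = cint f c d.
Proof.
move=> cf cd f0; rewrite cint_rint// [RHS]Rintegral_mkcond.
congr Rintegral; apply/funext => x; rewrite patchE; case: ifPn => //.
rewrite notin_setE/= in_itv/= => /negP; rewrite negb_and -!ltNge => /orP xcd.
exact: f0.
Qed.

Lemma cts_slope : continuous (@kernel_slope R).
Proof. exact: has_deriv_continuous kernel_slope_deriv. Qed.

Lemma cts_kernel : continuous (@kernel R).
Proof. exact: has_deriv_continuous kernel_deriv. Qed.

Lemma cts_curv : continuous (@curv R).
Proof. exact: smooth_continuous (@smooth_curv R). Qed.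

Lemma derive1_kernel : derive1 (@kernel R) = kernel_slope.
Proof. exact: has_deriv_derive1 kernel_deriv. Qed.

Lemma test_slope : test_function (@kernel_slope R).
Proof. by rewrite -derive1_kernel; apply: test_derive1; exact: test_kernel. Qed.

(** The points (1 + s) x with s > 0 lie outside the ball and tend to x. *)
Lemma vanish_closed f r : 0 < r -> continuous f ->
  (forall x, r < `|x| -> f x = 0) -> forall x, r <= `|x| -> f x = 0.
Proof.
move=> r0 cf f0 x; rewrite le_eqVlt => /predU1P[rx|/f0//].
apply/eqP/negPn/negP => fx.
have fx0 : 0 < `|f x| by rewrite normr_gt0.
have /cvgrPdist_lt/(_ _ fx0)/nbhs_ballP[e /= e0 eP] := cf x.
pose s := e / (2 * r).
have s0 : 0 < s by rewrite divr_gt0// mulr_gt0.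
have : ball x e ((1 + s) * x).
  rewrite /ball/= (_ : x - _ = - s * x); last by ring.
  rewrite normrM normrN (gtr0_norm s0) -rx /s.
  by rewrite (_ : e / (2 * r) * r = e / 2); [lra|field; rewrite gt_eqF].
move=> /eP /=; rewrite (f0 ((1 + s) * x)) ?subr0 ?ltxx//.
by rewrite normrM (ger0_norm (_ : 0 <= 1 + s)) -?rx; [rewrite ltr_pMl//; lra|lra].
Qed.

Lemma slope_eq0 x : 1 <= `|x| -> kernel_slope x = 0.
Proof.
apply: vanish_closed x => //; first exact: cts_slope.
move=> x x1; rewrite -derive1_kernel -derive1n1; apply: (derive1n_vanish _ _ x1) => y /ltW.
exact: kernel_eq0.
Qed.

Lemma norm_gt1 x : x < -1 \/ 1 < x -> 1 <= `|x|.
Proof. by case=> h; [rewrite ltr0_norm; lra|rewrite ger0_norm; lra]. Qed.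

Lemma kernel_unit x : 1 < `|x| -> kernel x = 0.
Proof. by move=> /ltW; exact: kernel_eq0. Qed.

Lemma Rintegral_kernel : \int[lebesgue_measure]_x kernel x = 1 :> R.
Proof.
rewrite (Rintegral_cint (c := -1) (d := 1) cts_kernel); [exact: cint_kernel|lra|].
by move=> x /norm_gt1; exact: kernel_eq0.
Qed.

Lemma cint_slope : cint (@kernel_slope R) (-1) 1 = 0.
Proof.
rewrite (cint_deriv _ _ cts_slope kernel_deriv) !kernel_eq0 ?subrr//.
  by rewrite normrN normr1.
by rewrite normr1.
Qed.

Lemma Rintegral_slope : \int[lebesgue_measure]_x kernel_slope x = 0 :> R.
Proof.
rewrite (Rintegral_cint (c := -1) (d := 1) cts_slope); [exact: cint_slope|lra|].
by move=> x /norm_gt1; exact: slope_eq0.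
Qed.

Lemma cint_id_slope : cint (fun x => x * @kernel_slope R x) (-1) 1 = -1.
Proof.
rewrite (cint_parts _ _ has_deriv_id kernel_deriv); [|exact: cts_cst|exact: cts_slope].
rewrite !kernel_eq0 ?normrN ?normr1// !mulr0 subrr sub0r.
by under [X in cint X]eq_fun do rewrite mul1r; rewrite cint_kernel.
Qed.

(** Unimodality of [kernel]: the signs of f and of the slope are opposite on either side of 0. *)
Lemma cint_slope_le0 f : continuous f -> f 0 = 0 ->
  (forall y, -1 <= y -> y <= 1 -> 0 <= f y * y) ->
  cint (fun y => f y * kernel_slope y) (-1) 1 <= 0.
Proof.
move=> cf f0 H; rewrite -[leLHS]opprK oppr_le0 -[leRHS]mulN1r -cintZ; last exact: ctsM cf cts_slope.
apply: cint_ge0; [by apply: ctsZ; exact: ctsM cf cts_slope|lra|].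
move=> y y1 y2; rewrite mulN1r oppr_ge0.
have := H y y1 y2; have := @kernel_slope_le0 R y.
have [y0|y0|->] := ltgtP y 0; last by rewrite f0 mul0r.
- by move=> h1 h2; rewrite nmulr_rle0 // in h1; rewrite nmulr_lge0 // in h2; rewrite mulr_le0_ge0.
- by move=> h1 h2; rewrite pmulr_rle0 // in h1; rewrite pmulr_lge0 // in h2; rewrite mulr_ge0_le0.
Qed.

End Kernel.

(** * Averages expressed through the antiderivative W *)

Section Local.
Context {R : realType}.
Variables (U : schwartz_dist R) (W : R -> R) (al be : R).
Hypothesis albe : al < be.
Hypothesis cW : continuous W.
Hypothesis UW : forall psi c, test_function psi -> al < c ->
    (forall x, x <= c \/ be <= x -> psi x = 0) ->
    U psi = - cint (fun z => W z * derive1 psi z) al be.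

Implicit Types (x y z t m : R).

Lemma dist_rescale_cint theta x t : test_function theta ->
  (forall y, 1 < `|y| -> theta y = 0) -> 0 < t -> al < x - t -> x + t < be ->
  U (rescale x t theta) = - cint (fun y => W (t * y + x) * derive1 theta y) (-1) 1.
Proof.
move=> tth th1 t0 ax xb; have tN0 : t != 0 by rewrite gt_eqF.
have th0 y : y <= x - t \/ x + t <= y -> 1 <= `|(y - x) / t|.
  rewrite normrM normfV (gtr0_norm t0) ler_pdivlMr// mul1r; case=> h.
    by rewrite ltr0_norm; lra.
  by rewrite ger0_norm; lra.
have sth := test_smooth tth.
have cd : continuous (derive1 theta) := smooth_continuous (smooth_derive1 sth).
have th1' := vanish_closed ltr01 (smooth_continuous sth) th1.
have d0 : forall y, 1 <= `|y| -> derive1 theta y = 0.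
  apply: vanish_closed => // y y1.
  by rewrite -derive1n1; exact: derive1n_vanish th1 y1.
have supp y : y <= x - t \/ be <= y -> rescale x t theta y = 0.
  move=> h; rewrite /rescale; apply: th1'; apply: th0.
  by case: h => h; [left|right; lra].
have tr := test_rescale x tN0 tth.
have E := UW tr ax supp.
rewrite E.
have oi (p q : R) : p = q -> - p = - q by move=> ->.
apply: oi.
rewrite (has_deriv_derive1 (rescale_deriv x t (smooth_deriv sth))).
have cf : continuous (fun z => W z * (t^-1 * rescale x t (derive1 theta) z)).
  apply: (ctsM cW); apply: ctsZ.
  exact: smooth_continuous (smooth_rescale (smooth_derive1 sth)).
rewrite (cint_supp (c' := x - t) (d' := x + t) cf); [|lra|lra|lra|]; last first.
  by move=> y h; rewrite /rescale d0 ?mulr0 ?mulr0//; exact: th0.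
have := cint_affine t x (- 1) 1 cf; rewrite mulrN !mulr1.
rewrite (_ : - t + x = x - t) 1?(_ : t + x = x + t); [|exact: addrC|exact: addrC].
move=> ->; have cg : continuous (fun y => W (t * y + x) * (t^-1 * rescale x t (derive1 theta) (t * y + x))).
  exact: cts_affine cf.
rewrite -(cintZ _ _ _ cg); congr (cint _ _ _); apply/funext => y.
rewrite /rescale addrK (mulrC t y) mulfK//.
by field.
Qed.

Definition average (x t : R) := t^-1 * U (rescale x t kernel).

Lemma averageE x t : 0 < t -> al < x - t -> x + t < be ->
  average x t = - t^-1 * cint (fun y => W (t * y + x) * kernel_slope y) (-1) 1.
Proof.
move=> t0 ax xb; rewrite /average (dist_rescale_cint test_kernel)//.
  by rewrite derive1_kernel mulrN mulNr.
exact: kernel_unit.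
Qed.

Let cts_Waff x t : continuous (fun y => W (t * y + x)).
Proof. exact: cts_affine. Qed.

(** [kernel_slope] has integral 0 and first moment -1, so subtracting an affine function from W
    subtracts its slope from the average. This is how averages are compared with slopes of
    chords. *)
Lemma average_shift x t m k : 0 < t -> al < x - t -> x + t < be ->
  average x t - m =
  - t^-1 * cint (fun y => (W (t * y + x) - k - m * t * y) * kernel_slope y) (-1) 1.
Proof.
move=> t0 ax xb; rewrite averageE//.
have c1 : continuous (fun y => W (t * y + x) * kernel_slope y).
  exact: (ctsM (@cts_Waff x t) (@cts_slope R)).
have c2 : continuous (fun y => k * kernel_slope y) by exact: (ctsZ (@cts_slope R)).
have c3 : continuous (fun y => m * t * (y * kernel_slope y)).
  exact: (ctsZ (ctsM (@cts_id R) (@cts_slope R))).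
have -> : (fun y => (W (t * y + x) - k - m * t * y) * kernel_slope y) =
    fun y => (W (t * y + x) * kernel_slope y - k * kernel_slope y) - m * t * (y * kernel_slope y).
  by apply/funext => y; ring.
rewrite (cintB _ _ (ctsB c1 c2) c3) (cintB _ _ c1 c2).
rewrite (@cintZ _ _ k _ _ (@cts_slope R)) (@cintZ _ _ (m * t) _ _ (ctsM (@cts_id R) (@cts_slope R))).
by rewrite cint_slope cint_id_slope; field; rewrite gt_eqF.
Qed.

Let cts_shift x t m : continuous (fun y => W (t * y + x) - W x - m * t * y).
Proof.
apply: ctsB; first by apply: ctsB; [exact: cts_Waff|exact: cts_cst].
exact: (ctsZ (@cts_id R)).
Qed.

Lemma average_ge x t m : 0 < t -> al < x - t -> x + t < be ->
  (forall y, -1 <= y -> y <= 1 -> 0 <= (W (t * y + x) - W x - m * t * y) * y) ->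
  m <= average x t.
Proof.
move=> t0 ax xb H; rewrite -subr_ge0 (average_shift m (W x))// mulNr -mulrN.
rewrite mulr_ge0 ?invr_ge0 ?(ltW t0)// oppr_ge0; apply: cint_slope_le0 => //.
by rewrite !mulr0 add0r subrr subr0.
Qed.

Lemma average_le x t m : 0 < t -> al < x - t -> x + t < be ->
  (forall y, -1 <= y -> y <= 1 -> (W (t * y + x) - W x - m * t * y) * y <= 0) ->
  average x t <= m.
Proof.
move=> t0 ax xb H; rewrite -subr_le0 (average_shift m (W x))// mulNr -mulrN.
rewrite mulr_ge0_le0 ?invr_ge0 ?(ltW t0)// -[leLHS]mulN1r -cintZ; last first.
  exact: ctsM (@cts_shift x t m) (@cts_slope R).
have -> : (fun y => -1 * ((W (t * y + x) - W x - m * t * y) * kernel_slope y)) =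
    (fun y => (-1 * (W (t * y + x) - W x - m * t * y)) * kernel_slope y).
  by apply/funext => y; rewrite mulrA.
apply: cint_slope_le0.
- by apply: ctsZ; exact: cts_shift.
- by rewrite !mulr0 add0r subrr subr0 mulr0.
- by move=> y y1 y2; rewrite mulN1r mulNr oppr_ge0; exact: H.
Qed.

Definition chord_convex := forall x y z, al < x -> x < y -> y < z -> z < be ->
  W y * (z - x) <= W x * (z - y) + W z * (y - x).

Lemma convex_translate p q d : chord_convex -> al < p -> p <= q -> 0 <= d ->
  q + d < be -> W (p + d) - W p <= W (q + d) - W q.
Proof.
move=> cvW ap; rewrite le_eqVlt => /predU1P[->//|pq].
rewrite le_eqVlt => /predU1P[<-|d0 qd]; first by rewrite !addr0 !subrr.
have h1 := cvW p (p + d) (q + d) ap ltac:(lra) ltac:(lra) qd.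
have h2 := cvW p q (q + d) ap ltac:(lra) ltac:(lra) qd.
have e : (W (p + d) + W q) * (q + d - p) <= (W p + W (q + d)) * (q + d - p) by lra.
by rewrite ler_pM2r in e; lra.
Qed.

(** For convex W the increment from x + y to x' + y is nondecreasing in y, and such a function has a
    nonpositive pairing with the slope of the kernel. *)
Lemma average_mono x x' t : chord_convex -> 0 < t -> al < x - t -> x <= x' ->
  x' + t < be -> average x t <= average x' t.
Proof.
move=> cvW t0 ax xx xb; rewrite !averageE//; [|lra|lra].
rewrite !mulNr lerN2 ler_pM2l ?invr_gt0// -subr_le0.
have cm y : continuous (fun z => W (t * z + y) * kernel_slope z).
  exact: ctsM (@cts_Waff y t) (@cts_slope R).
rewrite -(cintB _ _ (cm x') (cm x)).
pose f z := (W (t * z + x') - W (t * z + x)) - (W x' - W x).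
have cf : continuous f.
  by apply: ctsB; [apply: ctsB; exact: cts_Waff|exact: cts_cst].
have := @cint_slope_le0 R f cf.
have -> : cint (fun y => f y * kernel_slope y) (-1) 1 =
    cint (fun y => W (t * y + x') * kernel_slope y - W (t * y + x) * kernel_slope y) (-1) 1.
  transitivity (cint (fun y => (W (t * y + x') * kernel_slope y - W (t * y + x) * kernel_slope y)
      - (W x' - W x) * kernel_slope y) (-1) 1).
    by congr (cint _ _ _); apply/funext => y; rewrite /f; ring.
  rewrite (cintB _ _ (ctsB (cm x') (cm x)) (ctsZ (@cts_slope R))).
  by rewrite (cintZ _ _ _ (@cts_slope R)) cint_slope mulr0 subr0.
apply; first by rewrite /f mulr0 !add0r subrr.
move=> y y1 y2; rewrite /f; have ty : - t <= t * y <= t.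
  by rewrite -[X in - X]mulr1 -mulrN ler_pM2l// y1 -[X in _ <= X]mulr1 ler_pM2l.
have /andP[ty1 ty2] := ty.
have [y0|y0|->] := ltgtP y 0; last by rewrite mulr0.
- have t' : t * y < 0 by rewrite pmulr_rlt0.
  rewrite mulr_le0 ?(ltW y0)//.
  have := @convex_translate (t * y + x) x (x' - x) cvW ltac:(lra) ltac:(lra) ltac:(lra) ltac:(lra).
  by rewrite -addrA [x + _]addrC subrK; lra.
- have t' : 0 < t * y by rewrite mulr_gt0.
  rewrite mulr_ge0 ?(ltW y0)//.
  have := @convex_translate x (t * y + x) (x' - x) cvW ltac:(lra) ltac:(lra) ltac:(lra) ltac:(lra).
  by rewrite -addrA [x + _]addrC subrK; lra.
Qed.

Section SecondDifferences.
Variable u : schwartz_dist R.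
Hypothesis Uu : is_derivative U u.

(** [curv] lives on [1/2, 1] here, so this averages second differences of W with steps between t/2
    and t. It is the quantity that telescopes. *)
Definition curv_diff x t := cint (fun y => second_diff W x (t * y) * curv y) 0 1.

Let cts_sd x t : continuous (fun y => second_diff W x (t * y)).
Proof.
have -> : (fun y => second_diff W x (t * y)) =
    fun y => W (t * y + x) + W (- t * y + x) - 2 * W x.
  by apply/funext => y; rewrite /second_diff mulNr addrC [x - _]addrC [x + _]addrC addrC; ring.
apply: ctsB; last exact: cts_cst.
by apply: ctsD; exact: cts_affine.
Qed.

Let cint_curv x t : cint (fun y => W (t * y + x) * curv y) (-1) 1 =
  curv_diff x t + 2 * W x * curv_mass.
Proof.
have cc := @cts_curv R.
have cf s : continuous (fun y => W (s * y + x) * curv y) by apply: ctsM.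
rewrite (cint_split _ (-1) 1 0).
have -> : cint (fun y => W (t * y + x) * curv y) (-1) 0 =
    cint (fun y => W (- t * y + x) * curv y) 0 1.
  have := cint_affine (-1) 0 0 1 (cf t); rewrite mulr0 !addr0 mulr1.
  have -> : (fun y => W (t * (-1 * y + 0) + x) * curv (-1 * y + 0)) =
      fun y => W (- t * y + x) * curv y.
    by apply/funext => y; rewrite addr0 mulN1r curv_even mulrN mulNr.
  by rewrite cint_swap mulN1r => /oppr_inj.
rewrite -(cintD _ _ (cf (- t)) (cf t)).
rewrite /curv_diff -(cintZ _ _ _ cc) -cintD; last 2 first.
- exact: ctsM (@cts_sd x t) cc.
- exact: ctsZ cc.
suff -> : (fun y => W (- t * y + x) * curv y + W (t * y + x) * curv y) =
    fun y => second_diff W x (t * y) * curv y + 2 * W x * curv y by [].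
apply/funext => y; rewrite /second_diff mulNr.
by rewrite [x + t * y]addrC [x - _]addrC; ring.
Qed.

(** Both derivatives are moved to the kernel, whose second derivative curv(y) - 2 curv(2 y) gives
    the same expression at scales t and t/2; the terms in W x cancel. *)
Lemma curv_diff_halve x t : 0 < t -> al < x - t -> x + t < be ->
  curv_diff x t - curv_diff x (t / 2) = t * u (rescale x t kernel).
Proof.
move=> t0 ax xb; have tN0 : t != 0 by rewrite gt_eqF.
rewrite (Uu (test_rescale x tN0 test_kernel)).
rewrite (has_deriv_derive1 (rescale_deriv x t kernel_deriv)).
rewrite (distZ _ _ (test_rescale x tN0 test_slope)).
rewrite mulrN mulrA mulfV// mul1r (dist_rescale_cint test_slope)//; last first.
  by move=> y /ltW; exact: slope_eq0.
rewrite opprK (has_deriv_derive1 kernel_slope_deriv).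
have cc := @cts_curv R.
have cf s : continuous (fun y => W (s * y + x) * curv y) by apply: ctsM.
have c2 : continuous (fun y => 2 * (W (t * y + x) * curv (2 * y))).
  apply: ctsZ; apply: ctsM => //.
  by have := @cts_affine R curv 2 0 cc; under eq_fun do rewrite addr0.
have -> : (fun y => W (t * y + x) * (curv y - 2 * curv (2 * y))) =
    fun y => W (t * y + x) * curv y - 2 * (W (t * y + x) * curv (2 * y)).
  by apply/funext => y; ring.
rewrite (cintB _ _ (cf t) c2) cint_curv.
suff -> : cint (fun y => 2 * (W (t * y + x) * curv (2 * y))) (-1) 1 =
    curv_diff x (t / 2) + 2 * W x * curv_mass by ring.
rewrite -cint_curv.
rewrite -(@cint_supp R _ (-2) 2 (-1) 1 (cf (t / 2))); [|lra|lra|lra|]; last first.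
  move=> y h; rewrite curv_eq0 ?mulr0//; right.
  by case: h => h; [rewrite ler0_norm; lra|rewrite ger0_norm; lra].
have := cint_affine 2 0 (-1) 1 (cf (t / 2)).
rewrite !addr0 mulr1 mulrN1 => ->; rewrite cintZ; last first.
  apply: ctsM => //.
  by have := @cts_affine R curv 2 0 cc; under eq_fun do rewrite addr0.
suff -> : (fun y => W (t / 2 * (2 * y + 0) + x) * curv (2 * y + 0)) =
    fun y => W (t * y + x) * curv (2 * y) by [].
apply/funext => y; rewrite addr0.
by rewrite (_ : t / 2 * (2 * y) = t * y)//; field.
Qed.

Lemma curv_diff_le x t k : 0 < t -> (forall y, 1 / 2 < y -> y < 1 ->
    second_diff W x (t * y) <= k) -> curv_diff x t <= k * curv_mass.
Proof.
move=> t0 H; rewrite /curv_mass -(cintZ _ _ _ (@cts_curv R)).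
apply: cint_le; [exact: ctsM (@cts_sd x t) (@cts_curv R)|exact: ctsZ (@cts_curv R)|lra|].
move=> y y0 y1; have [y2|y2] := leP y (1 / 2).
  by rewrite curv_eq0 ?mulr0//; left; rewrite ger0_norm.
have [y3|y3] := leP 1 y.
  by rewrite curv_eq0 ?mulr0//; right; rewrite ger0_norm.
by rewrite ler_wpM2r ?curv_ge0// H.
Qed.

Lemma curv_diff_cvg0 x e : 0 < e -> exists2 d, 0 < d &
  forall t, 0 < t -> t < d -> `|curv_diff x t| <= e.
Proof.
move=> e0; have cm := @curv_mass_gt0 R.
pose e1 := e / curv_mass / 2.
have e10 : 0 < e1 by rewrite !divr_gt0.
have /cvgrPdist_lt/(_ _ e10)/nbhs_ballP[d /= d0 dP] := @cW x.
exists d => // t t0 td.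
have sdle y : 0 <= y -> y <= 1 -> `|second_diff W x (t * y)| <= e1 * 2.
  move=> y0 y1; have ty : t * y < d by apply: le_lt_trans td; rewrite ler_piMr// ltW.
  have ty0 : 0 <= t * y by rewrite mulr_ge0// ltW.
  have /dP h1 : ball x d (x + t * y).
    by rewrite /ball/= opprD addNKr normrN ger0_norm.
  have /dP h2 : ball x d (x - t * y).
    by rewrite /ball/= opprB addrC subrK ger0_norm.
  rewrite /second_diff (_ : _ - _ = (W (x + t * y) - W x) + (W (x - t * y) - W x)); last by ring.
  apply: le_trans (ler_normD _ _) _; rewrite distrC [X in _ + X]distrC.
  by move: h1 h2 => /=; lra.
have cc := @cts_curv R.
have eE : e = e1 * 2 * curv_mass by rewrite /e1 !divfK// gt_eqF.
rewrite ler_norml; apply/andP; split.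
  rewrite eE -mulNr /curv_mass -(cintZ _ _ _ cc).
  apply: cint_le; [exact: ctsZ cc|exact: ctsM (@cts_sd x t) cc|lra|].
  move=> y y0 y1; rewrite ler_wpM2r ?curv_ge0//.
  have := sdle y y0 y1; by rewrite ler_norml => /andP[].
rewrite eE /curv_mass -(cintZ _ _ _ cc).
apply: cint_le; [exact: ctsM (@cts_sd x t) cc|exact: ctsZ cc|lra|].
move=> y y0 y1; rewrite ler_wpM2r ?curv_ge0//.
have := sdle y y0 y1; by rewrite ler_norml => /andP[].
Qed.

End SecondDifferences.

End Local.

(** * Telescoping and local convexity *)

Section LocalConvexity.
Context {R : realType}.
Implicit Types (U u : schwartz_dist R) (W : R -> R) (E Z : set R) (x t : R).

(** Along t / 2^J the values do not increase, and they end above any given - e. *)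
Lemma halving_ge0 (h : R -> R) d :
  (forall t, 0 < t -> t < d -> h (t / 2) <= h t) ->
  (forall e, 0 < e -> exists2 d', 0 < d' & forall t, 0 < t -> t < d' -> - e <= h t) ->
  forall t, 0 < t -> t < d -> 0 <= h t.
Proof.
move=> hh h0 t t0 td; apply/ler_addgt0Pr => e e0.
have [d' d'0 d'P] := h0 e e0.
have hJ J : h (t / 2 ^+ J) <= h t.
  elim: J => [|J IHJ]; first by rewrite expr0 divr1.
  apply: le_trans IHJ; rewrite exprSr invfM mulrA; apply: hh.
    by rewrite divr_gt0// exprn_gt0.
  by apply: le_lt_trans td; rewrite ler_pdivrMr ?exprn_gt0// ler_peMr ?(ltW t0)// exprn_ege1// ler1n.
pose J := (Num.truncn (t / d')).+1.
have : t / 2 ^+ J < d'.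
  rewrite ltr_pdivrMr ?exprn_gt0// mulrC -ltr_pdivrMr//.
  apply: lt_trans (truncnS_gt _) _; rewrite -natrX ltr_nat.
  by rewrite -/J; exact: ltn_expl.
move=> /(d'P _ (divr_gt0 t0 (exprn_gt0 J (ltr0n R 2)))) h1.
by have := hJ J; lra.
Qed.

Section AtPoint.
Variables (U u : schwartz_dist R) (W : R -> R) (al be x : R).
Hypothesis cW : continuous W.
Hypothesis UW : forall psi c, test_function psi -> al < c ->
    (forall x, x <= c \/ be <= x -> psi x = 0) ->
    U psi = - cint (fun z => W z * derive1 psi z) al be.
Hypothesis Uu : is_derivative U u.
Hypothesis ax : al < x.
Hypothesis xb : x < be.

Let dx := Num.min (x - al) (be - x).

Let dx0 : 0 < dx.
Proof. by rewrite lt_min !subr_gt0 ax. Qed.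

Let halve t : 0 < t -> t < dx ->
  curv_diff W x t - curv_diff W x (t / 2) = t * u (rescale x t kernel).
Proof.
move=> t0; rewrite lt_min => /andP[t1 t2].
by apply: (curv_diff_halve cW UW Uu t0); lra.
Qed.

Let small (f : R -> R) e : 0 < e -> (forall t, 0 < t -> 0 <= f t) ->
  exists2 d', 0 < d' & forall t, 0 < t -> t < d' -> - e <= curv_diff W x t + f t.
Proof.
move=> e0 f0; have [d d0 dP] := curv_diff_cvg0 cW x e0.
exists d => // t t0 td; have := dP t t0 td; have := f0 t t0.
by rewrite ler_norml => ? /andP[? _]; lra.
Qed.

(** Halving t changes [curv_diff] by at least - A t^2, while 2 A t^2 contributes (3/2) A t^2; the
    sum of both is thus monotone under halving and tends to 0. *)
Lemma curv_diff_ge2 A d : 0 <= A -> 0 < d ->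
  (forall t, 0 < t -> t < d -> - A <= t^-1 * u (rescale x t kernel)) ->
  exists2 d', 0 < d' & forall t, 0 < t -> t < d' -> - (2 * A) * t ^+ 2 <= curv_diff W x t.
Proof.
move=> A0 d0 H; exists (Num.min d dx); first by rewrite lt_min d0.
move=> t t0 td; rewrite mulNr -subr_ge0 opprK.
apply: (halving_ge0 (h := fun t => curv_diff W x t + 2 * A * t ^+ 2) _ _ t0 td).
- move=> {td}t' {}t0; rewrite lt_min => /andP[td tx].
  have h1 := halve t0 tx; have h2 := H t' t0 td.
  have h3 : - A * t' ^+ 2 <= t' * u (rescale x t' kernel).
    have -> : t' * u (rescale x t' kernel) = t'^-1 * u (rescale x t' kernel) * t' ^+ 2.
      by field; rewrite gt_eqF.
    by rewrite ler_wpM2r// sqr_ge0.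
  have h4 : (t' / 2) ^+ 2 = t' ^+ 2 / 4 by field.
  have h5 : 0 <= A * t' ^+ 2 by rewrite mulr_ge0 ?sqr_ge0.
  by rewrite h4; lra.
- move=> e e0; apply: small => // t' _.
  by rewrite mulr_ge0 ?sqr_ge0// mulr_ge0.
Qed.

(** The linear analogue, for bounds without the factor t^-1: the change - A t is exactly compensated
    by 2 A t - 2 A (t/2). *)
Lemma curv_diff_ge1 A d : 0 <= A -> 0 < d ->
  (forall t, 0 < t -> t < d -> - A <= u (rescale x t kernel)) ->
  exists2 d', 0 < d' & forall t, 0 < t -> t < d' -> - (2 * A) * t <= curv_diff W x t.
Proof.
move=> A0 d0 H; exists (Num.min d dx); first by rewrite lt_min d0.
move=> t t0 td; rewrite mulNr -subr_ge0 opprK.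
apply: (halving_ge0 (h := fun t => curv_diff W x t + 2 * A * t) _ _ t0 td).
- move=> {td}t' {}t0; rewrite lt_min => /andP[td tx].
  have h1 := halve t0 tx.
  have h3 : t' * - A <= t' * u (rescale x t' kernel) by rewrite ler_pM2l// H.
  lra.
- by move=> e e0; apply: small => // t' /ltW t'0; rewrite !mulr_ge0.
Qed.

(** Weighted by [curv], only 1/2 < y < 1 matters, where a negative multiple of k(t y) is at most a
    quarter of that of k(t) for the powers k in use. The resulting upper bound on [curv_diff] falls
    below the lower one. *)
Lemma not_eventually_le A (k : R -> R) : (exists2 d', 0 < d' & forall t,
    0 < t -> t < d' -> A * k t <= curv_diff W x t) ->
  forall B, (forall t y, 0 < t -> 1 / 2 < y -> y < 1 -> B * k (t * y) <= B * k t / 4) ->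
  (forall t, 0 < t -> 0 < k t) ->
  B / 4 * curv_mass < A -> ~ eventually_le W x (fun y => B * k y).
Proof.
move=> [d' d'0 d'P] B Bk k0 BA [e e0 eP].
pose t := Num.min d' e / 2.
have t0 : 0 < t by rewrite divr_gt0// lt_min d'0.
have [td te] : t < d' /\ t < e.
  have m0 : 0 < Num.min d' e by rewrite lt_min d'0.
  have [m1 m2] : Num.min d' e <= d' /\ Num.min d' e <= e by rewrite !ge_min !lexx orbT.
  by rewrite /t; split; lra.
have h1 := d'P t t0 td.
have h2 : curv_diff W x t <= B * k t / 4 * curv_mass.
  apply: (curv_diff_le cW t0) => y y1 y2.
  apply: le_trans (Bk t y t0 y1 y2); apply: eP.
    by rewrite mulr_gt0//; lra.
  by apply: lt_trans te; rewrite gtr_pMr.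
have := k0 t t0; have := @curv_mass_gt0 R => m0 kt.
have : (A - B / 4 * curv_mass) * k t <= 0 by lra.
by rewrite pmulr_lle0//; lra.
Qed.

End AtPoint.

Lemma quarter_le (y : R) : 1 / 2 < y -> 1 / 4 <= y ^+ 2.
Proof.
move=> y1; have : 0 <= (y - 1 / 2) * (y + 1 / 2) by apply: mulr_ge0; lra.
by rewrite expr2; lra.
Qed.

(** What a major pair minus a minor pair satisfies, tested on [kernel] alone. *)
Definition average_nonneg_ae u E Z :=
  (forall x, ~ E x -> ~ Z x -> forall e, 0 < e -> exists2 d, 0 < d &
     forall t, 0 < t -> t < d -> - e <= t^-1 * u (rescale x t kernel)) /\
  (forall x, ~ E x -> exists C d, 0 < d /\
     forall t, 0 < t -> t < d -> - C <= t^-1 * u (rescale x t kernel)).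

(** The third condition of the criterion comes from the point values of U: as [kernel_slope] has
    integral 0, u(rescale x t kernel) tends to 0 at every x, exceptional or not. *)
Lemma local_convexity U u W (al be : R) E Z : continuous W ->
  (forall psi c, test_function psi -> al < c ->
    (forall x, x <= c \/ be <= x -> psi x = 0) ->
    U psi = - cint (fun z => W z * derive1 psi z) al be) ->
  is_derivative U u -> lojasiewicz U -> countable E ->
  lebesgue_measure.-negligible Z -> average_nonneg_ae u E Z ->
  chord_convex W al be.
Proof.
move=> cW UW Uu Ul cE nZ [H1 H2].
have m0 := @curv_mass_gt0 R.
apply: (convexity_criterion cW cE nZ).
- move=> x ax xb nE nZx e e0.
  (* With A = e curv_mass / 16 the lower bound - 2 A t^2 is - (e curv_mass / 8) t^2, strictly above
     the upper bound - (e curv_mass / 4) t^2. *)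
  have e'0 : 0 < e * curv_mass / 16 by rewrite divr_gt0// mulr_gt0.
  have [d d0 dP] := H1 x nE nZx _ e'0.
  apply: (not_eventually_le cW (curv_diff_ge2 cW UW Uu ax xb (ltW e'0) d0 dP)).
  + move=> t y t0 y1 y2; rewrite !mulNr lerN2 exprMn.
    have : 1 / 4 <= y ^+ 2 by have := quarter_le y1; lra.
    have : 0 < e * t ^+ 2 by rewrite mulr_gt0// exprn_gt0.
    move=> et y4; have : e * t ^+ 2 * (1 / 4) <= e * t ^+ 2 * y ^+ 2 by rewrite ler_pM2l.
    lra.
  + by move=> t t0; rewrite exprn_gt0.
  + by have em := mulr_gt0 e0 m0; lra.
- move=> x ax xb nE; have [C [d [d0 dP]]] := H2 x nE.
  have C0 : 0 <= `|C| by [].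
  have CP t : 0 < t -> t < d -> - `|C| <= t^-1 * u (rescale x t kernel).
    by move=> t0 td; apply: le_trans (dP t t0 td); rewrite lerN2 ler_norm.
  exists (16 * (`|C| + 1) / curv_mass).
  have D0 : 0 < 16 * (`|C| + 1) / curv_mass by rewrite divr_gt0// mulr_gt0//; lra.
  apply: (not_eventually_le cW (curv_diff_ge2 cW UW Uu ax xb C0 d0 CP)).
  + move=> t y t0 y1 y2; rewrite !mulNr lerN2 exprMn.
    have : 1 / 4 <= y ^+ 2 by have := quarter_le y1; lra.
    move: D0; set D := 16 * _ / _ => D0.
    have : 0 < D * t ^+ 2 by rewrite mulr_gt0// exprn_gt0.
    move=> et y4; have : D * t ^+ 2 * (1 / 4) <= D * t ^+ 2 * y ^+ 2 by rewrite ler_pM2l.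
    lra.
  + by move=> t t0; rewrite exprn_gt0.
  + have -> : - (16 * (`|C| + 1) / curv_mass) / 4 * curv_mass = - 4 * (`|C| + 1).
      by field; rewrite gt_eqF.
    by lra.
- move=> x ax xb e e0.
  have e'0 : 0 < e * curv_mass / 16 by rewrite divr_gt0// mulr_gt0.
  have [c Uc] := Ul x.
  have /cvgrPdist_lt/(_ _ e'0) := Uc _ (@test_slope R).
  rewrite Rintegral_slope mulr0 /dnbhs/= => /nbhs_ballP[d /= d0 dP].
  have uP t : 0 < t -> t < d -> - (e * curv_mass / 16) <= u (rescale x t kernel).
    move=> t0 td; have tN0 : t != 0 by rewrite gt_eqF.
    rewrite (Uu _ (test_rescale x tN0 test_kernel)).
    rewrite (has_deriv_derive1 (rescale_deriv x t kernel_deriv)).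
    rewrite (distZ _ _ (test_rescale x tN0 test_slope)).
    have := dP t; rewrite /ball/= sub0r normrN gtr0_norm// => /(_ td tN0).
    by rewrite sub0r normrN ltr_norml => /andP[_ /ltW]; rewrite lerN2.
  apply: (not_eventually_le cW (curv_diff_ge1 cW UW Uu ax xb (ltW e'0) d0 uP)).
  + move=> t y t0 y1 y2; rewrite !mulNr lerN2.
    have : 0 < e * t by rewrite mulr_gt0.
    move=> et; have : e * t * (1 / 4) <= e * t * y by rewrite ler_pM2l//; lra.
    lra.
  + by [].
  + by have em := mulr_gt0 e0 m0; lra.
Qed.

End LocalConvexity.

(** * From local to global by Baire's theorem *)

Section Monotone.
Context {R : realType}.

Lemma chord_slope (W : R -> R) al be p q v w : chord_convex W al be ->
  al < p -> p < q -> q <= v -> v < w -> w < be ->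
  (W q - W p) * (w - v) <= (W w - W v) * (q - p).
Proof.
move=> cvW ap pq; rewrite le_eqVlt => /predU1P[<-|qv] vw wb.
  by have := cvW p q w ap pq vw wb; lra.
have h1 := cvW p q v ap pq qv ltac:(lra).
have h2 := cvW q v w ltac:(lra) qv vw wb.
have e1 : (W q - W p) * (v - q) <= (W v - W q) * (q - p) by lra.
have e2 : (W v - W q) * (w - v) <= (W w - W v) * (v - q) by lra.
have vq0 : 0 < v - q by lra.
rewrite -(ler_pM2r vq0).
have := ler_wpM2r (_ : 0 <= w - v) e1; have := ler_wpM2r (_ : 0 <= q - p) e2.
move=> /(_ ltac:(lra)) f2 /(_ ltac:(lra)) f1; lra.
Qed.

Section Slopes.
Variables (U : schwartz_dist R) (W : R -> R) (al be : R).
Hypothesis cW : continuous W.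
Hypothesis UW : forall psi c, test_function psi -> al < c ->
    (forall x, x <= c \/ be <= x -> psi x = 0) ->
    U psi = - cint (fun z => W z * derive1 psi z) al be.

Lemma average_ge_slope x t m : 0 < t -> al < x - t -> x + t < be ->
  (forall v, x - t <= v -> v < x -> m * (x - v) <= W x - W v) ->
  (forall v, x < v -> v <= x + t -> m * (v - x) <= W v - W x) ->
  m <= average U x t.
Proof.
move=> t0 ax xb H1 H2; apply: (average_ge cW UW t0 ax xb) => y y1 y2.
have b1 := ler_wpM2l (ltW t0) y1; have b2 := ler_wpM2l (ltW t0) y2.
rewrite mulr1 in b2; rewrite mulrN1 in b1.
have [y0|y0|->] := ltgtP y 0; last by rewrite mulr0.
- have ty : t * y < 0 by rewrite pmulr_rlt0.
  rewrite mulr_le0// ?(ltW y0)//.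
  by have := H1 (t * y + x) ltac:(lra) ltac:(lra); lra.
- have ty : 0 < t * y by rewrite mulr_gt0.
  rewrite mulr_ge0// ?(ltW y0)//.
  by have := H2 (t * y + x) ltac:(lra) ltac:(lra); lra.
Qed.

Lemma average_le_slope x t m : 0 < t -> al < x - t -> x + t < be ->
  (forall v, x - t <= v -> v < x -> W x - W v <= m * (x - v)) ->
  (forall v, x < v -> v <= x + t -> W v - W x <= m * (v - x)) ->
  average U x t <= m.
Proof.
move=> t0 ax xb H1 H2; apply: (average_le cW UW t0 ax xb) => y y1 y2.
have b1 := ler_wpM2l (ltW t0) y1; have b2 := ler_wpM2l (ltW t0) y2.
rewrite mulr1 in b2; rewrite mulrN1 in b1.
have [y0|y0|->] := ltgtP y 0; last by rewrite mulr0.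
- have ty : t * y < 0 by rewrite pmulr_rlt0.
  rewrite mulr_ge0_le0// ?(ltW y0)//.
  by have := H1 (t * y + x) ltac:(lra) ltac:(lra); lra.
- have ty : 0 < t * y by rewrite mulr_gt0.
  rewrite mulr_le0_ge0// ?(ltW y0)//.
  by have := H2 (t * y + x) ltac:(lra) ltac:(lra); lra.
Qed.

End Slopes.

Variables (U u : schwartz_dist R) (E Z : set R).
Hypothesis Uu : is_derivative U u.
Hypothesis Ul : lojasiewicz U.
Hypothesis cE : countable E.
Hypothesis nZ : lebesgue_measure.-negligible Z.
Hypothesis uEZ : average_nonneg_ae u E Z.

Let good (z : R) := exists n r, 0 < r /\
  forall w, `|w - z| < r -> scaled_bound U n w.

Let good_uniform al be : (forall z, al <= z -> z <= be -> good z) ->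
  exists n, forall z, al <= z -> z <= be -> scaled_bound U n z.
Proof.
move=> H; have /compact_near_coveringP cov := @segment_compact R al be.
have := cov nat \oo (fun n z => scaled_bound U n z) _ _.
case=> [z|N _ NP].
  rewrite /= in_itv/= => /andP[az zb]; have [n [r [r0 nP]]] := H z az zb.
  exists ([set w | `|w - z| < r], [set k | (n <= k)%N]) => /=.
    split; last by exists n.
    by apply/nbhs_ballP; exists r => //= w; rewrite /ball/= distrC.
  by move=> [w k] /= [wr nk]; exact: scaled_boundS nk (nP w wr).
by exists N => z az zb; apply: (NP N); rewrite /= ?in_itv/= ?az.
Qed.

Let good_convex al be : al < be -> (forall z, al <= z -> z <= be -> good z) ->
  exists W : R -> R, [/\ continuous W, chord_convex W al be &
    forall psi c, test_function psi -> al < c ->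
      (forall x, x <= c \/ be <= x -> psi x = 0) ->
      U psi = - cint (fun z => W z * derive1 psi z) al be].
Proof.
move=> ab /good_uniform[n nP]; have [W [cW UW]] := antiderivative ab nP.
exists W; split=> //.
exact: local_convexity cW UW Uu Ul cE nZ uEZ.
Qed.

Let pointwise z : exists n, scaled_bound U n z.
Proof. by have [c /point_value_scaled_bound] := Ul z. Qed.

(* Baire's theorem on the closed set of points that are not good. *)
Let baire z0 : ~ good z0 -> exists x0 r n, [/\ ~ good x0, 0 < r &
  forall y, ~ good y -> `|y - x0| < r -> scaled_bound U n y].
Proof.
move=> bz0; apply: contrapT => nb.
(* From a bad point and a radius to a ball around another bad point that misses a given closed set
   of scaled bounds. Radii shrink by a factor 3, so the centres converge geometrically. *)
have /choice[f fP] : forall p : nat * (R * R), exists q : R * R,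
    ~ good p.2.1 -> 0 < p.2.2 ->
    [/\ ~ good q.1, 0 < q.2, q.2 <= p.2.2 / 3, `|q.1 - p.2.1| + q.2 <= p.2.2 &
      forall w, `|w - q.1| <= q.2 -> ~ scaled_bound U p.1 w].
  move=> [n [x r]]; have [[bx r0]|h] := pselect (~ good x /\ 0 < r); last first.
    by exists (0, 0) => /= bx r0; exfalso; exact: h.
  have : ~ forall y, ~ good y -> `|y - x| < r / 2 -> scaled_bound U n y.
    by move=> H; apply: nb; exists x, (r / 2), n; split=> //; rewrite divr_gt0.
  move=> /existsNP[y] /not_implyP[bqy] /not_implyP[yx] nby.
  have : open [set w | ~ scaled_bound U n w].
    by apply: closed_openC; exact: closed_scaled_bound.
  rewrite openE => /(_ y nby) /nbhs_ballP[d /= d0 dP].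
  pose rho := Num.min (d / 2) (r / 3).
  have rho0 : 0 < rho by rewrite lt_min !divr_gt0.
  have [h1 h2] : rho <= d / 2 /\ rho <= r / 3 by rewrite !ge_min !lexx orbT.
  exists (y, rho) => /= _ _; split=> //; first by lra.
  by move=> w wy; apply: dP; rewrite /ball/= distrC; lra.
pose s := fix s n : R * R := if n is m.+1 then f (m, s m) else (z0, 1).
have sP n : ~ good (s n).1 /\ 0 < (s n).2.
  by elim: n => [|n [b r0]]; [split|have [] := fP (n, s n) b r0].
have sS n := fP (n, s n) (sP n).1 (sP n).2.
have s3 n : (s n).2 <= 3^-1 ^+ n.
  elim: n => [|n IHn]; first by rewrite expr0.
  have [_ _ h _ _] := sS n; rewrite exprS; move: h => /=; lra.
have nested n k : `|(s (k + n)%N).1 - (s n).1| + (s (k + n)%N).2 <= (s n).2.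
  elim: k => [|k IHk]; first by rewrite add0n subrr normr0 add0r.
  have [_ _ _ h _] := sS (k + n)%N; rewrite addSn; move: h => /= h.
  have := ler_distD (s (k + n)%N).1 (s (k + n).+1).1 (s n).1; rewrite /=; lra.
have [|L LP] := @third_series R (fun j => (s j.+1).1 - (s j).1) 1.
  move=> j; rewrite mul1r; apply: le_trans (s3 j).
  have [_ r0 _ h _] := sS j; move: r0 h => /= r0 h; have := normr_ge0 ((s j.+1).1 - (s j).1).
  by rewrite /=; lra.
have LE J : `|(z0 + L) - (s J).1| <= 1 * (3 / 2) * 3^-1 ^+ J.
  rewrite (_ : _ - _ = L - \sum_(j < J) ((s j.+1).1 - (s j).1)); first exact: LP.
  suff -> : \sum_(j < J) ((s j.+1).1 - (s j).1) = (s J).1 - z0 by ring.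
  elim: J => [|J IHJ]; first by rewrite big_ord0 subrr.
  by rewrite big_ord_recr/= -/s IHJ addrC subrKA.
(* The limit lies in every ball and so satisfies no scaled bound, although the point value of U
   there provides one. *)
have [n nP] := pointwise (z0 + L).
have [_ _ _ _ H] := sS n; apply: (H (z0 + L)) nP.
rewrite -[(f (n, s n))]/(s n.+1).
apply: (@le_third _ _ _ (1 * (3 / 2)) n.+1) => J nJ.
have := nested n.+1 (J - n.+1)%N; rewrite subnK// => h.
have := LE J; have [_ rJ] := sP J.
have := ler_distD (s J).1 (z0 + L) (s n.+1).1; lra.
Qed.

(** On the gap W is convex, so its slopes near z lie between the averages of U at z - de/2 and z +
    de/2 at scale de/8. The bound at y controls these: the distances to y are at most 5/2 de = 20
    (de/8), and translation costs 21^(n+1). The factor 9/10 keeps a closed interval inside the open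
    gap. The constant B is independent of the size of the gap. *)
Let gap_lipschitz n (Mk z de B : R) y : scaled_bound U n y ->
  (forall k x, (k <= n)%N -> `|derive1n k (@kernel R) x| <= Mk) ->
  0 < de -> (forall w, `|w - z| < de -> good w) -> `|z - y| <= 2 * de ->
  21 * (de / 8) < n.+1%:R^-1 -> B = n%:R * 21 ^+ n.+1 * Mk ->
  exists W : R -> R, [/\ continuous W,
    forall psi c, test_function psi -> z - 9 / 10 * de < c ->
      (forall x, x <= c \/ z + 9 / 10 * de <= x -> psi x = 0) ->
      U psi = - cint (fun z => W z * derive1 psi z) (z - 9 / 10 * de) (z + 9 / 10 * de) &
    forall p, `|p - z| <= de / 4 -> `|W p - W z| <= B * `|p - z|].
Proof.
move=> Uy MkP de0 gd zy de21 BE.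
have [| |W [cW cvW UW]] := @good_convex (z - 9 / 10 * de) (z + 9 / 10 * de); first by lra.
  by move=> w w1 w2; apply: gd; rewrite ltr_norml; apply/andP; split; lra.
exists W; split=> //.
have s0 : 0 < de / 8 by rewrite divr_gt0.
have avgB v : `|v - y| <= 20 * (de / 8) -> `|average U v (de / 8)| <= B.
  move=> vy.
  have := scaled_bound_translate (k := 20) Uy (ler0n R 20) vy s0 _ (@smooth_kernel R) (@kernel_unit R) MkP.
  rewrite (_ : 20 + 1 = 21 :> R); last by ring.
  move=> /(_ de21) h.
  rewrite /average normrM gtr0_norm ?invr_gt0// ler_pdivrMl// BE.
  by apply: le_trans h _; rewrite le_eqVlt; apply/orP; left; apply/eqP; ring.
have hi : average U (z + de / 2) (de / 8) <= B.
  apply: le_trans (ler_norm _) _; apply: avgB.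
  have -> : z + de / 2 - y = (z - y) + de / 2 by ring.
  by apply: le_trans (ler_normD _ _) _; rewrite (gtr0_norm (_ : 0 < de / 2)) ?divr_gt0//; lra.
have lo : - B <= average U (z - de / 2) (de / 8).
  rewrite lerNl; apply: le_trans (ler_norm _) _; rewrite normrN; apply: avgB.
  have -> : z - de / 2 - y = (z - y) - de / 2 by ring.
  by apply: le_trans (ler_normB _ _) _; rewrite (gtr0_norm (_ : 0 < de / 2)) ?divr_gt0//; lra.
have up p q : z - de / 4 <= p -> p < q -> q <= z + de / 4 -> W q - W p <= B * (q - p).
  move=> zp pq qz; have qp0 : 0 < q - p by lra.
  rewrite -ler_pdivrMr//; apply: le_trans hi.
  apply: (average_ge_slope cW UW s0); [lra|lra| |] => v v1 v2;
    rewrite mulrAC ler_pdivrMr//; apply: (chord_slope cvW) => //; lra.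
have dn p q : z - de / 4 <= p -> p < q -> q <= z + de / 4 -> - B * (q - p) <= W q - W p.
  move=> zp pq qz; have qp0 : 0 < q - p by lra.
  rewrite -ler_pdivlMr//; apply: le_trans lo _.
  apply: (average_le_slope cW UW s0); [lra|lra| |] => v v1 v2;
    rewrite mulrAC ler_pdivlMr//; apply: (chord_slope cvW) => //; lra.
have key p q : z - de / 4 <= p -> p < q -> q <= z + de / 4 ->
    `|W q - W p| <= B * (q - p).
  move=> zp pq qz; rewrite ler_norml up// andbT.
  by have := dn p q zp pq qz; rewrite mulNr.
have d40 : 0 <= de / 4 by rewrite divr_ge0// ltW.
clear up dn hi lo avgB cvW UW.
move=> p; rewrite ler_norml => /andP[p1 p2].
have [pz|pz|->] := ltgtP p z; last by rewrite !subrr normr0 mulr0.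
- rewrite (ltr0_norm (_ : p - z < 0)) ?subr_lt0// opprB distrC.
  by apply: key => //; lra.
- rewrite (gtr0_norm (_ : 0 < p - z)) ?subr_gt0//.
  by apply: key => //; lra.
Qed.

(** At the point x0 from Baire's theorem the bound is uniform after all. A test function at w with
    scale t either comes within 4 t of a bad point, whose bound is translated, or sits in a gap of
    radius at least 4 t, where U is the derivative of a function whose Lipschitz constant does not
    depend on the gap. *)
Let all_good z : good z.
Proof.
apply: contrapT => /baire[x0 [r [n [bx0 r0 nP]]]]; apply: (bx0).
have [Mk MkP] := test_derivs_bounded (@test_kernel R) n.
have Mk0 := derivs_bounded_ge0 MkP.
pose B := n%:R * 21 ^+ n.+1 * Mk.
have B0 : 0 <= B by rewrite !mulr_ge0// exprn_ge0.
have ni0 : 0 < n.+1%:R^-1 :> R by rewrite invr_gt0.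
pose r' := Num.min (r / 4) (n.+1%:R^-1 / 6).
have r'0 : 0 < r' by rewrite lt_min !divr_gt0.
have [r'1 r'2] : r' <= r / 4 /\ r' <= n.+1%:R^-1 / 6 by rewrite !ge_min !lexx orbT.
(* The summands provide, in turn, t < r / 8, the translated bound, the Lipschitz bound and 5 t <
   n.+1%:R^-1. *)
pose q := 8 / r + n%:R * 5 ^+ n.+1 + 2 * B + 5 * n.+1%:R.
pose N := (Num.truncn q + n.+1)%N.
have qN : q <= N%:R.
  apply: le_trans (ltW (truncnS_gt q)) _.
  by rewrite ler_nat /N -addn1 leq_add2l.
have r80 : 0 < 8 / r by rewrite divr_gt0.
have n50 : 0 <= n%:R * 5 ^+ n.+1 :> R by rewrite mulr_ge0 ?exprn_ge0.
have n10 : 0 < n.+1%:R :> R by [].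
exists N, r'; split=> // w wr t th M t0 tN sth th1 thM.
have M0 := derivs_bounded_ge0 thM.
have NS : N.+1%:R = N%:R + 1 :> R by rewrite -natr1.
have tq : t * (q + 1) < 1.
  apply: (@le_lt_trans _ _ (t * N.+1%:R)); first by rewrite ler_pM2l// NS lerD2r.
  by rewrite -ltr_pdivlMr// mul1r.
have tr : t * 8 < r.
  have h : t * (8 / r) < 1.
    apply: le_lt_trans tq; rewrite ler_pM2l// /q; lra.
  by move: h; rewrite mulrA ltr_pdivrMr// mul1r.
have t5 : 5 * t < n.+1%:R^-1.
  rewrite -[ltRHS]mul1r ltr_pdivlMr//; apply: le_lt_trans tq.
  by rewrite [5 * t]mulrC -mulrA ler_pM2l// /q; lra.
have thMn k x : (k <= n)%N -> `|derive1n k th x| <= M.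
  by move=> kn; apply: thM; rewrite (leq_trans kn)// /N addnS ltnW// ltnS leq_addl.
have tth := test_unit sth th1.
have tM0 : 0 <= t * M by rewrite mulr_ge0// ltW.
have [[y [by_ wy]]|far] := pselect (exists y, ~ good y /\ `|w - y| <= 4 * t).
  have yx0 : `|y - x0| < r.
    by have := ler_distD w y x0; rewrite (distrC y w); lra.
  have := scaled_bound_translate (k := 4) (nP y by_ yx0) (ler0n R 4) wy t0 _ sth th1 thMn.
  rewrite (_ : 4 + 1 = 5 :> R); last by ring.
  move=> /(_ t5) /le_trans; apply.
  rewrite -mulrA -[leRHS]mulrA; apply: ler_wpM2r => //.
  by apply: le_trans qN; rewrite /q; lra.
pose S := [set `|w - y| | y in [set y | ~ good y]].
have hS : has_inf S.
  split; first by exists `|w - x0|, x0.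
  by exists 0 => _ [y _ <-].
pose de := inf S.
have low y : ~ good y -> de <= `|w - y| by move=> hy; apply: (ge_inf hS.2); exists y.
have de4 : 4 * t <= de.
  apply: lb_le_inf hS.1 _ => _ [y hy <-]; rewrite leNgt; apply/negP => h.
  by apply: far; exists y; split=> //; exact: ltW.
have de0 : 0 < de by apply: lt_le_trans de4; lra.
(* Taking de itself as tolerance gives a bad point within 2 de of w, as [gap_lipschitz] demands. *)
have [_ [y hy <-] yde] := inf_adherent de0 hS.
have der' : de < r' by apply: le_lt_trans wr; exact: low.
have yx0 : `|y - x0| < r.
  by have := ler_distD w y x0; rewrite (distrC y w); lra.
have [| | |W [cW UW WL]] := gap_lipschitz (nP y hy yx0) MkP de0 _ _ _ (erefl B) (z := w).
- by move=> v vw; apply: contrapT => /low; rewrite distrC leNgt vw.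
- by lra.
- have := lt_le_trans der' r'2; move: ni0; set ni := n.+1%:R^-1.
  by move: (de) ni => d1 ni ? ?; lra.
rewrite (dist_rescale_cint cW UW tth th1 t0); [|lra|lra].
have sth' := smooth_derive1 sth.
have cth' := smooth_continuous sth'.
have M1 x : `|derive1 th x| <= M.
  by rewrite -derive1n1; apply: thM; rewrite /N addnS.
have th1' := vanish_closed ltr01 (smooth_continuous sth) th1.
have -> : cint (fun y => W (t * y + w) * derive1 th y) (-1) 1 =
    cint (fun y => (W (t * y + w) - W w) * derive1 th y) (-1) 1.
  have c1 : continuous (fun y => W (t * y + w) * derive1 th y).
    by apply: ctsM => //; exact: cts_affine.
  have -> : (fun y => (W (t * y + w) - W w) * derive1 th y) =
      fun y => W (t * y + w) * derive1 th y - W w * derive1 th y.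
    by apply/funext => x; rewrite mulrBl.
  rewrite (cintB _ _ c1 (@ctsZ _ _ (W w) cth')) (@cintZ _ _ (W w) _ _ cth').
  rewrite (cint_deriv _ _ cth' (smooth_deriv sth)) !th1' ?normrN ?normr1//.
  by rewrite subrr mulr0 subr0.
rewrite normrN; apply: (@le_trans _ _ (B * t * M * (1 - -1))).
  apply: cint_norm_le; [|lra|].
    by apply: ctsM => //; apply: ctsB; [exact: cts_affine|exact: cts_cst].
  move=> x x1 x2; rewrite normrM; apply: ler_pM => //.
  have xn : `|x| <= 1 by rewrite ler_norml x1.
  have tx : `|t * x| <= t by rewrite normrM gtr0_norm// ler_piMr// ltW.
  apply: le_trans (WL (t * x + w) _) _; rewrite addrK; first by lra.
  by rewrite ler_wpM2l.
have -> : B * t * M * (1 - -1) = 2 * B * (t * M) by ring.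
rewrite -[leRHS]mulrA; apply: ler_wpM2r => //; apply: le_trans qN.
by rewrite /q; lra.
Qed.

Theorem average_monotone x x' t : 0 < t -> x <= x' -> average U x t <= average U x' t.
Proof.
move=> t0 xx; have [| |W [cW cvW UW]] := @good_convex (x - t - 1) (x' + t + 1).
- by lra.
- by move=> *; exact: all_good.
by apply: (average_mono cW UW cvW t0) => //; lra.
Qed.

Theorem average_derivative_ge0 x t : 0 < t -> 0 <= u (rescale x t kernel).
Proof.
move=> t0; have tN0 : t != 0 by rewrite gt_eqF.
have := dist_translate U t0 test_kernel.
rewrite derive1_kernel => dU; rewrite (Uu (test_rescale x tN0 test_kernel)).
rewrite (has_deriv_derive1 (rescale_deriv x t kernel_deriv)).
rewrite (distZ _ _ (test_rescale x tN0 test_slope)) -mulNr.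
have -> : - t^-1 * U (rescale x t kernel_slope) =
    derive1 (fun z => U (rescale z t kernel)) x by rewrite (has_deriv_derive1 dU).
rewrite derive1E; apply: limr_ge; first exact: (@has_deriv_derivable R _ _ x dU).
near=> h; rewrite /GRing.scale/= mulr1.
have hN0 : h != 0 by near: h; exact: nbhs_dnbhs_neq.
have mono y y' : y <= y' -> U (rescale y t kernel) <= U (rescale y' t kernel).
  move=> yy; have := average_monotone t0 yy.
  by rewrite /average ler_pM2l ?invr_gt0.
have [h0|h0|h0] := ltgtP h 0; last by rewrite h0 eqxx in hN0.
- by rewrite mulr_le0 ?invr_le0 ?(ltW h0)// subr_le0 mono// gerDr ltW.
- by rewrite mulr_ge0 ?invr_ge0 ?(ltW h0)// subr_ge0 mono// lerDr ltW.
Unshelve. all: by end_near. Qed.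

End Monotone.

(** * Differences of major and minor pairs *)

Section Pairing.
Context {R : realType}.
Implicit Types (u v U V : schwartz_dist R) (phi psi chi : R -> R) (a b c x t : R).

Lemma tsupport_disjoint phi (K W : set R) : open W -> K `<=` W ->
  (forall x, W x -> phi x = 0) -> tsupport phi `&` K = set0.
Proof.
move=> oW KW phi0; rewrite -subset0 => x [sx Kx].
have : (~` W) x.
  apply: (@tsupport_sub _ phi (~` W)) sx; first exact: open_closedC.
  by move=> y /contrapT; exact: phi0.
by apply; exact: KW.
Qed.

Lemma supported_eq0 u (K W : set R) phi : supported_in K u -> test_function phi ->
  open W -> K `<=` W -> (forall x, W x -> phi x = 0) -> u phi = 0.
Proof.
move=> su tphi oW KW phi0; apply: su tphi _.
exact: tsupport_disjoint oW KW phi0.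
Qed.

(** Two cutoffs are compared through their product: chi' (1 - chi) vanishes near one carrier and chi
    (1 - chi') near the other. *)
Lemma pairing_cutoff u K chi psi : compact K -> supported_in K u -> cutoff K chi ->
  smooth psi -> pairing u psi = u (fun y => chi y * psi y).
Proof.
move=> cK su cchi spsi; rewrite /pairing.
set S := [set r | _]; have : S (u (fun y => chi y * psi y)).
  by exists K, chi.
move=> /(@getI _ S)[K' [chi' [cK' su' [tchi' [W' [oW' KW' chi'1]]] ->]]].
have [tchi [W [oW KW chi1]]] := cchi.
have [sc sc'] := (test_smooth tchi, test_smooth tchi').
have sone (f : R -> R) : smooth f -> smooth (fun y => 1 - f y).
  by move=> sf; exact: (smoothB (@smooth_cst R 1) sf).
have tcc : test_function (fun y => chi y * (chi' y * psi y)).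
  exact: testM tchi (smoothM sc' spsi).
have key f g : test_function f -> smooth g -> smooth psi ->
    u (fun y => f y * (1 - g y) * psi y) = 0 ->
    u (fun y => f y * psi y) = u (fun y => f y * (g y * psi y)).
  move=> tf sg sp h; apply/eqP; rewrite -subr_eq0 -distB.
  - rewrite -[X in _ == X]h; apply/eqP; congr (u _); apply/funext => y.
    by rewrite mulrBr mulr1 mulrBl mulrA.
  - exact: testM tf sp.
  - exact: testM tf (smoothM sg sp).
rewrite (key _ _ tchi' sc spsi); last first.
  apply: (supported_eq0 su) oW KW _.
    exact: testM (testM tchi' (sone _ sc)) spsi.
  by move=> y Wy; rewrite chi1// subrr mulr0 mul0r.
rewrite (key _ _ tchi sc' spsi); last first.
  apply: (supported_eq0 su') oW' KW' _.
    exact: testM (testM tchi (sone _ sc')) spsi.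
  by move=> y Wy; rewrite chi'1// subrr mulr0 mul0r.
by congr (u _); apply/funext => y; rewrite mulrCA.
Qed.

Definition box_plateau a b : R -> R := plateau (`|a| + `|b| + 1).

Lemma box_plateau1 a b y : a - 1 <= y -> y <= b + 1 -> box_plateau a b y = 1.
Proof.
move=> ay yb; apply: plateau_eq1; rewrite ler_norml.
have := ler_norm b; have := ler_norm (- a); rewrite normrN.
by have := normr_ge0 a; have := normr_ge0 b => *; apply/andP; split; lra.
Qed.

Lemma cutoff_box a b : cutoff `[a, b]%classic (box_plateau a b).
Proof.
split; first exact: test_plateau.
exists `]a - 1, b + 1[%classic; split.
- exact: interval_open.
- by move=> y /=; rewrite !in_itv/= => /andP[? ?]; apply/andP; split; lra.
- by move=> y /=; rewrite in_itv/= => /andP[? ?]; apply: box_plateau1; exact: ltW.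
Qed.

Lemma pairing_box u a b psi : supported_in `[a, b]%classic u -> smooth psi ->
  pairing u psi = u (fun y => box_plateau a b y * psi y).
Proof.
move=> su spsi; apply: pairing_cutoff su (cutoff_box a b) spsi.
exact: segment_compact.
Qed.

Lemma pairing_test u a b phi : supported_in `[a, b]%classic u -> test_function phi ->
  pairing u phi = u phi.
Proof.
move=> su tphi; have sphi := test_smooth tphi.
have tb : test_function (box_plateau a b) by exact: test_plateau.
rewrite (pairing_box su sphi); apply/eqP.
rewrite -subr_eq0 -(distB u (testM tb sphi) tphi).
have [_ [W [oW KW W1]]] := cutoff_box a b.
apply/eqP; apply: (supported_eq0 su (testB (testM tb sphi) tphi) oW KW).
by move=> x Wx; rewrite W1// mul1r subrr.
Qed.

Lemma dist_lin_linear k u v (c : R) phi psi :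
  test_function phi -> test_function psi ->
  u (fun x => c * phi x + psi x) + k * v (fun x => c * phi x + psi x) =
  c * (u phi + k * v phi) + (u psi + k * v psi).
Proof. by move=> tphi tpsi; rewrite !dist_linear//; ring. Qed.

Lemma dist_lin_continuous k u v (K : set R) : compact K ->
  exists (N : nat) (C : R), forall phi M, test_function phi -> tsupport phi `<=` K ->
    (forall n x, (n <= N)%N -> `|derive1n n phi x| <= M) ->
    `|u phi + k * v phi| <= C * M.
Proof.
move=> cK; have [N1 [C1 H1]] := dist_continuous u cK.
have [N2 [C2 H2]] := dist_continuous v cK.
exists (maxn N1 N2), (C1 + `|k| * C2) => phi M tphi sphi phiM.
apply: le_trans (ler_normD _ _) _; rewrite normrM mulrDl -mulrA; apply: lerD.
  by apply: H1 => // n x nN; apply: phiM; rewrite leq_max nN.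
rewrite ler_wpM2l//; apply: H2 => // n x nN.
by apply: phiM; rewrite leq_max nN orbT.
Qed.

(** Used with k = -1 for the gap between two pairs and with k = 1 for adding an indefinite
    integral. *)
Definition dist_lin k u v := @SchwartzDist R (fun phi => u phi + k * v phi)
  (dist_lin_linear k u v) (dist_lin_continuous k u v).

Lemma supported_lin k u v K : supported_in K u -> supported_in K v ->
  supported_in K (dist_lin k u v).
Proof.
by move=> su sv phi tphi sphi /=; rewrite su// sv// mulr0 addr0.
Qed.

Lemma is_derivative_lin k u v U V : is_derivative U u -> is_derivative V v ->
  is_derivative (dist_lin k U V) (dist_lin k u v).
Proof. by move=> Uu Vv phi tphi /=; rewrite Uu// Vv//; ring. Qed.

Lemma point_value_lin k U V x c d : point_value U x c -> point_value V x d ->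
  point_value (dist_lin k U V) x (c + k * d).
Proof.
move=> Uc Vd phi tphi /=.
have -> : (fun e => `|e|^-1 * (U (rescale x e phi) + k * V (rescale x e phi))) =
    (fun e => `|e|^-1 * U (rescale x e phi) + k * (`|e|^-1 * V (rescale x e phi))).
  by apply/funext => e; ring.
rewrite mulrDl -mulrA; apply: cvgD; first exact: Uc.
by apply: cvgM; [exact: cvg_cst|exact: Vd].
Qed.

Lemma lojasiewicz_lin k U V : lojasiewicz U -> lojasiewicz V ->
  lojasiewicz (dist_lin k U V).
Proof.
move=> Ul Vl x; have [c Uc] := Ul x; have [d Vd] := Vl x.
by exists (c + k * d); exact: point_value_lin.
Qed.

Lemma pairing_lin k u v a b psi : supported_in `[a, b]%classic u ->
  supported_in `[a, b]%classic v -> smooth psi ->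
  pairing (dist_lin k u v) psi = pairing u psi + k * pairing v psi.
Proof.
move=> su sv spsi; rewrite (pairing_box su spsi) (pairing_box sv spsi).
by rewrite (pairing_box (supported_lin k su sv) spsi).
Qed.

End Pairing.

(** * Upper and lower values as bounds at small scales *)

Section Values.
Context {R : realType}.
Implicit Types (u : schwartz_dist R) (phi : R -> R) (x c : R).

Definition scaled_pairing u phi x t := t^-1 * pairing u (rescale x t phi).

Lemma near0P (P : R -> Prop) : (\forall t \near 0^'+, P t) <->
  exists2 d, 0 < d & forall t, 0 < t -> t < d -> P t.
Proof.
split=> [|[d d0 dP]].
  rewrite /at_right/= near_withinE => /nbhs_ballP[d /= d0 dP]; exists d => // t t0 td.
  by apply: dP => //; rewrite /ball/= sub0r normrN gtr0_norm.
near=> t; apply: dP; near: t; first exact: nbhs_right_gt.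
by apply: nbhs_right_lt.
Unshelve. all: by end_near. Qed.

Lemma lower_value_gt u phi x c : (c%:E < lower_value u phi x)%E ->
  exists2 d, 0 < d & forall t, 0 < t -> t < d -> c <= scaled_pairing u phi x t.
Proof.
rewrite /lower_value limf_einfE => /ereal_sup_gt[_ [V FV <-] cV].
have /near0P[d d0 dV] : \forall t \near 0^'+, V t by exact: FV.
exists d => // t t0 td; rewrite -lee_fin; apply: le_trans (ltW cV) _.
apply: ereal_inf_lbound; exists t; first exact: dV.
by rewrite gtr0_norm.
Qed.

Lemma lower_value_ge u phi x c : (exists2 d, 0 < d & forall t, 0 < t -> t < d ->
  c <= scaled_pairing u phi x t) -> (c%:E <= lower_value u phi x)%E.
Proof.
move=> [d d0 dP]; rewrite /lower_value limf_einfE.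
pose V := [set t | 0 < t /\ t < d].
apply: (@le_trans _ _ (ereal_inf [set (`|t|^-1 * pairing u (rescale x t phi))%:E | t in V])).
  apply: le_ereal_inf_tmp => _ [t [t0 td] <-].
  by rewrite lee_fin gtr0_norm//; exact: dP.
apply: ereal_sup_ubound; exists V => //.
suff : \forall t \near 0^'+, V t by [].
by apply/near0P; exists d.
Qed.

Lemma upper_value_lt u phi x c : (upper_value u phi x < c%:E)%E ->
  exists2 d, 0 < d & forall t, 0 < t -> t < d -> scaled_pairing u phi x t <= c.
Proof.
rewrite /upper_value limf_esupE => /ereal_inf_lt[_ [V FV <-] cV].
have /near0P[d d0 dV] : \forall t \near 0^'+, V t by exact: FV.
exists d => // t t0 td; rewrite -lee_fin; apply: le_trans (ltW cV).
apply: ereal_sup_ubound; exists t; first exact: dV.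
by rewrite gtr0_norm.
Qed.

Lemma upper_value_le u phi x c : (exists2 d, 0 < d & forall t, 0 < t -> t < d ->
  scaled_pairing u phi x t <= c) -> (upper_value u phi x <= c%:E)%E.
Proof.
move=> [d d0 dP]; rewrite /upper_value limf_esupE.
pose V := [set t | 0 < t /\ t < d].
apply: (@le_trans _ _ (ereal_sup [set (`|t|^-1 * pairing u (rescale x t phi))%:E | t in V])).
  apply: ereal_inf_lbound; exists V => //.
  suff : \forall t \near 0^'+, V t by [].
  by apply/near0P; exists d.
apply: ge_ereal_sup => _ [t [t0 td] <-].
by rewrite lee_fin gtr0_norm//; exact: dP.
Qed.

Lemma test_integrable phi : test_function phi ->
  lebesgue_measure.-integrable setT (EFin \o phi).
Proof.
move=> tphi; have [sphi [r phir]] := (test_functionP phi).1 tphi.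
have -> : EFin \o phi = (EFin \o phi) \_ `[- r, r]%classic.
  apply/funext => x; rewrite patchE; case: ifPn => //.
  rewrite notin_setE => nx; rewrite /= phir// ltNge; apply/negP => xr.
  by apply: nx; exact: norm_le_itv.
apply/(integrable_mkcond _ _).1 => //.
exact: continuous_integrable (smooth_continuous sphi).
Qed.

Lemma T1_kernel : T1 (@kernel R).
Proof.
split; last first.
  by move=> x; rewrite derive1_kernel; exact: kernel_slope_le0.
split; [exact: smooth_kernel|exact: kernel_ge0| |].
  have := integrable_fin_num measurableT (test_integrable test_kernel).
  by move=> /fineK <-; congr EFin; exact: Rintegral_kernel.
exists (-2); first by lra.
move=> m; exists 0, 1 => x x1; rewrite mul0r.
by rewrite (derive1n_vanish _ (@kernel_unit R) x1) normr0.
Qed.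

End Values.

(** * Total mass of the averages *)

Section Averages.
Context {R : realType}.
Implicit Types (u U : schwartz_dist R) (a b c x t : R).

Lemma kernel_cumul_eq0 (y : R) : y <= -1 -> cint kernel (-1) y = 0.
Proof.
move=> y1; rewrite cint_swap; suff -> : cint kernel y (-1) = 0 :> R by rewrite oppr0.
rewrite (@eq_cint R kernel (fun=> 0) y (-1) (@cts_kernel R) (@cts_cst R 0) y1).
  by rewrite cint_cst mul0r.
by move=> z _ z1; rewrite kernel_eq0// ler_normr; apply/orP; right; lra.
Qed.

Lemma kernel_cumul_eq1 (y : R) : 1 <= y -> cint kernel (-1) y = 1.
Proof.
move=> y1; rewrite (cint_split _ _ _ 1) cint_kernel.
rewrite (@eq_cint R kernel (fun=> 0) 1 y (@cts_kernel R) (@cts_cst R 0) y1).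
  by rewrite cint_cst mul0r addr0.
by move=> z z1 _; rewrite kernel_eq0// ler_normr; apply/orP; left; lra.
Qed.

Lemma kernel_cumul_deriv : has_deriv (cint kernel (-1 : R)) kernel.
Proof.
apply: has_deriv_eq (has_derivB (primitive_deriv (@cts_kernel R))
  (@has_deriv_cst R (primitive kernel (-1)))) _ => x.
by rewrite subr0.
Qed.

Lemma smooth_kernel_cumul : smooth (cint kernel (-1 : R)).
Proof. exact: smooth_antideriv kernel_cumul_deriv smooth_kernel. Qed.

(** Near K the primitives of the two rescaled kernels are both 0 or both 1. Their difference is a
    test function that u does not see. *)
Lemma average_locally_constant U u (K W : set R) (x t x' t' : R) :
  is_derivative U u -> supported_in K u -> open W -> K `<=` W -> 0 < t -> 0 < t' ->
  (forall y, W y -> y <= x - t /\ y <= x' - t' \/ x + t <= y /\ x' + t' <= y) ->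
  average U x t = average U x' t'.
Proof.
move=> Uu su oW KW t0 t'0 WP.
have [tN0 t'N0] : t != 0 /\ t' != 0 by rewrite !gt_eqF.
pose F := cint kernel (-1 : R).
pose th y := rescale x t F y - rescale x' t' F y.
have Flow (z s y : R) : 0 < s -> y <= z - s -> rescale z s F y = 0.
  by move=> s0 ys; apply: kernel_cumul_eq0; rewrite ler_pdivrMr//; lra.
have Fhigh (z s y : R) : 0 < s -> z + s <= y -> rescale z s F y = 1.
  by move=> s0 ys; apply: kernel_cumul_eq1; rewrite ler_pdivlMr//; lra.
have tth : test_function th.
  apply/test_functionP; split.
    by apply: smoothB; apply: smooth_rescale; exact: smooth_kernel_cumul.
  exists (`|x| + t + (`|x'| + t')) => y; rewrite /th lter_normr => /orP[] hy.
    rewrite !Fhigh ?subrr//; have := ler_norm x; have := ler_norm x';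
    have := normr_ge0 x; have := normr_ge0 x'; lra.
  rewrite !Flow ?subrr//; have := ler_norm (- x); have := ler_norm (- x');
  have := normr_ge0 x; have := normr_ge0 x'; rewrite !normrN; lra.
have dth : has_deriv th (fun y => t^-1 * rescale x t kernel y - t'^-1 * rescale x' t' kernel y).
  by apply: has_derivB; apply: rescale_deriv; exact: kernel_cumul_deriv.
have := Uu _ tth; rewrite (has_deriv_derive1 dth).
have tr z s : s != 0 -> test_function (fun y => s^-1 * rescale z s (@kernel R) y).
  by move=> s0; apply: testZ; exact: test_rescale s0 test_kernel.
rewrite (distB _ (tr x t tN0) (tr x' t' t'N0)).
rewrite (distZ _ _ (test_rescale x tN0 test_kernel)).
rewrite (distZ _ _ (test_rescale x' t'N0 test_kernel)).
rewrite (supported_eq0 su tth oW KW).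
  by rewrite /average => /eqP; rewrite eq_sym oppr_eq0 subr_eq0 => /eqP.
move=> y /WP[[h1 h2]|[h1 h2]]; rewrite /th.
  by rewrite !Flow// subrr.
by rewrite !Fhigh// subrr.
Qed.

Lemma average_right U u a b (x t x' t' : R) : is_derivative U u ->
  supported_in `[a, b]%classic u -> 0 < t -> 0 < t' -> b < x - t -> b < x' - t' ->
  average U x t = average U x' t'.
Proof.
move=> Uu su t0 t'0 bx bx'.
apply: (average_locally_constant (W := `]-oo, (Num.min (x - t) (x' - t'))[%classic) Uu su _ _ t0 t'0).
- exact: interval_open.
- by move=> y /=; rewrite !in_itv/= lt_min => /andP[_ yb]; rewrite !(le_lt_trans yb).
- by move=> y /=; rewrite in_itv/= lt_min => /andP[/ltW ? /ltW ?]; left.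
Qed.

Lemma average_left U u a b (x t x' t' : R) : is_derivative U u ->
  supported_in `[a, b]%classic u -> 0 < t -> 0 < t' -> x + t < a -> x' + t' < a ->
  average U x t = average U x' t'.
Proof.
move=> Uu su t0 t'0 bx bx'.
apply: (average_locally_constant (W := `](Num.max (x + t) (x' + t')), +oo[%classic) Uu su _ _ t0 t'0).
- exact: interval_open.
- move=> y /=; rewrite !in_itv/= gt_max andbT => /andP[ya _].
  by rewrite (lt_le_trans bx ya) (lt_le_trans bx' ya).
- by move=> y /=; rewrite in_itv/= gt_max andbT => /andP[/ltW ? /ltW ?]; right.
Qed.

Lemma Rintegral_shift_kernel (s : R) :
  \int[lebesgue_measure]_y rescale s 1 kernel y = 1 :> R.
Proof.
rewrite rescale_affine.
rewrite (@Rintegral_cint R _ (s - 1) (s + 1)); last 3 first.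
- by apply: cts_affine; exact: cts_kernel.
- lra.
- move=> x sx; apply: kernel_eq0; rewrite invr1 mul1r mulr1.
  by apply: norm_gt1; case: sx => ?; [left|right]; lra.
have := @cint_affine R kernel (1^-1) (- (s / 1)) (s - 1) (s + 1) (@cts_kernel R).
rewrite invr1 !mul1r mulr1 => <-.
have -> : s - 1 - s = -1 by ring.
have -> : s + 1 - s = 1 by ring.
exact: cint_kernel.
Qed.

(** A kernel displaced from z by s times its scale is again a rescaled test function of integral 1,
    so averages taken off the support compute the point value at z. *)
Lemma point_value_shift U z c s k : point_value U z c ->
  (forall e, 0 < e -> average U (z + s * e) e = k) -> k = c.
Proof.
move=> Uc Uk.
have ts : test_function (rescale s 1 (@kernel R)).
  exact: test_rescale (oner_neq0 R) test_kernel.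
have := Uc _ ts; rewrite Rintegral_shift_kernel mulr1 => /cvgrPdist_lt H.
apply/eqP/negP => /negP kc.
have : 0 < `|c - k| by rewrite normr_gt0 subr_eq0 eq_sym.
move=> /H; rewrite /= near_withinE => /nbhs_ballP[d /= d0 dP].
have d20 : 0 < d / 2 by rewrite divr_gt0.
have := dP (d / 2); rewrite /ball/= sub0r normrN gtr0_norm// gt_eqF// => /(_ _ isT).
have -> : rescale z (d / 2) (rescale s 1 kernel) = rescale (z + s * (d / 2)) (d / 2) (@kernel R).
  by apply/funext => y; rewrite /rescale; congr (kernel _); field; rewrite gt_eqF.
rewrite -/(average U _ _) (Uk _ d20) ltxx => /(_ _)/negP; apply => //.
lra.
Qed.

Lemma average_deriv U u t : is_derivative U u -> 0 < t ->
  has_deriv (fun x => average U x t) (fun x => t^-1 * u (rescale x t kernel)).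
Proof.
move=> Uu t0; have tN0 : t != 0 by rewrite gt_eqF.
apply: has_deriv_eq (has_derivZ t^-1 (dist_translate U t0 test_kernel)) _ => x.
rewrite derive1_kernel (Uu _ (test_rescale x tN0 test_kernel)).
rewrite (has_deriv_derive1 (rescale_deriv x t kernel_deriv)).
by rewrite (distZ _ _ (test_rescale x tN0 test_slope)) mulNr.
Qed.

Lemma scaled_dist_continuous u t : 0 < t -> continuous (fun x => t^-1 * u (rescale x t kernel)).
Proof.
move=> t0; apply: ctsZ; exact: has_deriv_continuous (dist_translate u t0 test_kernel).
Qed.

(** Since t < 1, the averages of U at a - 1 and b + 1 do not meet the support of u, where U is
    locally constant. The shifts 2 and -2 keep the comparison kernels outside [a, b]. *)
Lemma cint_scaled_dist U u a b ca cb t : is_derivative U u ->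
  supported_in `[a, b]%classic u -> point_value U a ca -> point_value U b cb ->
  0 < t -> t < 1 ->
  cint (fun x => t^-1 * u (rescale x t kernel)) (a - 1) (b + 1) = cb - ca.
Proof.
move=> Uu su Ua Ub t0 t1.
rewrite (cint_deriv _ _ (@scaled_dist_continuous u t t0) (average_deriv Uu t0)).
congr (_ - _).
  apply: (point_value_shift Ub (s := 2)) => e e0.
  by apply: (average_right Uu su) => //; lra.
apply: (point_value_shift Ua (s := -2)) => e e0.
by apply: (average_left Uu su) => //; lra.
Qed.

End Averages.

Section LimInf.
Context {R : realType}.
Local Open Scope ereal_scope.
Implicit Types (u v : nat -> \bar R) (c : \bar R).

Lemma limn_einfE u : limn_einf u = ereal_sup (range (einfs u)).
Proof. by rewrite limn_einf_lim; apply/cvg_lim => //; exact: cvg_einfs_sup. Qed.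

Lemma limn_einf_ge u c N : (forall n, (N <= n)%N -> c <= u n) -> c <= limn_einf u.
Proof.
move=> cu; rewrite limn_einfE; apply: le_trans (ereal_sup_ubound _); last by exists N.
by apply: le_ereal_inf_tmp => _ [n /= Nn <-]; exact: cu.
Qed.

Lemma limn_einf_gt u c : c < limn_einf u -> exists N, forall n, (N <= n)%N -> c < u n.
Proof.
rewrite limn_einfE => /ereal_sup_gt[_ [N _ <-] cN]; exists N => n Nn.
by apply: lt_le_trans cN _; apply: ereal_inf_lbound; exists n.
Qed.

Lemma limn_einf_lt u c : limn_einf u < c -> forall N, exists2 n, (N <= n)%N & u n < c.
Proof.
move=> uc N; apply: contrapT => H; move: uc; rewrite ltNge => /negP; apply.
apply: (@limn_einf_ge _ _ N) => n Nn; rewrite leNgt; apply/negP => un.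
by apply: H; exists n.
Qed.

Lemma limn_einf_le u c : (forall N, exists2 n, (N <= n)%N & u n <= c) -> limn_einf u <= c.
Proof.
move=> uc; rewrite limn_einfE; apply: ge_ereal_sup => _ [N _ <-].
have [n Nn un] := uc N.
by apply: le_trans un; apply: ereal_inf_lbound; exists n.
Qed.



Lemma measurable_limn_einf (d : measure_display) (T : measurableType d) (D : set T) (f : nat -> T -> \bar R) :
  (forall n, measurable_fun D (f n)) -> measurable_fun D (fun x => limn_einf (f ^~ x)).
Proof.
move=> mf; rewrite /limn_einf; apply: measurableT_comp => //.
apply: (@measurable_fun_limn_esup _ _ _ _ (fun n x => - f n x)) => n.
exact: measurableT_comp.
Qed.

Lemma small_invS (d : R) : (0 < d)%R -> exists N, forall n, (N <= n)%N -> (n.+2%:R^-1 < d)%R.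
Proof.
move=> d0; exists (Num.truncn d^-1) => n Nn.
rewrite invf_plt ?posrE//; apply: lt_trans (truncnS_gt _) _.
by rewrite ltr_nat ltnS (leq_ltn_trans Nn).
Qed.

End LimInf.

(** * Limits of averages along a sequence of scales *)

Section Density.
Context {R : realType}.
Implicit Types (u v w U V : schwartz_dist R) (f g : R -> \bar R) (a b x c d : R).
Local Notation mu := lebesgue_measure.

(** A sequence of scales makes the lower limit measurable; m + 2 keeps them below 1, as the
    computation of the total mass requires. *)
Definition density w m x := m.+2%:R^-1^-1 * w (rescale x m.+2%:R^-1 kernel).

Definition lower_density w x : \bar R := limn_einf (fun m => (density w m x)%:E).

Lemma inv2_gt0 m : 0 < m.+2%:R^-1 :> R.
Proof. by rewrite invr_gt0. Qed.

Lemma inv2_lt1 m : m.+2%:R^-1 < 1 :> R.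
Proof. by rewrite invf_lt1// ltr1n. Qed.

Lemma density_continuous w m : continuous (density w m).
Proof. exact: scaled_dist_continuous (inv2_gt0 m). Qed.

Lemma measurable_lower_density w : measurable_fun setT (lower_density w).
Proof.
apply: (measurable_limn_einf (f := fun m x => (density w m x)%:E)) => m.
apply/measurable_EFinP; apply: continuous_measurable_fun.
exact: density_continuous.
Qed.

Lemma integral_density w U a b ca cb m : a <= b -> is_derivative U w ->
  supported_in `[a, b]%classic w -> point_value U a ca -> point_value U b cb ->
  (forall x, 0 <= density w m x) ->
  (\int[mu]_(x in `[a, b]) (density w m x)%:E <= (cb - ca)%:E)%E.
Proof.
move=> ab Uw sw Ua Ub w0; pose I := `[a - 1, b + 1]%classic.
have cd := @density_continuous w m.
have md : measurable_fun I (EFin \o density w m).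
  by apply/measurable_EFinP; apply: measurable_funTS; exact: continuous_measurable_fun.
apply: (@le_trans _ _ (\int[mu]_(x in I) (density w m x)%:E)%E).
  apply: ge0_subset_integral; [exact: measurable_itv|exact: measurable_itv|exact: md| |].
    by move=> x _; rewrite lee_fin; exact: w0.
  by move=> x; rewrite /I/= !in_itv/= => /andP[? ?]; apply/andP; split; lra.
have := cint_scaled_dist Uw sw Ua Ub (inv2_gt0 m) (inv2_lt1 m).
rewrite -/(density w m) cint_rint//; last by lra.
move=> <-; rewrite /Rintegral fineK//; apply: integrable_fin_num => //.
exact: continuous_integrable.
Qed.

Lemma integral_lower_density w U a b ca cb : a <= b -> is_derivative U w ->
  supported_in `[a, b]%classic w -> point_value U a ca -> point_value U b cb ->
  (forall m x, 0 <= density w m x) ->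
  (\int[mu]_(x in `[a, b]) lower_density w x <= (cb - ca)%:E)%E.
Proof.
move=> ab Uw sw Ua Ub w0.
pose f m x := (density w m x)%:E.
have mI : measurable `[a, b]%classic by exact: measurable_itv.
apply: le_trans (@fatou _ _ _ mu _ mI f _ _) _.
- move=> m; apply/measurable_EFinP; apply: measurable_funTS.
  by apply: continuous_measurable_fun; exact: density_continuous.
- by move=> m x _; rewrite lee_fin.
apply: limn_einf_le => N; exists N => //.
exact: integral_density Uw sw Ua Ub _.
Qed.

End Density.

Section Gap.
Context {R : realType}.
Implicit Types (u v w U V : schwartz_dist R) (f g : R -> \bar R) (a b x c d : R).
Local Notation mu := lebesgue_measure.

Lemma supported_rescale_eq0 u a b x : supported_in `[a, b]%classic u ->
  ~ `[a, b]%classic x -> exists2 d, 0 < d & forall t, 0 < t -> t < d ->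
  u (rescale x t kernel) = 0.
Proof.
move=> su /= /negP; rewrite in_itv/= negb_and -!ltNge => /orP[xa|bx].
- exists (a - x); first by rewrite subr_gt0.
  move=> t t0 ta; have tN0 : t != 0 by rewrite gt_eqF.
  apply: (supported_eq0 su (test_rescale x tN0 test_kernel) (W := `]x + t, +oo[%classic)).
  + exact: interval_open.
  + by move=> y /=; rewrite !in_itv/= => /andP[ya _]; rewrite andbT; lra.
  + move=> y /=; rewrite in_itv/= andbT => xy; apply: kernel_eq0.
    by rewrite ler_normr ler_pdivlMr// mul1r; apply/orP; left; lra.
- exists (x - b); first by rewrite subr_gt0.
  move=> t t0 ta; have tN0 : t != 0 by rewrite gt_eqF.
  apply: (supported_eq0 su (test_rescale x tN0 test_kernel) (W := `]-oo, (x - t)[%classic)).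
  + exact: interval_open.
  + by move=> y /=; rewrite !in_itv/= => /andP[_ ya]; lra.
  + move=> y /=; rewrite in_itv/= => xy; apply: kernel_eq0.
    by rewrite ler_normr; apply/orP; right; rewrite -mulNr ler_pdivlMr// mul1r; lra.
Qed.

Lemma scaled_pairing_kernel u a b x t : supported_in `[a, b]%classic u -> 0 < t ->
  scaled_pairing u kernel x t = t^-1 * u (rescale x t kernel).
Proof.
move=> su t0; rewrite /scaled_pairing (pairing_test su)//.
by apply: test_rescale test_kernel; rewrite gt_eqF.
Qed.

Lemma scaled_gap u v a b x t : supported_in `[a, b]%classic u ->
  supported_in `[a, b]%classic v -> 0 < t ->
  t^-1 * dist_lin (-1) u v (rescale x t kernel) =
  scaled_pairing u kernel x t - scaled_pairing v kernel x t.
Proof.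
move=> su sv t0; rewrite (scaled_pairing_kernel x su t0) (scaled_pairing_kernel x sv t0).
by rewrite /= mulN1r mulrBr.
Qed.

Local Open Scope ereal_scope.

Lemma density_gt u a b x c : supported_in `[a, b]%classic u ->
  c%:E < lower_value u kernel x -> exists N, forall m, (N <= m)%N -> (c <= density u m x)%R.
Proof.
move=> su /lower_value_gt[d d0 dP]; have [N NP] := small_invS d0.
exists N => m /NP md; rewrite /density -(scaled_pairing_kernel x su (inv2_gt0 m)).
exact: dP (inv2_gt0 m) md.
Qed.

Lemma density_lt u a b x c : supported_in `[a, b]%classic u ->
  upper_value u kernel x < c%:E -> exists N, forall m, (N <= m)%N -> (density u m x <= c)%R.
Proof.
move=> su /upper_value_lt[d d0 dP]; have [N NP] := small_invS d0.
exists N => m /NP md; rewrite /density -(scaled_pairing_kernel x su (inv2_gt0 m)).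
exact: dP (inv2_gt0 m) md.
Qed.

Lemma densityB u v m x :
  density (dist_lin (-1) u v) m x = (density u m x - density v m x)%R.
Proof. by rewrite /density /= mulN1r mulrBr. Qed.

Lemma lt_ereal_real (c : \bar R) (P : \bar R) :
  (forall r : R, r%:E < c -> r%:E <= P) -> -oo < c -> c <= P.
Proof.
case: c => [c||]//.
- move=> H _; apply/lee_addgt0Pr => e e0; rewrite -leeBlDr//.
  by apply: H; rewrite lte_fin; lra.
- move=> H _; rewrite leye_eq; apply/eqP; case: P H => // [r|] H.
    by have := H (r + 1)%R (ltry _); rewrite lee_fin gerDl ler10.
  by have := H 0%R (ltry _).
Qed.

(** If the lower value of u or the upper value of v were infinite, so would be the lower limit p of
    the averages of u - v. Hence fx and gx, which lie between them, are finite, and the lower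
    density of u exceeds the upper value of v by at most p. *)
Lemma lower_density_bounds u v a b x (fx gx : \bar R) :
  supported_in `[a, b]%classic u -> supported_in `[a, b]%classic v ->
  upper_value v kernel x <= fx -> fx <= gx -> gx <= lower_value u kernel x ->
  -oo < lower_value u kernel x -> upper_value v kernel x < +oo ->
  lower_density (dist_lin (-1) u v) x < +oo ->
  [/\ fx \is a fin_num, gx \is a fin_num, gx <= lower_density u x &
      lower_density u x <= fx + lower_density (dist_lin (-1) u v) x].
Proof.
move=> su sv vf fg gu u0 v0; set p := lower_density _ x; set k := lower_density _ x => p0.
have A c d : c%:E < lower_value u kernel x -> upper_value v kernel x < d%:E ->
    (c - d)%:E <= p.
  move=> /(density_gt su)[N1 H1] /(density_lt sv)[N2 H2].
  apply: (@limn_einf_ge _ _ _ (maxn N1 N2)) => m; rewrite geq_max => /andP[/H1 h1 /H2 h2].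
  by rewrite lee_fin densityB; lra.
have B c : c%:E < lower_value u kernel x -> c%:E <= k.
  move=> /(density_gt su)[N H]; apply: (@limn_einf_ge _ _ _ N) => m /H h1.
  by rewrite lee_fin.
have C d : upper_value v kernel x < d%:E -> k <= d%:E + p.
  move=> /(density_lt sv)[N2 H2]; have [->|k0] := eqVneq k -oo; first exact: leNye.
  apply: lt_ereal_real => [r /limn_einf_gt[N1 H1]|]; last by rewrite ltNye.
  rewrite -leeBlDl//; apply: (@limn_einf_ge _ _ _ (maxn N1 N2)) => m.
  rewrite geq_max => /andP[/H1 h1 /H2 h2].
  by rewrite -EFinB lee_fin densityB; rewrite lte_fin in h1; lra.
have lfin : lower_value u kernel x \is a fin_num.
  rewrite fin_numE -ltNye u0/=; apply/negP => /eqP ly.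
  have [d vd] : exists d : R, upper_value v kernel x < d%:E.
    by move: v0; case: (upper_value v kernel x) => [r _|//|_]; [exists (r + 1)%R|exists 0%R; exact: ltNyr]; rewrite lte_fin; lra.
  move: p0; rewrite ltNge => /negP; apply; apply: lt_ereal_real => [r _|//].
  have -> : r = (r + d - d)%R by ring.
  by apply: A => //; rewrite ly ltry.
have vfin : upper_value v kernel x \is a fin_num.
  rewrite fin_numE -ltey v0 andbT; apply/negP => /eqP vNy.
  move: p0; rewrite ltNge => /negP; apply; apply: lt_ereal_real => [r _|//].
  rewrite -(fineK lfin) in A; set l := fine _ in A.
  have -> : r = ((l - 1) - (l - 1 - r))%R by ring.
  by apply: A; [rewrite lte_fin; lra|rewrite vNy ltNyr].
have ffin : fx \is a fin_num.
  apply: fin_real; rewrite (lt_le_trans _ vf) ?(le_lt_trans (le_trans fg gu))//.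
    by rewrite ltey_eq lfin.
  by rewrite ltNye_eq vfin.
have gfin : gx \is a fin_num.
  apply: fin_real; rewrite (lt_le_trans _ (le_trans vf fg)) ?(le_lt_trans gu)//.
    by rewrite ltey_eq lfin.
  by rewrite ltNye_eq vfin.
split=> //.
  apply: (le_trans gu); apply: lt_ereal_real u0 => r; exact: B.
apply: le_trans (_ : upper_value v kernel x + p <= _); last by rewrite leeD2r.
rewrite addeC -leeBlDr//; move: C vfin; case: (upper_value v kernel x) => // r C _.
apply/lee_addgt0Pr => e e0; rewrite leeBlDr// -addeA addeC.
have -> : e%:E + r%:E = (r + e)%:E by rewrite addeC.
by apply: C; rewrite lte_fin; lra.
Qed.

End Gap.

Section AlmostEverywhere.
Context {R : realType}.
Implicit Types P Q S : R -> Prop.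
Local Notation mu := (@lebesgue_measure R).

Lemma ae_imp P Q : {ae mu, forall x, P x} -> (forall x, P x -> Q x) -> {ae mu, forall x, Q x}.
Proof. by move=> aP PQ; apply: negligibleS aP => x /=; apply: contra_not; exact: PQ. Qed.

Lemma ae_imp2 P Q S : {ae mu, forall x, P x} -> {ae mu, forall x, Q x} ->
  (forall x, P x -> Q x -> S x) -> {ae mu, forall x, S x}.
Proof.
move=> aP aQ PQS; apply: negligibleS (negligibleU aP aQ) => x /= nS.
have [Px|nP] := pselect (P x); last by left.
by right => Qx; apply: nS; exact: PQS.
Qed.

Lemma ae_forall (P : nat -> R -> Prop) : (forall n, {ae mu, forall x, P n x}) ->
  {ae mu, forall x, forall n, P n x}.
Proof.
move=> aP; apply: negligibleS (negligible_bigcup aP) => x /= /existsNP[n nP].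
by exists n.
Qed.

End AlmostEverywhere.

Section PairGap.
Context {R : realType}.
Implicit Types (u v w U V : schwartz_dist R) (f g p k : R -> \bar R) (a b x c d : R).
Local Notation mu := lebesgue_measure.

Lemma rescale_kernel_bounds a b u v x c d : supported_in `[a, b]%classic u ->
  supported_in `[a, b]%classic v -> (c%:E < lower_value u kernel x)%E ->
  (upper_value v kernel x < d%:E)%E -> exists2 e, 0 < e & forall t, 0 < t -> t < e ->
  c - d <= t^-1 * dist_lin (-1) u v (rescale x t kernel).
Proof.
move=> su sv /lower_value_gt[e1 e10 H1] /upper_value_lt[e2 e20 H2].
exists (Num.min e1 e2); first by rewrite lt_min e10.
move=> t t0; rewrite lt_min => /andP[/(H1 _ t0) h1 /(H2 _ t0) h2].
by rewrite (scaled_gap x su sv t0); lra.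
Qed.

(** As x = y is possible, only a level separating up to e can be expected. *)
Lemma ereal_between (x y : \bar R) e : 0 < e -> (x <= y)%E -> (x < +oo)%E -> (-oo < y)%E ->
  exists c, ((c - e)%:E < y)%E /\ (x < (c + e)%:E)%E.
Proof.
move=> e0; case: y => [y||]//; case: x => [x||]//; rewrite ?lee_fin => xy _ _.
- by exists y; rewrite !lte_fin; split; lra.
- by exists y; rewrite lte_fin ltNyr; split => //; lra.
- by exists x; rewrite lte_fin ltry; split => //; lra.
- by exists 0; rewrite ltNyr ltry.
Qed.

Lemma pair_average_nonneg a b f g u U v V : major_pair a b g u U ->
  minor_pair a b f v V -> {ae mu, forall x, `[a, b]%classic x -> (f x <= g x)%E} ->
  exists E Z : set R, [/\ countable E, mu.-negligible Z,
    average_nonneg_ae (dist_lin (-1) u v) E Z &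
    forall x, `[a, b]%classic x -> ~ Z x ->
      [/\ (upper_value v kernel x <= f x)%E, (f x <= g x)%E, (g x <= lower_value u kernel x)%E,
          (-oo < lower_value u kernel x)%E & (upper_value v kernel x < +oo)%E]].
Proof.
move=> [su _ _ _ [E1 [Z1 [cE1 nZ1 Z1P E1P]]]] [sv _ _ _ [E2 [Z2 [cE2 nZ2 Z2P E2P]]]] fg.
pose E := E1 `|` E2; pose N := ~` [set x | `[a, b]%classic x -> (f x <= g x)%E].
have cE : countable E by rewrite /E -bigcup2E; apply: bigcup_countable => //= -[|[|]].
have nE : mu.-negligible E.
  apply/negligibleP; last exact: countable_lebesgue_measure0.
  by apply: countable_measurable => // x; exact: measurable_set1.
have nN : mu.-negligible N by exact: fg.
(* E is put into Z as well, so that off Z the pointwise inequalities and the one-sided finiteness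
   hold together. *)
pose Z := ((Z1 `|` Z2) `|` N) `|` E.
have goodE x : `[a, b]%classic x -> ~ E x ->
    (-oo < lower_value u kernel x)%E /\ (upper_value v kernel x < +oo)%E.
  move=> xab nEx; split; first by apply: E1P T1_kernel => // ?; apply: nEx; left.
  by apply: E2P T1_kernel => // ?; apply: nEx; right.
have goodZ x : `[a, b]%classic x -> ~ Z x ->
      [/\ (upper_value v kernel x <= f x)%E, (f x <= g x)%E, (g x <= lower_value u kernel x)%E,
          (-oo < lower_value u kernel x)%E & (upper_value v kernel x < +oo)%E].
  move=> xab nZ; have [|h1 h2] := goodE x xab; first by move=> Ex; apply: nZ; right.
  have [T0k _] := @T1_kernel R; split=> //.
  - by apply: Z2P => // ?; apply: nZ; left; left; right.
  - by apply: contrapT => fgx; apply: nZ; left; right => /(_ xab).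
  - by apply: Z1P => // ?; apply: nZ; left; left; left.
exists E, Z; split=> //; first by do 3 apply: negligibleU => //.
split=> x.
- move=> nE' nZ e e0; have [xab|xab] := pselect (`[a, b]%classic x).
    have [h1 h2 h3 h4 h5] := goodZ x xab nZ.
    have e2 : 0 < e / 2 by rewrite divr_gt0.
    have [c [c1 c2]] := ereal_between e2 (le_trans h1 (le_trans h2 h3)) h5 h4.
    have [d d0 dP] := rescale_kernel_bounds su sv c1 c2.
    exists d => // t t0 td; apply: le_trans (dP t t0 td); lra.
  have [d d0 dP] := supported_rescale_eq0 (supported_lin (-1) su sv) xab.
  by exists d => // t t0 td; rewrite dP// mulr0 oppr_le0 ltW.
- move=> nE'; have [xab|xab] := pselect (`[a, b]%classic x).
    have [h1 h2] := goodE x xab nE'.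
    have [c cP] : exists c, (c%:E < lower_value u kernel x)%E.
      move: h1; case: (lower_value _ _ _) => // [r _|_]; last by exists 0; rewrite ltry.
      by exists (r - 1); rewrite lte_fin; lra.
    have [d dP] : exists c, (upper_value v kernel x < c%:E)%E.
      move: h2; case: (upper_value _ _ _) => // [r _|_]; last by exists 0; rewrite ltNyr.
      by exists (r + 1); rewrite lte_fin; lra.
    have [e e0 H] := rescale_kernel_bounds su sv cP dP.
    by exists (d - c), e; split => // t t0 te; rewrite opprB; exact: H.
  have [d d0 dP] := supported_rescale_eq0 (supported_lin (-1) su sv) xab.
  by exists 0, d; split=> // t t0 td; rewrite dP// mulr0 oppr0.
Qed.

(** p and k are the lower densities of u - v and of u. Nothing is assumed on the measurability of f
    and g; the measurable k squeezed between g and f + p is what yields it when f = g and p is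
    small. *)
Theorem pair_gap a b f g u U v V cu cv : a <= b -> major_pair a b g u U ->
  minor_pair a b f v V -> point_value U b cu -> point_value V b cv ->
  {ae mu, forall x, `[a, b]%classic x -> (f x <= g x)%E} ->
  exists p k, [/\ measurable_fun setT p, measurable_fun setT k, forall x, (0 <= p x)%E,
    (\int[mu]_(x in `[a, b]) p x <= (cu - cv)%:E)%E &
    {ae mu, forall x, `[a, b]%classic x ->
      [/\ (p x < +oo)%E, f x \is a fin_num, g x \is a fin_num, (g x <= k x)%E &
          (k x <= f x + p x)%E]}].
Proof.
move=> ab mju mnv Ub Vb fg.
have [E [Z [cE nZ avg good]]] := pair_average_nonneg mju mnv fg.
have [su Ul Uu Ua _] := mju; have [sv Vl Vv Va _] := mnv.
set w := dist_lin (-1) u v; set W := dist_lin (-1) U V.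
have Ww : is_derivative W w by exact: is_derivative_lin.
have Wl : lojasiewicz W by exact: lojasiewicz_lin.
have w0 m x : 0 <= density w m x.
  rewrite /density mulr_ge0 ?invr_ge0 ?(ltW (inv2_gt0 m))//.
  exact: (average_derivative_ge0 Ww Wl cE nZ avg x (inv2_gt0 m)).
have Wa : point_value W a 0.
  by have := @point_value_lin R (-1) U V a 0 0 Ua Va; rewrite mulr0 addr0.
have Wb : point_value W b (cu - cv).
  by have := @point_value_lin R (-1) U V b cu cv Ub Vb; rewrite mulN1r.
have pint := integral_lower_density ab Ww (supported_lin (-1) su sv) Wa Wb w0.
rewrite subr0 in pint.
have mp := measurable_lower_density w.
have p0 x : (0 <= lower_density w x)%E.
  by apply: (@limn_einf_ge _ _ _ 0) => m _; rewrite lee_fin.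
exists (lower_density w), (lower_density u); split=> //.
  exact: measurable_lower_density.
have mab := @measurable_itv R `[a, b].
have pI : mu.-integrable `[a, b]%classic (lower_density w).
  apply/integrableP; split; first exact: measurable_funTS.
  under eq_integral do rewrite gee0_abs//.
  by apply: le_lt_trans pint _; rewrite ltry.
have aZ : {ae mu, forall x, ~ Z x} by apply: negligibleS nZ => x /= /contrapT.
apply: ae_imp2 aZ (@integrable_ae _ _ _ mu _ mab _ pI) _ => x nZx pfin xab.
have [h1 h2 h3 h4 h5] := good x xab nZx.
have ply : (lower_density w x < +oo)%E by rewrite ltey_eq pfin.
by have [] := lower_density_bounds su sv h1 h2 h3 h4 h5 ply.
Qed.

End PairGap.

(** * Integrability, measurability and comparison *)

Section Integrable.
Context {R : realType}.
Implicit Types (f g h : R -> \bar R) (a b c d I : R).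
Local Notation mu := lebesgue_measure.

(** Integrability with epsilons, which is directly stable under adding pairs and avoids arithmetic
    with extended suprema and infima. *)
Definition has_integral a b f I :=
  (forall e, 0 < e -> exists u U c, [/\ major_pair a b f u U, point_value U b c & c < I + e]) /\
  (forall e, 0 < e -> exists v V c, [/\ minor_pair a b f v V, point_value V b c & I - e < c]).

Lemma minor_le_major a b f u U v V cu cv : a <= b -> major_pair a b f u U ->
  minor_pair a b f v V -> point_value U b cu -> point_value V b cv -> cv <= cu.
Proof.
move=> ab mju mnv Ub Vb; have [| p [k [_ _ p0 pI _]]] := pair_gap ab mju mnv Ub Vb.
  by apply: aeW.
by rewrite -subr_ge0 -lee_fin; apply: le_trans pI; apply: integral_ge0.
Qed.

Lemma has_integralP a b f : a <= b -> dist_integrable a b f <-> exists I, has_integral a b f I.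
Proof.
move=> ab; split=> [[[_ [c0 [u0 [U0 [m0 v0]]] _]] [_ [d0 [w0 [W0 [n0 z0]]] _]] supinf]|].
  have s1 : (d0%:E <= ereal_sup (minor_values a b f))%E.
    by apply: ereal_sup_ubound; exists d0 => //; exists w0, W0.
  have s2 : (ereal_inf (major_values a b f) <= c0%:E)%E.
    by apply: ereal_inf_lbound; exists c0 => //; exists u0, U0.
  have sfin : ereal_sup (minor_values a b f) \is a fin_num.
    apply: fin_real; rewrite (lt_le_trans (ltNyr d0) s1) supinf.
    exact: le_lt_trans s2 (ltry _).
  exists (fine (ereal_sup (minor_values a b f))); split=> e e0.
  - have : (ereal_inf (major_values a b f) < (fine (ereal_sup (minor_values a b f)) + e)%:E)%E.
      by rewrite -supinf EFinD fineK// lteDl// lte_fin.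
    move=> /ereal_inf_lt[_ [c [u [U [mU Ub]]] <-]]; rewrite lte_fin => cI.
    by exists u, U, c.
  - have : ((fine (ereal_sup (minor_values a b f)) - e)%:E < ereal_sup (minor_values a b f))%E.
      by rewrite EFinB fineK// lteBlDr// lteDl// lte_fin.
    move=> /ereal_sup_gt[_ [c [u [U [mU Ub]]] <-]]; rewrite lte_fin => cI.
    by exists u, U, c.
move=> [I [Iu Iv]]; split.
- by have [u [U [c [mU Ub _]]]] := Iu 1 ltr01; exists c%:E, c => //; exists u, U.
- by have [u [U [c [mU Ub _]]]] := Iv 1 ltr01; exists c%:E, c => //; exists u, U.
- apply/eqP; rewrite eq_le; apply/andP; split.
    apply: ge_ereal_sup => _ [d [v [V [mV Vb]]] <-].
    apply: le_ereal_inf_tmp => _ [c [u [U [mU Ub]]] <-].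
    by rewrite lee_fin; exact: minor_le_major mU mV Ub Vb.
  apply: (@le_trans _ _ I%:E).
    apply/lee_addgt0Pr => e e0; have [u [U [c [mU Ub cI]]]] := Iu e e0.
    apply: (@le_trans _ _ c%:E); last by rewrite -EFinD lee_fin ltW.
    by apply: ereal_inf_lbound; exists c => //; exists u, U.
  apply/lee_addgt0Pr => e e0; have [u [U [c [mU Ub cI]]]] := Iv e e0.
  apply: (@le_trans _ _ (c + e)%:E); first by rewrite lee_fin; lra.
  rewrite EFinD leeD2r//.
  by apply: ereal_sup_ubound; exists c => //; exists u, U.
Qed.

Lemma has_integral_sup a b f I : a <= b -> has_integral a b f I ->
  dist_integrable a b f /\ ereal_sup (minor_values a b f) = I%:E.
Proof.
move=> ab fI; split; first by apply/has_integralP => //; exists I.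
have [Iu Iv] := fI; apply/eqP; rewrite eq_le; apply/andP; split.
  apply: ge_ereal_sup => _ [d [v [V [mV Vb]]] <-].
  apply/lee_addgt0Pr => e e0; have [u [U [c [mU Ub cI]]]] := Iu e e0.
  by rewrite -EFinD lee_fin; apply: le_trans (ltW cI); exact: minor_le_major mU mV Ub Vb.
apply/lee_addgt0Pr => e e0; have [u [U [c [mU Ub cI]]]] := Iv e e0.
apply: (@le_trans _ _ (c + e)%:E); first by rewrite lee_fin; lra.
rewrite EFinD leeD2r//.
by apply: ereal_sup_ubound; exists c => //; exists u, U.
Qed.

Lemma has_integral_gap a b f g I J e : a <= b -> has_integral a b f I ->
  has_integral a b g J -> {ae mu, forall x, `[a, b]%classic x -> (f x <= g x)%E} -> 0 < e ->
  exists p k, [/\ measurable_fun setT p, measurable_fun setT k, forall x, (0 <= p x)%E,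
    (\int[mu]_(x in `[a, b]) p x <= (J - I + e)%:E)%E &
    {ae mu, forall x, `[a, b]%classic x ->
      [/\ (p x < +oo)%E, f x \is a fin_num, g x \is a fin_num, (g x <= k x)%E &
          (k x <= f x + p x)%E]}].
Proof.
move=> ab [_ Iv] [Ju _] fg e0; have e2 : 0 < e / 2 by rewrite divr_gt0.
have [u [U [c [mU Ub cJ]]]] := Ju _ e2; have [v [V [d [mV Vb dI]]]] := Iv _ e2.
have [p [k [h1 h2 h3 h4 h5]]] := pair_gap ab mU mV Ub Vb fg.
exists p, k; split=> //; apply: le_trans h4 _; rewrite lee_fin; lra.
Qed.

(** The gap of h with itself is arbitrarily small in L^1. The infimum of the functions k lies
    between h and h plus the infimum of the functions p, and the latter vanishes almost
    everywhere. *)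
Lemma has_integral_measurable a b h I : a <= b -> has_integral a b h I ->
  exists2 h' : R -> R, measurable_fun setT h' &
    {ae mu, forall x, `[a, b]%classic x -> h x = (h' x)%:E}.
Proof.
move=> ab hI; have mab := @measurable_itv R `[a, b].
have H n : exists p k, [/\ measurable_fun setT p, measurable_fun setT k,
    forall x, (0 <= p x)%E, (\int[mu]_(x in `[a, b]) p x <= (n.+1%:R^-1)%:E)%E &
    {ae mu, forall x, `[a, b]%classic x ->
      [/\ (p x < +oo)%E, h x \is a fin_num, h x \is a fin_num, (h x <= k x)%E &
          (k x <= h x + p x)%E]}].
  have n0 : 0 < n.+1%:R^-1 :> R by rewrite invr_gt0.
  have [|p [k [h1 h2 h3 h4 h5]]] := has_integral_gap ab hI hI _ n0; first by apply: aeW.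
  by exists p, k; split=> //; apply: le_trans h4 _; rewrite subrr add0r.
have /choice[p /choice[k H']] : forall n, exists p k, _ := H.
pose P x := einfs (p^~ x) 0; pose K x := einfs (k^~ x) 0.
have mP : measurable_fun setT P by apply: measurable_fun_einfs => n; have [] := H' n.
have mK : measurable_fun setT K by apply: measurable_fun_einfs => n; have [] := H' n.
have P0 x : (0 <= P x)%E.
  by apply: le_ereal_inf_tmp => _ [n _ <-]; have [_ _ p0 _ _] := H' n.
have PI : (\int[mu]_(x in `[a, b]) P x = 0)%E.
  apply/eqP; rewrite eq_le integral_ge0// andbT.
  apply/lee_addgt0Pr => e e0; rewrite add0e.
  pose n := Num.truncn e^-1; have [mp _ p0 pI _] := H' n.
  apply: (@le_trans _ _ (n.+1%:R^-1)%:E).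
    apply: le_trans pI; apply: ge0_le_integral => //; try exact: measurable_funTS.
    by move=> x _; apply: ereal_inf_lbound; exists n.
  rewrite lee_fin invf_ple ?posrE//; exact: ltW (truncnS_gt _).
have aeP : ae_eq mu `[a, b]%classic P (cst 0%E).
  apply/(ae_eq_integral_abs mu mab); first exact: measurable_funTS.
  by under eq_integral do rewrite gee0_abs//.
exists (fine \o K).
  exact: measurableT_comp.
have aeH := ae_forall (fun n => let: And5 _ _ _ _ x := H' n in x).
apply: ae_imp2 aeP aeH _ => x Px Hx xab.
have [_ hfin _ _ _] := Hx 0 xab.
suff hK : h x = K x by rewrite /= -hK fineK.
apply/eqP; rewrite eq_le; apply/andP; split.
  by apply: le_ereal_inf_tmp => _ [n _ <-]; have [] := Hx n xab.
rewrite -[leRHS]adde0 -leeBlDl// -[leRHS](Px xab).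
apply: le_ereal_inf_tmp => _ [n _ <-]; rewrite leeBlDl//.
have [_ _ _ _] := Hx n xab; apply: le_trans.
by apply: ereal_inf_lbound; exists n.
Qed.

(** The majorant p depends on e but the positive part of g' - f' does not, so e may tend to 0. *)
Lemma has_integral_le a b f g (f' g' : R -> R) I J : a <= b -> has_integral a b f I ->
  has_integral a b g J -> {ae mu, forall x, `[a, b]%classic x -> (f x <= g x)%E} ->
  measurable_fun setT f' -> measurable_fun setT g' ->
  {ae mu, forall x, `[a, b]%classic x -> f x = (f' x)%:E} ->
  {ae mu, forall x, `[a, b]%classic x -> g x = (g' x)%:E} ->
  (\int[mu]_(x in `[a, b]) (Num.max (g' x - f' x) 0)%:E <= (J - I)%:E)%E.
Proof.
move=> ab fI gJ fg mf mg ff gg; have mab := @measurable_itv R `[a, b].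
apply/lee_addgt0Pr => e e0; rewrite -EFinD.
have [p [k [mp _ p0 pI H]]] := has_integral_gap ab fI gJ fg e0.
apply: le_trans pI; apply: ae_ge0_le_integral => //.
- by move=> x _; rewrite lee_fin le_max lexx orbT.
- apply/measurable_EFinP; apply: measurable_funTS; apply: measurable_maxr => //.
  exact: measurable_funB.
- exact: measurable_funTS.
apply: ae_imp2 H (ae_imp2 ff gg (fun x => @conj _ _)) _ => x Hx [fx gx] xab.
have [_ _ _ gk kf] := Hx xab; have := le_trans gk kf.
rewrite (fx xab) (gx xab); have := p0 x; case: (p x) => // [r|_ _]; last exact: leey.
by rewrite -EFinD !lee_fin ge_max => -> ?; rewrite andbT lerBlDl.
Qed.

End Integrable.

(** * Indefinite integrals as distributions *)

Section DerivativeDist.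
Context {R : realType}.
Variable U : schwartz_dist R.

Let lin (c : R) (phi psi : R -> R) : test_function phi -> test_function psi ->
  - U (derive1 (fun x => c * phi x + psi x)) = c * - U (derive1 phi) + - U (derive1 psi).
Proof.
move=> tphi tpsi; have [sphi spsi] := (test_smooth tphi, test_smooth tpsi).
have d := has_derivD (has_derivZ c (smooth_deriv sphi)) (smooth_deriv spsi).
by rewrite (has_deriv_derive1 d) dist_linear; [ring|exact: test_derive1|exact: test_derive1].
Qed.

Let cont (K : set R) : compact K ->
  exists (N : nat) (C : R), forall phi (M : R), test_function phi -> tsupport phi `<=` K ->
    (forall n x, (n <= N)%N -> `|derive1n n phi x| <= M) ->
    `|- U (derive1 phi)| <= C * M.
Proof.
move=> cK; have [N [C H]] := dist_continuous U cK; exists N.+1, C => phi M tphi sphi phiM.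
rewrite normrN; apply: H; first exact: test_derive1.
- apply: subset_trans sphi; apply: tsupport_sub; first exact: closed_closure.
  by move=> x; exact: (@derive1n_out R phi 1).
- by move=> n x nN; rewrite -derive1Sn; exact: phiM.
Qed.

Definition deriv_dist := @SchwartzDist R (fun phi => - U (derive1 phi)) lin cont.

Lemma is_derivative_deriv_dist : is_derivative U deriv_dist.
Proof. by []. Qed.

End DerivativeDist.

Section FunctionDist.
Context {R : realType}.
Variable Q : R -> R.
Hypothesis cQ : continuous Q.
Local Notation mu := lebesgue_measure.

Lemma Rintegral_test_cint phi r : smooth phi -> 0 <= r -> (forall x, r < `|x| -> phi x = 0) ->
  \int[mu]_x (Q x * phi x) = cint (fun x => Q x * phi x) (- r) r.
Proof.
move=> sphi r0 phir; apply: Rintegral_cint; first exact: ctsM cQ (smooth_continuous sphi).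
  lra.
by move=> x xr; rewrite phir ?mulr0// lter_normr; case: xr => ?; apply/orP; [right|left]; lra.
Qed.

Lemma test_radius phi psi : test_function phi -> test_function psi ->
  exists r : R, [/\ 0 <= r, forall x, r < `|x| -> phi x = 0 & forall x, r < `|x| -> psi x = 0].
Proof.
move=> /test_functionP[_ [r1 H1]] /test_functionP[_ [r2 H2]].
exists (Num.max 0 (Num.max r1 r2)); split; first by rewrite le_max lexx.
- by move=> x; rewrite !gt_max => /and3P[_ ? _]; exact: H1.
- by move=> x; rewrite !gt_max => /and3P[_ _ ?]; exact: H2.
Qed.

Let lin (c : R) phi psi : test_function phi -> test_function psi ->
  \int[mu]_x (Q x * (c * phi x + psi x)) =
  c * (\int[mu]_x (Q x * phi x)) + \int[mu]_x (Q x * psi x) :> R.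
Proof.
move=> tphi tpsi; have [r [r0 phir psir]] := test_radius tphi tpsi.
have [sphi spsi] := (test_smooth tphi, test_smooth tpsi).
have [cphi cpsi] := (smooth_continuous sphi, smooth_continuous spsi).
rewrite (Rintegral_test_cint sphi r0 phir) (Rintegral_test_cint spsi r0 psir).
have slin := smoothD (@smoothZ R c phi sphi) spsi.
have vlin x : r < `|x| -> c * phi x + psi x = 0.
  by move=> rx; rewrite phir// psir// mulr0 addr0.
rewrite (Rintegral_test_cint slin r0 vlin).
rewrite -cintZ; last exact: ctsM.
rewrite -cintD; [|by apply: ctsZ; exact: ctsM|exact: ctsM].
by congr (cint _ _ _); apply/funext => x; ring.
Qed.

Let cont (K : set R) : compact K ->
  exists (N : nat) (C : R), forall phi (M : R), test_function phi -> tsupport phi `<=` K ->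
    (forall n x, (n <= N)%N -> `|derive1n n phi x| <= M) ->
    `|\int[mu]_x (Q x * phi x)| <= C * M.
Proof.
move=> /compact_bounded[r0 [_ rP]]; pose r := Num.max 0 (r0 + 1).
have r_ge0 : 0 <= r by rewrite le_max lexx.
have [B BP] := continuous_bounded r cQ.
exists 0, (B * (r - - r)) => phi M tphi sphi phiM.
have rK x : r < `|x| -> phi x = 0.
  move=> rx; apply: tsupport_out => /sphi Kx.
  have : `|x| <= r0 + 1 by apply: (rP (r0 + 1)) => //; rewrite ltrDl.
  by rewrite leNgt (le_lt_trans _ rx)// le_max lexx orbT.
have cphi := smooth_continuous (test_smooth tphi).
rewrite (Rintegral_test_cint (test_smooth tphi) r_ge0 rK) mulrAC.
apply: cint_norm_le; [exact: ctsM|lra|].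
move=> x x1 x2; rewrite normrM; apply: ler_pM => //; last exact: (phiM 0%N).
by apply: BP; rewrite ler_norml x1.
Qed.

Definition fun_dist := @SchwartzDist R (fun phi => \int[mu]_x (Q x * phi x)) lin cont.

Lemma point_value_fun_dist x : point_value fun_dist x (Q x).
Proof.
move=> phi tphi; have [r [r0 phir _]] := test_radius tphi tphi.
have sphi := test_smooth tphi; have cphi := smooth_continuous sphi.
pose F e := cint (fun y => Q (e * y + x) * phi y) (- r) r.
have cF (e : R) : continuous (fun y : R => Q (e * y + x) * phi y).
  by apply: ctsM cphi; exact: cts_affine.
(* The substitution y -> e y + x holds for both signs: if e < 0 the bounds are exchanged and |e|
   accounts for the sign. *)
have FE e : e != 0 -> `|e|^-1 * fun_dist (rescale x e phi) = F e.
  move=> e0; rewrite /=.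
  have cr : continuous (rescale x e phi).
    by rewrite rescale_affine; exact: cts_affine.
  have cQr : continuous (fun y => Q y * rescale x e phi y) by exact: ctsM.
  rewrite (@Rintegral_cint R _ (x - r * `|e|) (x + r * `|e|)); last 3 first.
  - exact: cQr.
  - by have := mulr_ge0 r0 (normr_ge0 e); lra.
  - move=> y yx; rewrite /rescale phir ?mulr0// normrM normfV ltr_pdivlMr ?normr_gt0//.
    by rewrite lter_normr; case: yx => ?; apply/orP; [right|left]; lra.

  have key c d : cint (fun y => Q y * rescale x e phi y) (e * c + x) (e * d + x) =
      e * cint (fun y => Q (e * y + x) * phi y) c d.
    rewrite (cint_affine _ _ _ _ cQr); congr (_ * cint _ _ _); apply/funext => y.
    by rewrite /rescale addrK mulrAC divff// mul1r.
  rewrite /F; have [e_lt0|e_gt0|e00] := ltgtP e 0; last by rewrite e00 eqxx in e0.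
  - have := key r (- r); have -> : e * r + x = x - r * `|e| by rewrite ltr0_norm//; ring.
    have -> : e * - r + x = x + r * `|e| by rewrite ltr0_norm//; ring.
    move=> ->; rewrite [cint _ r (- r)]cint_swap ltr0_norm//.
    by field; rewrite e0.
  - have := key (- r) r; have -> : e * - r + x = x - r * `|e| by rewrite gtr0_norm//; ring.
    have -> : e * r + x = x + r * `|e| by rewrite gtr0_norm//; ring.
    by move=> ->; rewrite gtr0_norm// mulrA mulVf// mul1r.
have -> : \int[mu]_y phi y = cint phi (- r) r.
  rewrite (@Rintegral_cint R _ (- r) r)//; first lra.
  by move=> y yr; apply: phir; rewrite lter_normr; case: yr => ?; apply/orP; [right|left]; lra.
have [B BP] := continuous_bounded r cphi.
have B0 : 0 <= B.
  by apply: le_trans (normr_ge0 (phi 0)) (BP 0 _); rewrite normr0.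
apply/cvgrPdist_le => eps eps0.
pose k := eps / (B * (2 * r) + 1).
have den0 : 0 < B * (2 * r) + 1 by apply: ltr_wpDl => //; rewrite !mulr_ge0.
have k0 : 0 < k by rewrite divr_gt0.
have /cvgrPdist_le/(_ _ k0)/nbhs_ballP[d /= d0 dP] := @cQ x.
rewrite near_withinE; apply/nbhs_ballP; exists (d / (r + 1)) => /=.
  by rewrite divr_gt0//; lra.
move=> e; rewrite /ball/= sub0r normrN ltr_pdivlMr; last by lra.
move=> ed e0; rewrite (FE e e0) -cintZ// /F -cintB//; last exact: ctsZ.
apply: (@le_trans _ _ (k * B * (r - - r))).
  apply: cint_norm_le; [by apply: ctsB => //; exact: ctsZ|lra|].
  move=> y y1 y2; rewrite -mulrBl normrM ler_pM//; last by apply: BP; rewrite ler_norml y1.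
  apply: dP; rewrite /ball/= opprD addrCA subrr addr0 normrN normrM.
  apply: le_lt_trans ed; rewrite ler_wpM2l//.
  by apply: (@le_trans _ _ r); [rewrite ler_norml y1|lra].
rewrite opprK -mulr2n -[r *+ 2]mulr_natl -mulrA /k mulrAC ler_pdivrMr// mulrDr mulr1.
by rewrite lerDl ltW.
Qed.

Lemma lojasiewicz_fun_dist : lojasiewicz fun_dist.
Proof. by move=> x; exists (Q x); exact: point_value_fun_dist. Qed.

End FunctionDist.

(** * The derivative of a continuous function as a Stieltjes integral *)

Section StieltjesPairing.
Context {R : realType}.
Variables (Q : R -> R) (a b : R).
Hypothesis ab : a <= b.
Hypothesis cQ : continuous Q.
Hypothesis Qlow : forall x, x <= a -> Q x = Q a.
Hypothesis Qhigh : forall x, b <= x -> Q x = Q b.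

Let u := deriv_dist (fun_dist cQ).

(** The integral of theta dP over [a, b] after integration by parts. The constant k is free; it
    serves to centre P at the point under study. *)
Definition stieltjes (P : R -> R) k theta :=
  - cint (fun z => (P z - k) * derive1 theta z) a b + (k - P a) * theta a + (P b - k) * theta b.

Let cts_part k theta : smooth theta -> continuous (fun z => (Q z - k) * derive1 theta z).
Proof.
move=> st; apply: ctsM (smooth_continuous (smooth_derive1 st)).
exact: ctsB cQ (@cts_cst R k).
Qed.

Lemma deriv_fun_dist_stieltjes k theta : test_function theta -> u theta = stieltjes Q k theta.
Proof.
move=> tth; have [sth [r0 thr0]] := (test_functionP theta).1 tth.
pose r := Num.max (r0 + 1) (`|a| + `|b|).
have rr0 : r0 < r by rewrite lt_max ltrDl ltr01.
have rab : `|a| + `|b| <= r by rewrite le_max lexx orbT.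
have r_ge0 : 0 <= r by apply: le_trans rab; exact: addr_ge0.
have [ra br] : - r <= a /\ b <= r.
  have := ler_norm b; have := ler_norm (- a); rewrite normrN.
  by have := normr_ge0 a; have := normr_ge0 b => *; split; lra.
have dth := smooth_deriv sth; have sth' := smooth_derive1 sth.
have cth' := smooth_continuous sth'.
have th'r x : r < `|x| -> derive1 theta x = 0.
  move=> rx; rewrite -derive1n1; apply: (derive1n_vanish 1 _ (lt_trans rr0 rx)) => y.
  exact: thr0.
have thr : theta r = 0 by apply: thr0; rewrite ger0_norm.
have thNr : theta (- r) = 0 by apply: thr0; rewrite normrN ger0_norm.
rewrite /u /= (Rintegral_test_cint cQ sth' r_ge0 th'r).
have -> : cint (fun x => Q x * derive1 theta x) (- r) r =
    cint (fun z => (Q z - k) * derive1 theta z) (- r) r.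
  have -> : cint (fun x => Q x * derive1 theta x) (- r) r =
      cint (fun x => (Q x - k) * derive1 theta x + k * derive1 theta x) (- r) r.
    by congr (cint _ _ _); apply/funext => x; ring.
  rewrite cintD; [|exact: cts_part|exact: ctsZ].
  by rewrite cintZ// (cint_deriv _ _ cth' dth) thr thNr subrr mulr0 addr0.
rewrite (cint_split _ _ _ a) (cint_split _ a r b).
have -> : cint (fun z => (Q z - k) * derive1 theta z) (- r) a = (Q a - k) * theta a.
  rewrite (@eq_cint R _ (fun z => (Q a - k) * derive1 theta z) _ _ (cts_part sth) _ ra).
  - by rewrite cintZ// (cint_deriv _ _ cth' dth) thNr subr0.
  - by apply: (@ctsZ R).
  - by move=> z _ za; rewrite Qlow.
have -> : cint (fun z => (Q z - k) * derive1 theta z) b r = - (Q b - k) * theta b.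
  rewrite (@eq_cint R _ (fun z => (Q b - k) * derive1 theta z) _ _ (cts_part sth) _ br).
  - by rewrite cintZ// (cint_deriv _ _ cth' dth) thr sub0r mulrN mulNr.
  - by apply: (@ctsZ R).
  - by move=> z bz _; rewrite Qhigh.
by rewrite /stieltjes; ring.
Qed.

Lemma supported_deriv_fun_dist : supported_in `[a, b]%classic u.
Proof.
move=> theta tth th0; rewrite (deriv_fun_dist_stieltjes 0 tth).
have out x : `[a, b]%classic x -> ~ tsupport theta x.
  by move=> xab sx; have : (tsupport theta `&` `[a, b]%classic) x by []; rewrite th0.
have zab z : a <= z -> z <= b -> `[a, b]%classic z by move=> z1 z2; rewrite /= in_itv/= z1.
rewrite /stieltjes (tsupport_out (out a (zab _ (lexx a) ab))).
rewrite (tsupport_out (out b (zab _ ab (lexx b)))) !mulr0 !addr0.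
rewrite (@eq_cint R _ (fun=> 0) _ _ (cts_part (test_smooth tth)) (@cts_cst R 0) ab).
  by rewrite cint_cst mul0r oppr0.
by move=> z az zb; rewrite -derive1n1 (@derive1n_out R theta 1 z (out z (zab z az zb))) mulr0.
Qed.

Lemma pairing_stieltjes k psi : smooth psi -> pairing u psi = stieltjes Q k psi.
Proof.
move=> spsi; rewrite (pairing_box supported_deriv_fun_dist spsi).
have tb : test_function (box_plateau a b) by exact: test_plateau.
rewrite (deriv_fun_dist_stieltjes k (testM tb spsi)) /stieltjes.
have b1 y : a - 1 <= y -> y <= b + 1 -> box_plateau a b y = 1 by exact: box_plateau1.
have ba1 : box_plateau a b a = 1 by apply: b1; [rewrite gerBl|exact: ler_wpDr ab].
have bb1 : box_plateau a b b = 1 by apply: b1; [rewrite lerBlDr; exact: ler_wpDr ab|rewrite lerDl].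
have sbp := test_smooth (testM tb spsi).
rewrite ba1 bb1 !mul1r.
suff -> : cint (fun z => (Q z - k) * derive1 (fun y => box_plateau a b y * psi y) z) a b =
          cint (fun z => (Q z - k) * derive1 psi z) a b by [].
apply: (eq_cint (cts_part sbp) (cts_part spsi) ab) => z az zb.
suff -> : derive1 (fun y => box_plateau a b y * psi y) z = derive1 psi z by [].
rewrite !derive1E; apply: near_eq_derive.
have az1 : a - 1 < z by rewrite ltrBlDr; exact: ltr_pwDr az.
have zb1 : z < b + 1 by exact: ltr_pwDr zb.
by near=> y; rewrite b1 ?mul1r//; apply: ltW; near: y; [exact: lt_nbhsr|exact: lt_nbhsl].
Unshelve. all: by end_near. Qed.

End StieltjesPairing.

(** * Moments of functions with power decay *)

Section Decay.
Context {R : realType}.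
Implicit Types (f g r : R -> R) (be e y : R).

Lemma powR_neg_small be e : be < 0 -> 0 < e ->
  exists2 M, 0 < M & forall y, M <= y -> y `^ be <= e.
Proof.
move=> be0 e0; exists (e `^ be^-1); first exact: powR_gt0.
move=> y ye; have y0 : 0 < y by apply: lt_le_trans ye; exact: powR_gt0.
have ee : e = ((e `^ be^-1) `^ - be)^-1.
  by rewrite -powRN opprK -powRrM mulVf ?lt_eqF// powRr1// ltW.
have -> : y `^ be = (y `^ - be)^-1 by rewrite -powRN opprK.
rewrite [leRHS]ee lef_pV2 ?posrE ?powR_gt0//.
by apply: ge0_ler_powR; rewrite ?nnegrE ?oppr_ge0 ?powR_ge0// ltW.
Qed.

Lemma cint_mono_itv f c d d' : continuous f -> d <= d' ->
  (forall y, 0 <= f y) -> cint f c d <= cint f c d'.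
Proof.
move=> cf dd f0; rewrite [leRHS](cint_split _ _ _ d) lerDl.
by apply: cint_ge0.
Qed.

Variables (f f' : R -> R) (al C A : R).
Hypothesis cf' : continuous f'.
Hypothesis al1 : al < -1.
Hypothesis fC : forall y, A < y -> `|f y| <= C * y `^ al.
Hypothesis f'C : forall y, A < y -> `|f' y| <= C * y `^ (al - 1).

Let m y := `|y| * `|f' y|.

Let cm : continuous m.
Proof.
have cn : continuous (fun y : R => `|y|) by exact: norm_continuous.
by apply: ctsM cn _ => y; exact: (continuous_comp (@cf' y) (@norm_continuous _ _ _)).
Qed.

Let m_ge0 y : 0 <= m y. Proof. exact: mulr_ge0. Qed.

Let powR_mul y be : 0 < y -> y * y `^ (be - 1) = y `^ be.
Proof.
move=> y0; rewrite -{1}[y]powRr1 ?(ltW y0)// -powRD; first by congr (_ `^ _); ring.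
by apply/implyP => _; rewrite gt_eqF.
Qed.

Let C_ge0 : 0 <= C.
Proof.
have h : A < `|A| + 1 by rewrite (le_lt_trans (ler_norm A))// ltrDl.
by have := le_trans (normr_ge0 _) (fC h); rewrite pmulr_lge0// powR_gt0.
Qed.

(** As |f' y| is O(y^(al-1)), m is dominated by C y^al, the derivative of - ka y^(al+1); since al +
    1 < 0, this primitive tends to 0 at infinity. *)
Lemma decay_tail e : 0 < e -> exists2 M, 0 < M & forall Y, M <= Y ->
  cint m M Y <= e /\ Y * `|f Y| <= e.
Proof.
move=> e0; pose be := al + 1; have be0 : be < 0 by rewrite /be -ltrBrDr sub0r.
pose ka := C / - be; have ka0 : 0 <= ka by rewrite divr_ge0// oppr_ge0 ltW.
have kc0 : 0 < ka + C + 1 by rewrite ltr_wpDl// addr_ge0// C_ge0.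
have [M M0 MP] := powR_neg_small be0 (divr_gt0 e0 kc0).
have small k y : 0 <= k -> k <= ka + C -> M <= y -> k * y `^ be <= e.
  move=> k0 kk My; apply: (@le_trans _ _ ((ka + C + 1) * (e / (ka + C + 1)))).
    by apply: ler_pM; rewrite ?powR_ge0//; [lra|exact: MP].
  by rewrite mulrC divfK// gt_eqF.
pose M' := Num.max M (`|A| + 1).
have MM' : M <= M' by rewrite le_max lexx.
have AM' : A < M'.
  by rewrite (le_lt_trans (ler_norm A))// lt_max ltrDl ltr01 orbT.
exists M'; first exact: lt_le_trans M0 MM'.
move=> Y M'Y; have Y0 : 0 < Y by rewrite (lt_le_trans M0)// (le_trans MM').
split; last first.
  apply: (@le_trans _ _ (C * Y `^ be)); last first.
    by apply: small; [exact: C_ge0|lra|exact: le_trans MM' M'Y].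
  rewrite -(powR_mul be Y0) /be addrK mulrCA ler_pM2l//.
  exact: fC (lt_le_trans AM' M'Y).
pose F y := - ka * y `^ be - primitive m y.
have dF y : 0 < y -> is_derive y 1 F (- ka * (be * y `^ (be - 1)) - m y).
  move=> y0; have := is_derive1_powR be y0; have := primitive_deriv cm y.
  by move=> d1 d2; rewrite /F; apply: is_deriveB.
have M'0 : 0 < M' by exact: lt_le_trans M0 MM'.
have : F M' <= F Y.
  apply: (@ger0_derive1_ndecr R F M' Y _ _ _ M' Y (lexx M') M'Y (lexx Y)).
  - move=> y; rewrite in_itv/= => /andP[y1 _].
    by have [] := dF y (lt_trans M'0 y1).
  - move=> y; rewrite in_itv/= => /andP[y1 _]; have y0 := lt_trans M'0 y1.
    rewrite derive1E; have [_ ->] := dF y y0.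
    have -> : - ka * (be * y `^ (be - 1)) = C * y `^ al.
      rewrite mulrA; have -> : - ka * be = C.
        by rewrite /ka invrN mulrN opprK divfK// lt_eqF.
      by rewrite /be addrK.
    rewrite subr_ge0 /m gtr0_norm// -(powR_mul al y0) mulrCA ler_pM2l//.
    exact: f'C (lt_trans AM' y1).
  - apply: derivable_within_continuous => y; rewrite in_itv/= => /andP[y1 _].
    by have [] := dF y (lt_le_trans M'0 y1).
rewrite /F /cint => h.
have h1 : ka * M' `^ be <= e by apply: small => //; have := C_ge0; lra.
have h2 : 0 <= ka * Y `^ be by rewrite mulr_ge0// powR_ge0.
by move: h; rewrite !mulNr; lra.
Qed.

Lemma decay_moment : exists2 K, 0 <= K & forall Y, 0 <= Y -> cint m 0 Y <= K.
Proof.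
have [M M0 MP] := decay_tail ltr01.
have c0 : 0 <= cint m 0 M by apply: cint_ge0 => //; exact: ltW.
exists (cint m 0 M + 1); first by lra.
move=> Y Y0; have [YM|/ltW MY] := leP Y M.
  by have := cint_mono_itv 0 cm YM m_ge0; lra.
by rewrite (cint_split _ _ _ M); have [] := MP Y MY; lra.
Qed.

Lemma decay_half : exists2 K, 0 <= K & forall e, 0 < e -> exists2 M, 0 < M &
  forall r C1 e1 Y, continuous r -> 0 <= C1 -> M <= Y ->
    (forall y, 0 <= y -> y <= Y -> `|r y| <= C1 * y) ->
    (forall y, 0 <= y -> y <= M -> `|r y| <= e1 * y) ->
    `|- cint (fun y => r y * f' y) 0 Y + r Y * f Y| <= e1 * K + C1 * e.
Proof.
have [K K0 KP] := decay_moment; exists K => // e e0.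
have e2 : 0 < e / 2 by rewrite divr_gt0.
have [M M0 MP] := decay_tail e2; exists M => // r C1 e1 Y cr C10 MY rC re.
have Y0 : 0 < Y by exact: lt_le_trans M0 MY.
have e10 : 0 <= e1.
  by have := le_trans (normr_ge0 _) (re M (ltW M0) (lexx M)); rewrite pmulr_lge0.
have cg : continuous (fun y => r y * f' y) by exact: ctsM.
have nle k c d : 0 <= k -> 0 <= c -> c <= d -> (forall y, c <= y -> y <= d -> `|r y| <= k * y) ->
    `|cint (fun y => r y * f' y) c d| <= k * cint m c d.
  move=> k0 c0 cd rk; have ckm : continuous (fun y => k * m y) by exact: ctsZ.
  have pw y : c <= y -> y <= d -> `|r y * f' y| <= k * m y.
    move=> y1 y2; rewrite normrM /m mulrA ler_wpM2r// (ger0_norm (le_trans c0 y1)).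
    exact: rk.
  rewrite -cintZ// ler_norml; apply/andP; split.
    rewrite lerNl -[leLHS]mulN1r -cintZ//; apply: cint_le => //; first exact: ctsZ.
    by move=> y y1 y2; rewrite mulN1r (le_trans (ler_norm _))// normrN pw.
  by apply: cint_le => // y y1 y2; rewrite (le_trans (ler_norm _))// pw.
have [t1 t2] := MP Y MY.
have h1 : `|cint (fun y => r y * f' y) 0 M| <= e1 * K.
  apply: (@le_trans _ _ (e1 * cint m 0 M)); first by apply: nle => //; exact: ltW.
  by rewrite ler_wpM2l// KP// ltW.
have h2 : `|cint (fun y => r y * f' y) M Y| <= C1 * (e / 2).
  apply: (@le_trans _ _ (C1 * cint m M Y)); last by rewrite ler_wpM2l.
  apply: nle => //; first exact: ltW.
  by move=> y y1 y2; apply: rC => //; apply: le_trans y1; exact: ltW.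
have h3 : `|r Y * f Y| <= C1 * (e / 2).
  apply: (@le_trans _ _ (C1 * (Y * `|f Y|))); last by rewrite ler_wpM2l.
  by rewrite normrM mulrA ler_wpM2r// rC// ltW.
rewrite (cint_split _ _ _ M); apply: le_trans (ler_normD _ _) _; rewrite normrN.
have := ler_normD (cint (fun y => r y * f' y) 0 M) (cint (fun y => r y * f' y) M Y).
have -> : C1 * e = C1 * (e / 2) + C1 * (e / 2) by field.
by move: h1 h2 h3; lra.
Qed.

End Decay.

Section TestClass.
Context {R : realType}.
Implicit Types (phi : R -> R) (c d e t x s : R).
Local Notation mu := lebesgue_measure.

Let cint_ereal phi c d : continuous phi -> c <= d ->
  (cint phi c d)%:E = (\int[mu]_(y in `[c, d]) (phi y)%:E)%E.
Proof.
move=> cphi cd; rewrite cint_rint// /Rintegral fineK//.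
apply: integrable_fin_num; first exact: measurable_itv.
exact: continuous_integrable.
Qed.

Let measurable_phi phi (D : set R) : continuous phi -> measurable_fun D (EFin \o phi).
Proof.
by move=> cphi; apply/measurable_EFinP; apply: measurable_funTS; exact: continuous_measurable_fun.
Qed.

Lemma T0_cint_le1 phi c d : T0 phi -> c <= d -> cint phi c d <= 1.
Proof.
move=> [sphi phi0 phi1 _] cd; have cphi := smooth_continuous sphi.
rewrite -lee_fin cint_ereal// -phi1.
apply: ge0_subset_integral; [exact: measurable_itv|exact: measurableT| | |exact: subsetT].
- exact: measurable_phi.
- by move=> y _; rewrite lee_fin.
Qed.

Lemma T0_cint_ge phi e : T0 phi -> 0 < e ->
  exists2 M, 0 < M & forall c d, c <= - M -> M <= d -> 1 - e <= cint phi c d.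
Proof.
move=> [sphi phi0 phi1 _] e0; have cphi := smooth_continuous sphi.
pose F n := `[- n.+1%:R, n.+1%:R]%classic : set R.
have FT : \bigcup_n F n = setT.
  apply/seteqP; split=> // y _; exists (Num.truncn `|y|) => //.
  by apply: norm_le_itv; exact: ltW (truncnS_gt _).
have ndF : nondecreasing_seq F.
  move=> m n mn; apply/subsetPset => y; rewrite /F/= !in_itv/= => /andP[y1 y2].
  have mn' : m.+1%:R <= n.+1%:R :> R by rewrite ler_nat.
  by apply/andP; split; lra.
have mF n : measurable (F n) by exact: measurable_itv.
have H : (\int[mu]_(y in F i) (phi y)%:E)%E @[i --> \oo] --> 1%E.
  rewrite -phi1 -FT; apply: ge0_nondecreasing_set_cvg_integral => //.
  by move=> i; exact: measurable_phi.
  by move=> i y _; rewrite lee_fin.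
move: H => /fine_cvgP[_ /cvgrPdist_le/(_ e e0)[N _ /(_ N (leqnn N))]].
rewrite /= -cint_ereal//=; last by have := ler0n R N.+1; lra.
rewrite ler_norml => /andP[_ h].
exists N.+1%:R => // c d cN Nd.
have NN : - N.+1%:R <= N.+1%:R :> R by have := ler0n R N.+1; lra.
have h1 : 0 <= cint phi c (- N.+1%:R) by apply: cint_ge0.
have h2 : 0 <= cint phi N.+1%:R d by apply: cint_ge0.
rewrite (cint_split _ _ _ (- N.+1%:R)) (cint_split _ (- N.+1%:R) d N.+1%:R).
by lra.
Qed.

Lemma T0_reflect_decay phi : T0 phi -> exists al C A, [/\ al < -1,
  forall y, A < `|y| -> `|phi y| <= C * `|y| `^ al &
  forall y, A < `|y| -> `|derive1 phi y| <= C * `|y| `^ (al - 1)].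
Proof.
move=> [_ _ _ [al al1 H]]; have [C0 [A0 H0]] := H 0%N; have [C1 [A1 H1]] := H 1%N.
exists al, (Num.max C0 C1), (Num.max A0 A1); split=> // y; rewrite gt_max => /andP[y0 y1].
- have := H0 y y0; rewrite subr0 => /le_trans; apply.
  by rewrite ler_wpM2r ?powR_ge0// le_max lexx.
- have := H1 y y1; rewrite derive1n1 => /le_trans; apply.
  by rewrite ler_wpM2r ?powR_ge0// le_max lexx orbT.
Qed.

Lemma T0_half phi : T0 phi -> exists2 K, 0 <= K & forall e, 0 < e -> exists2 M, 0 < M &
  forall (r : R -> R) C1 e1 Y, continuous r -> 0 <= C1 -> M <= Y ->
    (forall y, 0 <= y -> y <= Y -> `|r y| <= C1 * y) ->
    (forall y, 0 <= y -> y <= M -> `|r y| <= e1 * y) ->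
    `|- cint (fun y => r y * derive1 phi y) 0 Y + r Y * phi Y| <= e1 * K + C1 * e.
Proof.
move=> T0phi; have [al [C [A [al1 H0 H1]]]] := T0_reflect_decay T0phi.
have [sphi _ _ _] := T0phi.
have cphi' := smooth_continuous (smooth_derive1 sphi).
apply: (@decay_half R phi (derive1 phi) al C (Num.max A 0) cphi' al1).
- by move=> y; rewrite gt_max => /andP[yA y0]; have := H0 y; rewrite gtr0_norm//; exact.
- by move=> y; rewrite gt_max => /andP[yA y0]; have := H1 y; rewrite gtr0_norm//; exact.
Qed.

(** The right half applied to the reflected phi; reflection changes the sign of the derivative,
    hence of the boundary term. *)
Lemma T0_half_left phi : T0 phi -> exists2 K, 0 <= K & forall e, 0 < e -> exists2 M, 0 < M &
  forall (r : R -> R) C1 e1 Y, continuous r -> 0 <= C1 -> M <= Y ->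
    (forall y, - Y <= y -> y <= 0 -> `|r y| <= C1 * - y) ->
    (forall y, - M <= y -> y <= 0 -> `|r y| <= e1 * - y) ->
    `|- cint (fun y => r y * derive1 phi y) (- Y) 0 - r (- Y) * phi (- Y)| <= e1 * K + C1 * e.
Proof.
move=> T0phi; have [al [C [A [al1 H0 H1]]]] := T0_reflect_decay T0phi.
have [sphi _ _ _] := T0phi; have cphi' := smooth_continuous (smooth_derive1 sphi).
have [| | |K K0 KP] := @decay_half R (fun y => phi (-1 * y + 0))
  (fun y => -1 * derive1 phi (-1 * y + 0)) al C (Num.max A 0) _ al1.
- by apply: ctsZ; exact: cts_affine.
- move=> y; rewrite gt_max mulN1r addr0 => /andP[yA y0].
  by have := H0 (- y); rewrite normrN gtr0_norm//; exact.
- move=> y; rewrite gt_max !mulN1r addr0 normrN => /andP[yA y0].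
  by have := H1 (- y); rewrite normrN gtr0_norm//; exact.
exists K => // e e0; have [M M0 MP] := KP e e0; exists M => // r C1 e1 Y cr C10 MY rC re.
have := MP (fun y => r (-1 * y + 0)) C1 e1 Y (cts_affine cr) C10 MY.
have E1 : cint (fun y => r y * derive1 phi y) (- Y) 0 =
    cint (fun y => r (-1 * y + 0) * derive1 phi (-1 * y + 0)) 0 Y.
  have := @cint_affine R (fun y => r y * derive1 phi y) (-1) 0 0 Y (ctsM cr cphi').
  by rewrite mulr0 addr0 mulN1r addr0 mulN1r cint_swap => /oppr_inj.
have E2 : cint (fun y => r (-1 * y + 0) * (-1 * derive1 phi (-1 * y + 0))) 0 Y =
    - cint (fun y => r (-1 * y + 0) * derive1 phi (-1 * y + 0)) 0 Y.
  rewrite -[RHS]mulN1r -cintZ; last by apply: ctsM; exact: cts_affine.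
  by congr (cint _ _ _); apply/funext => y; ring.
rewrite E1 => H.
rewrite -normrN opprD !opprK.
have rE (y : R) : r (-1 * y + 0) = r (- y) by rewrite mulN1r addr0.
have rC' y : 0 <= y -> y <= Y -> `|r (-1 * y + 0)| <= C1 * y.
  move=> y0 yY; rewrite rE -[X in _ * X]opprK; apply: rC; first by rewrite lerN2.
  by rewrite oppr_le0.
have re' y : 0 <= y -> y <= M -> `|r (-1 * y + 0)| <= e1 * y.
  move=> y0 yY; rewrite rE -[X in _ * X]opprK; apply: re; first by rewrite lerN2.
  by rewrite oppr_le0.
by have := H rC' re'; rewrite E2 opprK mulN1r addr0.
Qed.

End TestClass.

Section StieltjesBounds.
Context {R : realType}.
Implicit Types (phi theta P Q : R -> R) (a b c d e t x s k : R).

Let cts_lin s x : continuous (fun z : R => s * (z - x)).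
Proof. by apply: ctsZ; apply: ctsB (@cts_id R) (@cts_cst R x). Qed.

Lemma stieltjes_split a b Q x s theta : continuous Q -> smooth theta ->
  stieltjes a b Q (Q x) theta =
  s * cint theta a b + stieltjes a b (fun z => Q z - Q x - s * (z - x)) 0 theta.
Proof.
move=> cQ sth; have dth := smooth_deriv sth; have cth := smooth_continuous sth.
have cth' := smooth_continuous (smooth_derive1 sth).
have dlin : has_deriv (fun z => s * (z - x)) (fun=> s * (1 - 0)).
  by apply: has_derivZ; apply: has_derivB; [exact: has_deriv_id|exact: has_deriv_cst].
have cR : continuous (fun z => Q z - Q x - s * (z - x)).
  exact: (ctsB (ctsB cQ (@cts_cst R (Q x))) (@cts_lin s x)).
have h := cint_parts a b dlin dth (@cts_cst R _) cth'.
have -> : s * cint theta a b = cint (fun z => s * (1 - 0) * theta z) a b.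
  by rewrite -cintZ// subr0 mulr1.
rewrite /stieltjes.
have -> : cint (fun z => (Q z - Q x) * derive1 theta z) a b =
    cint (fun z => (Q z - Q x - s * (z - x) - 0) * derive1 theta z) a b +
    cint (fun z => s * (z - x) * derive1 theta z) a b.
  rewrite -cintD; [|exact: (ctsM (ctsB cR (@cts_cst R 0)) cth')|exact: (ctsM (@cts_lin s x) cth')].
  by congr (cint _ _ _); apply/funext => z; ring.
by rewrite h; ring.
Qed.

Lemma stieltjesN a b P theta : continuous P -> smooth theta ->
  stieltjes a b (fun z => - P z) 0 theta = - stieltjes a b P 0 theta.
Proof.
move=> cP sth; have cth' := smooth_continuous (smooth_derive1 sth).
rewrite /stieltjes.
have -> : cint (fun z => (- P z - 0) * derive1 theta z) a b =
    -1 * cint (fun z => (P z - 0) * derive1 theta z) a b.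
  rewrite -cintZ; last by apply: ctsM cth'; exact: ctsB cP (@cts_cst R 0).
  by congr (cint _ _ _); apply/funext => z; ring.
by ring.
Qed.

(** Here the monotonicity in [T1] enters: on both sides of x, P and the derivative of the rescaled
    phi have opposite signs. *)
Lemma stieltjes_sign a b P x t phi : a <= x -> x <= b -> continuous P -> P x = 0 ->
  (forall z, a <= z -> z <= x -> P z <= 0) -> (forall z, x <= z -> z <= b -> 0 <= P z) ->
  T1 phi -> 0 < t -> 0 <= stieltjes a b P 0 (rescale x t phi).
Proof.
move=> ax xb cP Px Ple Pge [[sphi phi0 _ _] phi'] t0.
have ab := le_trans ax xb.
have cphi' := smooth_continuous (smooth_derive1 sphi).
have dr := rescale_deriv x t (smooth_deriv sphi).
have cr : continuous (fun z => (P z - 0) * (t^-1 * rescale x t (derive1 phi) z)).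
  apply: ctsM; first by apply: ctsB cP (@cts_cst R 0).
  by apply: (@ctsZ R); rewrite rescale_affine; exact: cts_affine.
rewrite /stieltjes (has_deriv_derive1 dr).
rewrite !addr_ge0//.
- rewrite -[leRHS]mulN1r -cintZ//; apply: cint_ge0 => //; first exact: ctsZ.
  move=> z az zb; rewrite subr0.
  have h := phi' ((z - x) / t).
  have ti : 0 < t^-1 by rewrite invr_gt0.
  rewrite mulN1r oppr_ge0 /rescale mulrCA pmulr_rle0//.
  have [zx|xz|zx] := ltgtP z x.
  + have w0 : (z - x) / t < 0 by rewrite pmulr_llt0// subr_lt0.
    by rewrite mulr_le0_ge0 ?Ple ?(ltW zx)//; move: h; rewrite nmulr_rle0.
  + have w0 : 0 < (z - x) / t by rewrite divr_gt0// subr_gt0.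
    by rewrite mulr_ge0_le0 ?Pge ?(ltW xz)//; move: h; rewrite pmulr_rle0.
  + by rewrite zx Px mul0r.
- by rewrite sub0r; apply: mulr_ge0; [rewrite oppr_ge0 Ple|exact: phi0].
- by rewrite subr0; apply: mulr_ge0; [rewrite Pge|exact: phi0].
Qed.

Lemma stieltjes_ge0 a b Q x t phi : a <= x -> x <= b -> continuous Q ->
  (forall y z, y <= z -> Q y <= Q z) -> T1 phi -> 0 < t ->
  0 <= stieltjes a b Q (Q x) (rescale x t phi).
Proof.
move=> ax xb cQ ndQ T1phi t0; have [[sphi _ _ _] _] := T1phi.
rewrite (stieltjes_split _ _ x 0 cQ (@smooth_rescale R x t phi sphi)) mul0r add0r.
apply: (stieltjes_sign ax xb) => //.
- exact: (ctsB (ctsB cQ (@cts_cst R (Q x))) (@cts_lin 0 x)).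
- by rewrite !subrr mulr0 subr0.
- by move=> z _ zx; rewrite mul0r subr0 subr_le0 ndQ.
- by move=> z xz _; rewrite mul0r subr0 subr_ge0 ndQ.
Qed.

Lemma cint_rescale phi a b x t : continuous phi -> 0 < t ->
  cint (rescale x t phi) a b = t * cint phi ((a - x) / t) ((b - x) / t).
Proof.
move=> cphi t0; have tN0 : t != 0 by rewrite gt_eqF.
have := @cint_affine R (rescale x t phi) t x ((a - x) / t) ((b - x) / t).
rewrite ![t * (_ / t)]mulrC !divfK// !subrK => ->.
  by congr (_ * cint _ _ _); apply/funext => y; rewrite /rescale addrK mulrC mulKf.
by rewrite rescale_affine; exact: cts_affine.
Qed.

(** The line of slope N at x contributes at most N, and N (z - x) minus the increment of Q has the
    sign of z - x. *)
Lemma stieltjes_le a b Q x t phi N : a <= x -> x <= b -> continuous Q -> 0 <= N ->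
  (forall y z, y <= z -> Q z - Q y <= N * (z - y)) -> T1 phi -> 0 < t ->
  t^-1 * stieltjes a b Q (Q x) (rescale x t phi) <= N.
Proof.
move=> ax xb cQ N0 lQ T1phi t0; have [T0phi _] := T1phi; have [sphi _ _ _] := T0phi.
have cphi := smooth_continuous sphi; have srs := @smooth_rescale R x t phi sphi.
have cR : continuous (fun z => Q z - Q x - N * (z - x)).
  exact: (ctsB (ctsB cQ (@cts_cst R (Q x))) (@cts_lin N x)).
rewrite ler_pdivrMl// (stieltjes_split _ _ x N cQ srs).
have h1 : cint (rescale x t phi) a b <= t.
  rewrite (cint_rescale _ _ _ cphi t0) ler_piMr ?(ltW t0)//; apply: T0_cint_le1 => //.
  by rewrite ler_pM2r ?invr_gt0//; lra.
have h2 : stieltjes a b (fun z => Q z - Q x - N * (z - x)) 0 (rescale x t phi) <= 0.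
  rewrite -oppr_ge0 -stieltjesN//; apply: (stieltjes_sign ax xb) => //.
  - exact: ctsN.
  - by rewrite !subrr mulr0 subr0 oppr0.
  - move=> z _ zx; have := lQ z x zx; rewrite oppr_le0 => ?; lra.
  - by move=> z xz _; have := lQ x z xz; rewrite oppr_ge0 => ?; lra.
have := ler_wpM2l N0 h1; rewrite [N * t]mulrC; lra.
Qed.

End StieltjesBounds.

Section StieltjesLimit.
Context {R : realType}.
Implicit Types (phi theta P Q : R -> R) (a b c d e t x s k : R).

Lemma stieltjes_rescale a b P x t phi : continuous P -> smooth phi -> 0 < t ->
  t^-1 * stieltjes a b P 0 (rescale x t phi) =
  (- cint (fun y => t^-1 * P (t * y + x) * derive1 phi y) (- ((x - a) / t)) 0
    - t^-1 * P (t * - ((x - a) / t) + x) * phi (- ((x - a) / t))) +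
  (- cint (fun y => t^-1 * P (t * y + x) * derive1 phi y) 0 ((b - x) / t)
    + t^-1 * P (t * ((b - x) / t) + x) * phi ((b - x) / t)).
Proof.
move=> cP sphi t0; have tN0 : t != 0 by rewrite gt_eqF.
have cphi' := smooth_continuous (smooth_derive1 sphi).
have dr := rescale_deriv x t (smooth_deriv sphi).
rewrite /stieltjes (has_deriv_derive1 dr).
have ea : t * - ((x - a) / t) + x = a by field; rewrite tN0.
have eb : t * ((b - x) / t) + x = b by field; rewrite tN0.
have ra : rescale x t phi a = phi (- ((x - a) / t)).
  by rewrite /rescale -mulNr opprB.
have rb : rescale x t phi b = phi ((b - x) / t) by [].
rewrite ea eb ra.
have cr : continuous (fun z => (P z - 0) * (t^-1 * rescale x t (derive1 phi) z)).
  apply: ctsM; first by exact: ctsB cP (@cts_cst R 0).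
  by apply: (@ctsZ R); rewrite rescale_affine; exact: cts_affine.
have E : cint (fun z => (P z - 0) * (t^-1 * rescale x t (derive1 phi) z)) a b =
    t * cint (fun y => t^-1 * P (t * y + x) * derive1 phi y) (- ((x - a) / t)) ((b - x) / t).
  rewrite -[in LHS]ea -[in LHS]eb (cint_affine _ _ _ _ cr).
  congr (_ * cint _ _ _); apply/funext => y; rewrite subr0 /rescale addrK.
  by rewrite [t * y]mulrC mulfK//; ring.
by rewrite E (cint_split _ _ _ 0) rb; field; rewrite tN0.
Qed.

Lemma quarter_bound (c e : R) : 0 <= c -> 0 < e -> exists2 k, 0 < k & c * k <= e / 4.
Proof.
move=> c0 e0; have c1 : 0 < 4 * (c + 1) by rewrite mulr_gt0// ltr_wpDl.
exists (e / (4 * (c + 1))); first by rewrite divr_gt0.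
rewrite mulrA ler_pdivrMr// mulrA divfK ?pnatr_eq0// mulrDr mulr1 mulrC.
by rewrite lerDl ltW.
Qed.

(** Near x the slope 1 suffices; beyond the distance d the maximum of |P| is divided by d. *)
Lemma differentiable_global_bound a b P x e : a < x -> x < b -> continuous P -> P x = 0 ->
  (forall e, 0 < e -> exists2 d, 0 < d & forall z, `|z - x| < d -> `|P z| <= e * `|z - x|) ->
  exists2 C, 0 <= C & forall z, a <= z -> z <= b -> `|P z| <= C * `|z - x|.
Proof.
move=> ax xb cP Px dP; have [d d0 H] := dP 1 ltr01.
have [B BP] := continuous_bounded (`|a| + `|b|) cP.
have B0 : 0 <= B.
  by apply: le_trans (normr_ge0 (P 0)) (BP 0 _); rewrite normr0 addr_ge0.
have Bd : 0 <= B / d by rewrite divr_ge0// ltW.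
exists (1 + B / d) => [|z az zb]; first by rewrite addr_ge0.
have [zd|dz] := ltP `|z - x| d.
  by apply: le_trans (H z zd) _; rewrite ler_wpM2r// lerDl.
apply: (@le_trans _ _ (B / d * `|z - x|)); last by rewrite ler_wpM2r// lerDr.
apply: (@le_trans _ _ B).
  apply: BP; rewrite ler_norml; have := ler_norm b; have := ler_norm (- a).
  rewrite normrN; have := normr_ge0 a; have := normr_ge0 b => *.
  by apply/andP; split; lra.
by rewrite -mulrA ler_peMr// mulrC ler_pdivlMr// mul1r.
Qed.

(** Since phi has only power decay, its tails matter: the remainder P is o(|z - x|) for |z - x| <= t
    M but merely O(|z - x|) up to the ends of [a, b], where the small tail moments of phi
    compensate. *)
Lemma stieltjes_limit a b Q x s phi : a < x -> x < b -> continuous Q -> T0 phi ->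
  (forall e, 0 < e -> exists2 d, 0 < d & forall z, `|z - x| < d ->
     `|Q z - Q x - s * (z - x)| <= e * `|z - x|) ->
  forall e, 0 < e -> exists2 d, 0 < d & forall t, 0 < t -> t < d ->
    `|t^-1 * stieltjes a b Q (Q x) (rescale x t phi) - s| <= e.
Proof.
move=> ax xb cQ T0phi dQ e e0; have [sphi _ _ _] := T0phi.
have cphi := smooth_continuous sphi.
pose P z := Q z - Q x - s * (z - x).
have cP : continuous P.
  apply: ctsB (ctsB cQ (@cts_cst R (Q x))) _.
  by apply: ctsZ; exact: ctsB (@cts_id R) (@cts_cst R x).
have Px : P x = 0 by rewrite /P !subrr mulr0 subr0.
have [C C0 CP] := differentiable_global_bound e ax xb cP Px dQ.
have [K1 K10 H1] := T0_half T0phi; have [K2 K20 H2] := T0_half_left T0phi.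
(* Four errors of e / 4 each: the parts near x on both sides together, the left tail, the right
   tail, and the missing mass of phi times |s|. *)
have [k1 k10 k1e] := quarter_bound (addr_ge0 K10 K20) e0.
have [k2 k20 k2e] := quarter_bound C0 e0.
have [k3 k30 k3e] := quarter_bound (normr_ge0 s) e0.
have [M1 M10 {}H1] := H1 k2 k20; have [M2 M20 {}H2] := H2 k2 k20.
have [M3 M30 H3] := T0_cint_ge T0phi k30.
have [d d0 dP] := dQ k1 k10.
pose M := M1 + M2 + M3; have M0 : 0 < M by rewrite !addr_gt0.
pose m := Num.min (Num.min (x - a) (b - x)) d.
have m0 : 0 < m by rewrite !lt_min !subr_gt0 ax xb.
exists (m / M); first by rewrite divr_gt0.
move=> t t0; rewrite ltr_pdivlMr// => tM.
have [t1 t2 t3] : [/\ t * M < x - a, t * M < b - x & t * M < d].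
  by move: tM; rewrite !lt_min => /andP[/andP[]].
have scale Y N : 0 < N -> N <= M -> t * M < Y -> N <= Y / t.
  move=> N0 NM tY; rewrite ler_pdivlMr// mulrC; apply: ltW; apply: le_lt_trans tY.
  by rewrite ler_pM2l.
have [M1M M2M M3M] : [/\ M1 <= M, M2 <= M & M3 <= M].
  by rewrite /M; clear -M10 M20 M30; split; lra.
set Y1 := (x - a) / t; set Y2 := (b - x) / t.
pose r y := t^-1 * P (t * y + x).
have cr : continuous r by apply: ctsZ; exact: cts_affine.
have rE k (y : R) : 0 <= k -> (`|P (t * y + x)| <= k * `|t * y + x - x|) -> `|r y| <= k * `|y|.
  move=> k0 h; rewrite normrM gtr0_norm ?invr_gt0// ler_pdivrMl//; apply: le_trans h _.
  by rewrite addrK normrM (gtr0_norm t0) mulrCA.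
have rC y : - Y1 <= y -> y <= Y2 -> `|r y| <= C * `|y|.
  rewrite /Y1 /Y2 -mulNr ler_pdivrMr// ler_pdivlMr// ![y * t]mulrC => y1 y2.
  by apply: rE => //; apply: CP; clear -y1 y2; lra.
have rk y : `|y| <= M -> `|r y| <= k1 * `|y|.
  move=> yM; apply: rE; first exact: ltW.
  apply: dP; rewrite addrK normrM (gtr0_norm t0); apply: le_lt_trans t3.
  by rewrite ler_pM2l.
have Y10 : 0 <= Y1 by rewrite divr_ge0 ?subr_ge0 ?ltW.
have Y20 : 0 <= Y2 by rewrite divr_ge0 ?subr_ge0 ?ltW.
have h1 : `|- cint (fun y => r y * derive1 phi y) 0 Y2 + r Y2 * phi Y2| <= k1 * K1 + C * k2.
  apply: H1 => //; first exact: scale.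
  - by move=> y y0 yY; rewrite -{2}[y]ger0_norm//; apply: rC => //; clear -y0 Y10; lra.
  - by move=> y y0 yM; rewrite -{2}[y]ger0_norm//; apply: rk; rewrite ger0_norm// (le_trans yM).
have h2 : `|- cint (fun y => r y * derive1 phi y) (- Y1) 0 - r (- Y1) * phi (- Y1)|
    <= k1 * K2 + C * k2.
  apply: H2 => //; first exact: scale.
  - by move=> y y0 yY; rewrite -[- y]ler0_norm//; apply: rC => //; clear -yY Y20; lra.
  - by move=> y y0 yM; rewrite -[- y]ler0_norm//; apply: rk; rewrite ler0_norm//; clear -y0 M2M; lra.
have h3 : `|cint phi (- Y1) Y2 - 1| <= k3.
  have g1 : 1 - k3 <= cint phi (- Y1) Y2.
    by apply: H3; [rewrite lerN2|]; exact: scale.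
  have g2 : cint phi (- Y1) Y2 <= 1 by apply: T0_cint_le1 => //; clear -Y10 Y20; lra.
  by rewrite ler_norml; clear -g1 g2 k30; apply/andP; split; lra.
have h4 : `|s * (cint phi (- Y1) Y2 - 1)| <= e / 4.
  by rewrite normrM; apply: le_trans k3e; rewrite ler_wpM2l.
rewrite (stieltjes_split _ _ x s cQ (@smooth_rescale R x t phi sphi)).
rewrite (cint_rescale _ _ _ cphi t0) mulrDr (stieltjes_rescale _ _ _ cP sphi t0).
have aY : (a - x) / t = - Y1 by rewrite /Y1 -mulNr opprB.
rewrite aY -/Y1 -/Y2.
have -> : t^-1 * (s * (t * cint phi (- Y1) Y2)) = s * cint phi (- Y1) Y2.
  by field; rewrite gt_eqF.
move: h1 h2; rewrite /r.
set A1 := (X in `|X| <= _ -> _); set A2 := (X in _ -> `|X| <= _ -> _) => h1 h2.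
have -> : s * cint phi (- Y1) Y2 + (A2 + A1) - s = s * (cint phi (- Y1) Y2 - 1) + (A2 + A1) by ring.
have := ler_normD (s * (cint phi (- Y1) Y2 - 1)) (A2 + A1); have := ler_normD A2 A1.
move: h1 h2 h4 k1e k2e; rewrite mulrDl [K1 * k1]mulrC [K2 * k1]mulrC; clear.
move: `|A1| `|A2| `|A2 + A1| `|_ + (A2 + A1)| `|s * _| (k1 * K1) (k1 * K2) (C * k2) => *.
by lra.
Qed.

End StieltjesLimit.

(** * Indefinite integrals of nonnegative integrable functions *)

Section Distribution.
Context {R : realType}.
Variables (q : R -> R) (a b : R).
Hypothesis ab : a <= b.
Local Notation mu := lebesgue_measure.
Hypothesis qint : mu.-integrable setT (EFin \o q).
Hypothesis q0 : forall x, 0 <= q x.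
Hypothesis qa : forall x, x < a -> q x = 0.
Hypothesis qb : forall x, b < x -> q x = 0.

Definition cumul (x : R) : R := \int[mu]_(y in `]-oo, x]) q y.

Let qI (i : interval R) : mu.-integrable [set` i] (EFin \o q).
Proof. by apply: integrableS qint => //. Qed.

Lemma cumulB x y : x <= y -> cumul y - cumul x = \int[mu]_(z in `]x, y]) q z.
Proof. by move=> xy; apply: Rintegral_itvB; [exact: qI|by []|rewrite bnd_simp]. Qed.

Lemma cumul_nd x y : x <= y -> cumul x <= cumul y.
Proof. by move=> xy; rewrite -subr_ge0 cumulB//; apply: Rintegral_ge0. Qed.

Lemma Rintegral_eq0 (D : set R) (f : R -> R) : (forall x, D x -> f x = 0) ->
  \int[mu]_(x in D) f x = 0.
Proof.
move=> f0; rewrite /Rintegral integral0_eq// => x Dx; by rewrite f0.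
Qed.

Lemma cumul_a : cumul a = 0.
Proof.
rewrite /cumul -Rintegral_itv_bndo_bndc; last exact: qI.
by apply: Rintegral_eq0 => x /=; rewrite in_itv/=; exact: qa.
Qed.

Lemma cumul_low x : x <= a -> cumul x = cumul a.
Proof.
rewrite le_eqVlt => /predU1P[->//|xa]; rewrite cumul_a; apply: Rintegral_eq0 => y /=.
by rewrite in_itv/= => yx; apply: qa; exact: le_lt_trans yx xa.
Qed.

Lemma cumul_high x : b <= x -> cumul x = cumul b.
Proof.
move=> bx; apply/eqP; rewrite -subr_eq0 cumulB//; apply/eqP; apply: Rintegral_eq0 => y /=.
by rewrite in_itv/= => /andP[yb _]; exact: qb.
Qed.

Lemma cumul_b : (cumul b)%:E = (\int[mu]_(x in `[a, b]) (q x)%:E)%E.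
Proof.
have := cumulB ab; rewrite cumul_a subr0 Rintegral_itv_obnd_cbnd; last exact: qI.
by move=> ->; rewrite /Rintegral fineK//; apply: integrable_fin_num => //; exact: qI.
Qed.

Lemma cumul_lipschitz N x y : (forall z, q z <= N) -> x <= y ->
  cumul y - cumul x <= N * (y - x).
Proof.
move=> qN xy; rewrite cumulB//.
have h : \int[mu]_(z in `]x, y]) N = N * (y - x) :> R.
  rewrite Rintegral_cst//= lebesgue_measure_itv/= lte_fin.
  by move: xy; rewrite le_eqVlt => /predU1P[->|->//]; rewrite ltxx subrr.

rewrite -h; apply: le_Rintegral; [exact: measurable_itv|exact: qI| |by move=> z _; exact: qN].
apply: (@integrableS _ _ _ mu `[x, y]%classic); [exact: measurable_itv|exact: measurable_itv| |].
  by apply: subset_itvr; rewrite bnd_simp.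
exact: continuous_integrable (@cts_cst R N).
Qed.

Lemma cumul_continuous : continuous cumul.
Proof.
move=> x; have xx : x - 1 < x + 1 by lra.
have H := @parameterized_integral_continuous R (x - 1) (x + 1) q (ltW xx) (qI `[x - 1, x + 1]).
have [H1 _ _] := (continuous_within_itvP _ xx).1 H.
have xin : x \in `]x - 1, x + 1[ by rewrite in_itv/=; apply/andP; split; lra.
have Hx := H1 x xin.
have near_eq y : x - 1 <= y -> cumul y = cumul (x - 1) + parameterized_integral mu (x - 1) y q.
  move=> xy; rewrite /parameterized_integral -Rintegral_itv_obnd_cbnd; last exact: qI.
  by rewrite -cumulB// addrC subrK.
rewrite /continuous_at near_eq; last by lra.
apply: cvg_trans; last exact: (cvgD (cvg_cst (cumul (x - 1))) Hx).
apply: near_eq_cvg; near=> y; apply/esym/near_eq; apply: ltW; near: y.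
by apply: lt_nbhsr; lra.
Unshelve. all: by end_near. Qed.

(** Lebesgue's differentiation theorem, unfolded into the estimate that [stieltjes_limit] takes. *)
Lemma cumul_deriv_ae : {ae mu, forall x, forall e, 0 < e -> exists2 d, 0 < d &
  forall z, `|z - x| < d -> `|cumul z - cumul x - q x * (z - x)| <= e * `|z - x|}.
Proof.
have locq : locally_integrable setT q.
  by apply: open_integrable_locally => //; exact: openT.
apply: ae_imp (FTC1Ny (fun y => qI `]-oo, y]) locq) _ => x [dQ Qx] e e0.
have : h^-1 *: (cumul (h + x) - cumul x) @[h --> 0^'] --> q x.
  rewrite -Qx; move: dQ => /cvg_ex[l Hl].
  have Hl' : h^-1 *: (cumul (h + x) - cumul x) @[h --> 0^'] --> l.
    apply: cvg_trans Hl; apply: near_eq_cvg; near=> h => /=.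
    by rewrite /GRing.scale/= mulr1.
  by rewrite /derive1; have -> := cvg_lim (@Rhausdorff R) Hl'.
move=> /cvgrPdist_le/(_ e e0); rewrite near_withinE => /nbhs_ballP[d /= d0 dP].
exists d => // z zd; have [->|zx] := eqVneq z x.
  by rewrite !subrr mulr0 subr0 !normr0 mulr0.
have zx0 : z - x != 0 by rewrite subr_eq0.
have := dP (z - x); rewrite /ball/= sub0r normrN => /(_ zd zx0).
rewrite subrK /GRing.scale/= => h.
rewrite -normrN opprB.
have -> : q x * (z - x) - (cumul z - cumul x) =
    (q x - (z - x)^-1 * (cumul z - cumul x)) * (z - x) by field.
by rewrite normrM ler_wpM2r.
Unshelve. all: by end_near. Qed.

End Distribution.

(** * Adding an indefinite integral to a pair *)

Section AddDensity.
Context {R : realType}.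
Variables (q : R -> R) (a b : R).
Hypothesis ab : a <= b.
Local Notation mu := lebesgue_measure.
Hypothesis qint : mu.-integrable setT (EFin \o q).
Hypothesis q0 : forall x, 0 <= q x.
Hypothesis qa : forall x, x < a -> q x = 0.
Hypothesis qb : forall x, b < x -> q x = 0.
Implicit Types (h k : R -> \bar R) (u v U V : schwartz_dist R).

Let cQ := cumul_continuous qint.
Let Qlow := cumul_low qint qa.
Let Qhigh := cumul_high qint qb.

Definition density_prim := fun_dist cQ.
Definition density_dist := deriv_dist density_prim.

Let supp : supported_in `[a, b]%classic density_dist.
Proof. exact: (supported_deriv_fun_dist ab cQ Qlow Qhigh). Qed.

Let scaled phi x t : smooth phi -> scaled_pairing density_dist phi x t =
  t^-1 * stieltjes a b (cumul q) (cumul q x) (rescale x t phi).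
Proof.
move=> sphi; rewrite /scaled_pairing.
by rewrite (pairing_stieltjes ab cQ Qlow Qhigh (cumul q x) (@smooth_rescale R x t phi sphi)).
Qed.

Lemma density_T1_ge0 phi x t : T1 phi -> `[a, b]%classic x -> 0 < t ->
  0 <= scaled_pairing density_dist phi x t.
Proof.
move=> T1phi; rewrite /= in_itv/= => /andP[ax xb] t0; have [[sphi _ _ _] _] := T1phi.
rewrite scaled// mulr_ge0 ?invr_ge0 ?(ltW t0)//.
exact: (stieltjes_ge0 ax xb cQ (cumul_nd qint q0) T1phi t0).
Qed.

Lemma density_T1_le phi x t N : (forall y, q y <= N) -> T1 phi -> `[a, b]%classic x -> 0 < t ->
  scaled_pairing density_dist phi x t <= N.
Proof.
move=> qN T1phi; rewrite /= in_itv/= => /andP[ax xb] t0; have [[sphi _ _ _] _] := T1phi.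
rewrite scaled//; apply: (stieltjes_le ax xb cQ _ _ T1phi t0).
- exact: le_trans (q0 0) (qN 0).
- by move=> y z yz; exact: cumul_lipschitz.
Qed.

Lemma density_T0_ae : {ae mu, forall x, `[a, b]%classic x -> forall phi, T0 phi ->
  forall e, 0 < e -> exists2 d, 0 < d & forall t, 0 < t -> t < d ->
    `|scaled_pairing density_dist phi x t - q x| <= e}.
Proof.
(* The ends are discarded: there the distribution sees phi on one side of x only. *)
have nab : mu.-negligible [set a; b].
  apply/negligibleP; last by apply: countable_lebesgue_measure0; exact: finite_set_countable.
  by apply: measurableU; exact: measurable_set1.
have aeab : {ae mu, forall x, ~ [set a; b] x} by apply: negligibleS nab => x /= /contrapT.
apply: ae_imp2 aeab (cumul_deriv_ae qint) _ => x nx dQ xab phi T0phi e e0.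
have [sphi _ _ _] := T0phi; move: xab; rewrite /= in_itv/= => /andP[ax xb].
have xa : a < x.
  by rewrite lt_neqAle ax andbT; apply/eqP => xa; apply: nx; left; rewrite xa.
have xb' : x < b.
  by rewrite lt_neqAle xb andbT; apply/eqP => xb0; apply: nx; right; rewrite xb0.
have [d d0 dP] := stieltjes_limit xa xb' cQ T0phi dQ e0.
by exists d => // t t0 td; rewrite scaled//; exact: dP.
Qed.

Let scaled_add u phi x t : supported_in `[a, b]%classic u -> smooth phi ->
  scaled_pairing (dist_lin 1 u density_dist) phi x t =
  scaled_pairing u phi x t + scaled_pairing density_dist phi x t.
Proof.
move=> su sphi; rewrite /scaled_pairing.
by rewrite (pairing_lin 1 su supp (@smooth_rescale R x t phi sphi)) mul1r mulrDr.
Qed.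

Let pa : point_value density_prim a 0.
Proof. by rewrite -(cumul_a qint qa); exact: point_value_fun_dist. Qed.

Let pb : point_value density_prim b (cumul q b).
Proof. exact: point_value_fun_dist. Qed.

Local Open Scope ereal_scope.

Lemma gt_ereal_real (c P : \bar R) :
  (forall r : R, c < r%:E -> P <= r%:E) -> c < +oo -> P <= c.
Proof.
move=> H coo; rewrite -leeN2; apply: lt_ereal_real => [r rc|].
  by rewrite -[r]opprK EFinN leeN2; apply: H; rewrite -lteN2 -EFinN opprK.
by rewrite -[-oo]/(- +oo) lteN2.
Qed.

(** Almost everywhere the averages of the added part converge to q x; off E, for [T1], their
    nonnegativity keeps the lower values above -oo, even where q is unbounded. *)
Lemma major_pair_add h k u U : major_pair a b h u U ->
  {ae mu, forall x, `[a, b]%classic x -> k x <= h x + (q x)%:E} ->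
  major_pair a b k (dist_lin 1 u density_dist) (dist_lin 1 U density_prim).
Proof.
move=> [su Ul Uu Ua [E [Z [cE nZ Z1 E1]]]] kh; split.
- exact: supported_lin.
- exact: lojasiewicz_lin Ul (lojasiewicz_fun_dist cQ).
- exact: is_derivative_lin Uu (is_derivative_deriv_dist _).
- by have := @point_value_lin R 1 U density_prim a 0 0 Ua pa; rewrite mulr0 addr0.
pose N := ~` [set x | (`[a, b]%classic x -> k x <= h x + (q x)%:E)].
pose M := ~` [set x | `[a, b]%classic x -> forall phi, T0 phi ->
  forall e, (0 < e)%R -> exists2 d, (0 < d)%R & forall t, (0 < t)%R -> (t < d)%R ->
    (`|scaled_pairing density_dist phi x t - q x| <= e)%R].
exists E, (Z `|` (N `|` M)); split=> //.
- by apply: negligibleU => //; apply: negligibleU; [exact: kh|exact: density_T0_ae].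
- move=> x phi xab nZx T0phi.
  have nZ' : ~ Z x by move=> ?; apply: nZx; left.
  have kx : k x <= h x + (q x)%:E.
    by apply: contrapT => H; apply: nZx; right; left => /(_ xab).
  have lim : forall e, (0 < e)%R -> exists2 d, (0 < d)%R & forall t, (0 < t)%R -> (t < d)%R ->
      (`|scaled_pairing density_dist phi x t - q x| <= e)%R.
    by apply: contrapT => H; apply: nZx; right; right => /(_ xab phi T0phi).
  have hu := Z1 x phi xab nZ' T0phi; have [sphi _ _ _] := T0phi.
  apply: le_trans kx _; have [->|hx] := eqVneq (h x) -oo; first by rewrite addNye leNye.
  apply: lt_ereal_real => [r|]; last by rewrite ltNye adde_eq_ninfty negb_or hx.
  rewrite -lteBlDr// -EFinB => rh; have [d1 d10 H1] := lower_value_gt (lt_le_trans rh hu).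
  apply/lee_addgt0Pr => e e0; have [d2 d20 H2] := lim e e0.
  rewrite -leeBlDr// -EFinB; apply: lower_value_ge; exists (Num.min d1 d2).
    by rewrite lt_min d10.
  move=> t t0; rewrite lt_min => /andP[td1 td2]; rewrite (scaled_add _ _ su sphi).
  by have := H1 t t0 td1; have := H2 t t0 td2; rewrite ler_norml => /andP[? _] ?; lra.
- move=> x phi xab nEx T1phi; have := E1 x phi xab nEx T1phi.
  have [[sphi _ _ _] _] := T1phi.
  move=> lu; have [c cP] : exists c : R, c%:E < lower_value u phi x.
    move: lu; case: (lower_value _ _ _) => // [r _|_]; last by exists 0%R; rewrite ltry.
    by exists (r - 1)%R; rewrite lte_fin; lra.
  apply: (lt_le_trans (ltNyr c)); apply: lower_value_ge.
  have [d d0 H] := lower_value_gt cP; exists d => // t t0 td.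
  rewrite (scaled_add _ _ su sphi); have := H t t0 td.
  by have := density_T1_ge0 T1phi xab t0; lra.
Qed.

(** The bound N keeps the upper values finite at every point off E. For unbounded q the averages may
    tend to +oo on a null set that is not countable. *)
Lemma minor_pair_add h k v V N : (forall y, (q y <= N)%R) -> minor_pair a b h v V ->
  {ae mu, forall x, `[a, b]%classic x -> h x + (q x)%:E <= k x} ->
  minor_pair a b k (dist_lin 1 v density_dist) (dist_lin 1 V density_prim).
Proof.
move=> qN [su Ul Uu Ua [E [Z [cE nZ Z1 E1]]]] kh; split.
- exact: supported_lin.
- exact: lojasiewicz_lin Ul (lojasiewicz_fun_dist cQ).
- exact: is_derivative_lin Uu (is_derivative_deriv_dist _).
- by have := @point_value_lin R 1 V density_prim a 0 0 Ua pa; rewrite mulr0 addr0.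
pose N' := ~` [set x | (`[a, b]%classic x -> h x + (q x)%:E <= k x)].
pose M := ~` [set x | `[a, b]%classic x -> forall phi, T0 phi ->
  forall e, (0 < e)%R -> exists2 d, (0 < d)%R & forall t, (0 < t)%R -> (t < d)%R ->
    (`|scaled_pairing density_dist phi x t - q x| <= e)%R].
exists E, (Z `|` (N' `|` M)); split=> //.
- by apply: negligibleU => //; apply: negligibleU; [exact: kh|exact: density_T0_ae].
- move=> x phi xab nZx T0phi.
  have nZ' : ~ Z x by move=> ?; apply: nZx; left.
  have kx : h x + (q x)%:E <= k x.
    by apply: contrapT => H; apply: nZx; right; left => /(_ xab).
  have lim : forall e, (0 < e)%R -> exists2 d, (0 < d)%R & forall t, (0 < t)%R -> (t < d)%R ->
      (`|scaled_pairing density_dist phi x t - q x| <= e)%R.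
    by apply: contrapT => H; apply: nZx; right; right => /(_ xab phi T0phi).
  have hu := Z1 x phi xab nZ' T0phi; have [sphi _ _ _] := T0phi.
  apply: le_trans kx; have [->|hx] := eqVneq (h x) +oo; first by rewrite addye// leey.
  apply: gt_ereal_real => [r|]; last by rewrite lte_add_pinfty ?ltry// ltey.
  rewrite -lteBrDr// -EFinB => rh; have [d1 d10 H1] := upper_value_lt (le_lt_trans hu rh).
  apply/lee_addgt0Pr => e e0; have [d2 d20 H2] := lim e e0.
  rewrite -EFinD; apply: upper_value_le; exists (Num.min d1 d2).
    by rewrite lt_min d10.
  move=> t t0; rewrite lt_min => /andP[td1 td2]; rewrite (scaled_add _ _ su sphi).
  by have := H1 t t0 td1; have := H2 t t0 td2; rewrite ler_norml => /andP[_ ?] ?; lra.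
- move=> x phi xab nEx T1phi; have := E1 x phi xab nEx T1phi.
  have [[sphi _ _ _] _] := T1phi.
  move=> lu; have [c cP] : exists c : R, upper_value v phi x < c%:E.
    move: lu; case: (upper_value _ _ _) => // [r _|_]; last by exists 0%R; rewrite ltNyr.
    by exists (r + 1)%R; rewrite lte_fin; lra.
  apply: le_lt_trans (ltry (c + N)); apply: upper_value_le.
  have [d d0 H] := upper_value_lt cP; exists d => // t t0 td.
  rewrite (scaled_add _ _ su sphi); have := H t t0 td.
  by have := density_T1_le qN T1phi xab t0; lra.
Qed.

Lemma point_value_add U c : point_value U b c ->
  point_value (dist_lin 1 U density_prim) b (c + cumul q b).
Proof. by move=> Ub; have := @point_value_lin R 1 U density_prim b c _ Ub pb; rewrite mul1r. Qed.

End AddDensity.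

Section HasIntegralAdd.
Context {R : realType}.
Variables (s : R -> R) (a b : R).
Hypothesis ab : a <= b.
Local Notation mu := lebesgue_measure.
Hypothesis ms : measurable_fun setT s.
Hypothesis s0 : forall x, 0 <= s x.
Hypothesis sfin : (\int[mu]_(x in `[a, b]) (s x)%:E < +oo)%E.
Implicit Types (h k : R -> \bar R).

Let q x := if x \in `[a, b] then s x else 0.
Let qN (n : nat) x := Num.min (q x) n%:R.

Let q_ge0 x : 0 <= q x. Proof. by rewrite /q; case: ifP. Qed.
Let qN_ge0 n x : 0 <= qN n x. Proof. by rewrite /qN le_min q_ge0 ler0n. Qed.
Let q_low x : x < a -> q x = 0.
Proof. by move=> xa; rewrite /q in_itv/= leNgt xa. Qed.
Let q_high x : b < x -> q x = 0.
Proof. by move=> bx; rewrite /q in_itv/= andbC leNgt bx. Qed.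
Let qN_low n x : x < a -> qN n x = 0.
Proof. by move=> xa; rewrite /qN q_low// min_l// ler0n. Qed.
Let qN_high n x : b < x -> qN n x = 0.
Proof. by move=> bx; rewrite /qN q_high// min_l// ler0n. Qed.

Let qint : mu.-integrable setT (EFin \o q).
Proof.
have -> : EFin \o q = (EFin \o s) \_ `[a, b]%classic.
  apply/funext => x; rewrite patchE /= /q; case: ifPn => xab; case: ifPn => //.
  - by rewrite notin_setE => /(_ xab).
  - by rewrite inE => /= xab'; rewrite xab' in xab.
apply/(integrable_mkcond _ _).1; first exact: measurable_itv.
apply/integrableP; split.
  by apply/measurable_EFinP; exact: measurable_funTS.
by under eq_integral do rewrite gee0_abs ?lee_fin//.
Qed.

Let mq : measurable_fun setT q.
Proof. by apply/measurable_EFinP; have /integrableP[] := qint. Qed.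

Let mqN n : measurable_fun setT (qN n).
Proof. by apply: measurable_minr => //; exact: measurable_cst. Qed.

Let qNint n : mu.-integrable setT (EFin \o qN n).
Proof.
apply: (le_integrable measurableT _ _ qint); first by apply/measurable_EFinP; exact: mqN.
move=> x _; rewrite lee_fin /= ger0_norm; last exact: qN_ge0.
by rewrite ger0_norm; [rewrite /qN ge_min lexx|exact: q_ge0].
Qed.

Let qs : (\int[mu]_(x in `[a, b]) (q x)%:E = \int[mu]_(x in `[a, b]) (s x)%:E)%E.
Proof. by apply: eq_integral => x; rewrite inE /q => /= ->. Qed.

(** Fatou's lemma for the truncations, whose lower limit is at least q. *)
Let qN_cvg e : 0 < e -> exists n, cumul q b - e < cumul (qN n) b.
Proof.
move=> e0; have mab := @measurable_itv R `[a, b].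
pose f n x := (qN n x)%:E.
have mf n : measurable_fun `[a, b]%classic (f n).
  by apply/measurable_EFinP; exact: measurable_funTS.
have f0 n x : `[a, b]%classic x -> (0 <= f n x)%E by move=> _; rewrite lee_fin; exact: qN_ge0.
have le_q x : ((q x)%:E <= limn_einf (f^~ x))%E.
  apply: (@limn_einf_ge _ _ _ (Num.truncn (q x)).+1) => n qn; rewrite lee_fin le_min lexx/=.
  by apply: ltW; apply: lt_le_trans (truncnS_gt _) _; rewrite ler_nat.
have F := @fatou _ _ _ mu _ mab f mf f0.
have H : (\int[mu]_(x in `[a, b]) (q x)%:E <= limn_einf (fun n => \int[mu]_(x in `[a, b]) f n x))%E.
  apply: le_trans F; apply: ge0_le_integral => //.
  - by move=> x _; rewrite lee_fin.
  - by apply/measurable_EFinP; exact: measurable_funTS.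
  - exact: measurable_limn_einf.
have : ((cumul q b - e)%:E < limn_einf (fun n => \int[mu]_(x in `[a, b]) f n x))%E.
  by apply: lt_le_trans H; rewrite -(cumul_b ab qint q_low) lte_fin; lra.
move=> /limn_einf_gt[n /(_ n (leqnn n)) nP]; exists n.
by rewrite -lte_fin (cumul_b ab (qNint n) (@qN_low n)).
Qed.

Let sum_fine : cumul q b = fine (\int[mu]_(x in `[a, b]) (s x)%:E)%E.
Proof. by rewrite -qs -(cumul_b ab qint q_low). Qed.

Theorem has_integral_add h k I : has_integral a b h I ->
  {ae mu, forall x, `[a, b]%classic x -> k x = (h x + (s x)%:E)%E} ->
  has_integral a b k (I + fine (\int[mu]_(x in `[a, b]) (s x)%:E)%E).
Proof.
move=> [Iu Iv] kh; rewrite -sum_fine; split=> e e0.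
- have [u [U [c [mU Ub cI]]]] := Iu e e0.
  exists (dist_lin 1 u (density_dist qint)), (dist_lin 1 U (density_prim qint)), (c + cumul q b).
  split; last lra.
    apply: (major_pair_add ab qint q_ge0 q_low q_high mU).
    by apply: ae_imp kh _ => x kx xab; rewrite (kx xab) leeD2l// lee_fin /q /= ifT.
  exact: point_value_add.
- have e2 : 0 < e / 2 by rewrite divr_gt0.
  have [v [V [c [mV Vb cI]]]] := Iv _ e2; have [n nP] := qN_cvg e2.
  exists (dist_lin 1 v (density_dist (qNint n))), (dist_lin 1 V (density_prim (qNint n))),
    (c + cumul (qN n) b).
  split; last lra.
    apply: (minor_pair_add ab (qNint n) (@qN_ge0 n) (@qN_low n) (@qN_high n) (N := n%:R)) mV _.
      by move=> y; rewrite /qN ge_min lexx orbT.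
    apply: ae_imp kh _ => x kx xab; rewrite (kx xab) leeD2l// lee_fin /qN /q /= ifT//.
    by rewrite ge_min lexx.
  exact: point_value_add.
Qed.

End HasIntegralAdd.

(** Adding the function 0: equality almost everywhere is all that the addition theorem asks of k. *)
Lemma has_integral_ae (R : realType) (a b : R) (h k : R -> \bar R) I : a <= b ->
  has_integral a b h I ->
  {ae lebesgue_measure, forall x, `[a, b]%classic x -> k x = h x} -> has_integral a b k I.
Proof.
move=> ab hI kh.
have i0 : (\int[lebesgue_measure]_(x in `[a, b]) (0 : R)%:E = 0)%E by rewrite integral0.
have := @has_integral_add R (fun=> 0) a b ab (measurable_cst _) (fun=> lexx 0) _ h k I hI.
rewrite i0 addr0; apply; first by rewrite ltry.
by apply: ae_imp kh _ => x kx xab; rewrite adde0 kx.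
Qed.

(** * Fatou's lemma *)

Section LebesgueMeasurable.
Context {R : realType}.
Implicit Types (a b : R) (f g : R -> \bar R).
Local Notation mu := (@lebesgue_measure R).

Lemma lmeasurable_borel a b f : measurable_fun setT f -> lmeasurable a b f.
Proof.
move=> mf _ Y mY; apply: sub_gen_smallest.
exists (`[a, b] `&` f @^-1` Y).
  apply: measurableI; first exact: measurable_itv.
  by rewrite -[X in measurable X]setTI; exact: mf.
by exists set0; [exact: negligible_set0|rewrite setU0].
Qed.

Lemma completed_ae_borel (A : set R) :
  @measurable _ (g_sigma_algebraType (completed_algebra_gen mu)) A ->
  exists2 B : set R, measurable B & {ae mu, forall x, A x <-> B x}.
Proof.
rewrite g_sigma_completed_algebra_genE => -[B mB [N nN] BNA].
exists B => //; apply: negligibleS nN => x /= H; apply: contrapT => nNx; apply: H.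
by rewrite -BNA; split=> [[]//|]; left.
Qed.

Lemma ereal_inf_rat (c : \bar R) :
  c = ereal_inf [set (ratr r : R)%:E | r in [set r : rat | (c < (ratr r : R)%:E)%E]].
Proof.
apply/eqP; rewrite eq_le; apply/andP; split.
  by apply: le_ereal_inf_tmp => _ [r /= cr <-]; exact: ltW.
have [->|cy] := eqVneq c +oo%E; first exact: leey.
apply: gt_ereal_real; last by rewrite ltey.
move=> r cr; have [d cd dr] : exists2 d : R, (c <= d%:E)%E & d < r.
  case: c cr {cy} => [c|//|_]; last by exists (r - 1); [exact: leNye|lra].
  by rewrite lte_fin => cr; exists c.
have [p] := rat_in_itvoo dr; rewrite in_itv/= => /andP[dp pr].
apply: (@le_trans _ _ (ratr p)%:E); last by rewrite lee_fin ltW.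
by apply: ereal_inf_lbound; exists p => //=; apply: le_lt_trans cd _; rewrite lte_fin.
Qed.

(** Every rational sublevel set is Borel up to a null set; the rationals being countable, f is
    almost everywhere the infimum built from these Borel sets. *)
Lemma lmeasurable_ae_borel a b f : lmeasurable a b f ->
  exists2 f', measurable_fun setT f' & {ae mu, forall x, `[a, b]%classic x -> f x = f' x}.
Proof.
move=> mf.
have mab : @measurable _ (g_sigma_algebraType (completed_algebra_gen mu)) `[a, b]%classic.
  apply: sub_gen_smallest; exists `[a, b]%classic; first exact: measurable_itv.
  by exists set0; [exact: negligible_set0|rewrite setU0].
have H (r : rat) : exists B : set R, measurable B /\
    {ae mu, forall x, (`[a, b]%classic x /\ (f x < (ratr r)%:E)%E) <-> B x}.
  have [|B mB BP] := @completed_ae_borel (`[a, b] `&` [set x | (f x < (ratr r)%:E)%E]).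
    exact: (emeasurable_fun_infty_o mab mf).
  by exists B.
have /choice[B BP] := H.
(* [unpickle] enumerates the rationals; an index that codes none, or a set that misses x,
   contributes +oo and leaves the infimum unchanged. *)
pose F n x : \bar R := if @unpickle rat n is Some r then
  (if x \in B r then (ratr r)%:E else +oo%E) else +oo%E.
exists (fun x => einfs (F^~ x) 0).
  apply: (measurable_fun_einfs (f := F)) => n; rewrite /F; case: unpickle => [r|].
    apply: measurable_fun_ifT; [|exact: measurable_cst..].
    apply: (measurable_fun_bool true); rewrite setTI.
    have -> : (fun x => x \in B r) @^-1` [set true] = B r.
      by apply/seteqP; split=> x /=; [move=> /set_mem|move=> /mem_set].
    by have [] := BP r.
  exact: measurable_cst.
have aeB : {ae mu, forall x, forall n, if @unpickle rat n is Some r then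
    ((`[a, b]%classic x /\ (f x < (ratr r)%:E)%E) <-> B r x) else True}.
  apply: ae_forall => n; case: unpickle => [r|]; last exact: aeW.
  by have [] := BP r.
apply: (ae_imp aeB) => x Hx xab; rewrite {1}[f x]ereal_inf_rat.
have {}Hx r : (f x < (ratr r)%:E)%E <-> B r x.
  have := Hx (pickle r); rewrite pickleK => <-.
  by split=> [|[]].
apply/eqP; rewrite eq_le; apply/andP; split.
  apply: le_ereal_inf_tmp => _ [n _ <-]; rewrite /F; case: unpickle => [r|]; last exact: leey.
  case: ifPn => [|_]; last exact: leey.
  by rewrite inE => /Hx fr; apply: ereal_inf_lbound; exists r.
apply: le_ereal_inf_tmp => _ [r /= fr <-]; apply: ereal_inf_lbound.
exists (pickle r) => //; rewrite /F pickleK ifT//.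
by rewrite inE; apply/Hx.
Qed.

End LebesgueMeasurable.

(** * Excess over an integrable function, and its Fatou lemma *)

Section FatouDistributional.
Context {R : realType}.
Variables (a b : R).
Hypothesis ab : a <= b.
Implicit Types (h g k S : R -> \bar R) (I J c : R).
Local Notation mu := lebesgue_measure.
Local Open Scope ereal_scope.

Let mab := @measurable_itv R `[a, b].

Lemma has_integral_add_ereal h k S I : measurable_fun setT S -> (forall x, 0 <= S x) ->
  \int[mu]_(x in `[a, b]) S x < +oo -> has_integral a b h I ->
  {ae mu, forall x, `[a, b]%classic x -> k x = h x + S x} ->
  has_integral a b k (I + fine (\int[mu]_(x in `[a, b]) S x)).
Proof.
move=> mS S0 Sfin hI kh.
have SI : mu.-integrable `[a, b]%classic S.
  apply/integrableP; split; first exact: measurable_funTS.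
  by under eq_integral do rewrite gee0_abs//.
have aeS := @integrable_ae _ _ _ mu _ mab _ SI.
have mfS : measurable_fun setT (fine \o S) by exact: measurableT_comp.
have fS0 x : (0 <= (fine \o S) x)%R by exact: fine_ge0.
have eqS : \int[mu]_(x in `[a, b]) ((fine \o S) x)%:E = \int[mu]_(x in `[a, b]) S x.
  apply: ge0_ae_eq_integral => //.
  - by apply/measurable_EFinP; exact: measurable_funTS.
  - exact: measurable_funTS.
  - by move=> x _; rewrite lee_fin; exact: fS0.
  - by apply: (ae_imp aeS) => x Sx xab /=; rewrite fineK// Sx.
rewrite -eqS; apply: (has_integral_add ab mfS fS0 _ hI); first by rewrite eqS.
by apply: (ae_imp2 aeS kh) => x Sx kx xab; rewrite (kx xab) /= fineK// Sx.
Qed.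

(** The versions h' and g' satisfy the inequality only almost everywhere; the positive part makes
    the integrand nonnegative at every point, as Fatou's lemma needs. *)
Lemma has_integral_excess h g (h' : R -> R) (g' : R -> \bar R) I J : has_integral a b h I ->
  has_integral a b g J -> {ae mu, forall x, `[a, b]%classic x -> h x <= g x} ->
  measurable_fun setT h' -> measurable_fun setT g' ->
  {ae mu, forall x, `[a, b]%classic x -> h x = (h' x)%:E} ->
  {ae mu, forall x, `[a, b]%classic x -> g x = g' x} ->
  \int[mu]_(x in `[a, b]) maxe (g' x - (h' x)%:E) 0 <= (J - I)%:E.
Proof.
move=> hI gJ hg mh mg hh gg; have [g2 mg2 gg2] := has_integral_measurable ab gJ.
apply: le_trans (has_integral_le ab hI gJ hg mh mg2 hh gg2).
apply: ae_ge0_le_integral => //.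
- by move=> x _; rewrite le_max lexx orbT.
- apply: measurable_funTS; apply: measurable_maxe => //.
  by apply: emeasurable_funB => //; exact/measurable_EFinP.
- by move=> x _; rewrite lee_fin le_max lexx orbT.
- apply/measurable_EFinP; apply: measurable_funTS; apply: measurable_maxr => //.
  exact: measurable_funB.
apply: (ae_imp2 gg gg2) => x g1 g2x xab.
by rewrite -(g1 xab) (g2x xab) -EFinB -EFin_max.
Qed.

(** Comparison with 0 shows that a distributionally integrable S >= 0 is Lebesgue integrable. *)
Lemma has_integral0 : has_integral a b (fun=> 0) 0.
Proof.
pose U := fun_dist (@cts_cst R 0%R); pose u := deriv_dist U.
have u0 phi : test_function phi -> u phi = 0%R.
  move=> tphi; rewrite /u /U /=.
  by rewrite (Rintegral_eq0 (f := fun x => 0 * derive1 phi x)%R) ?oppr0// => x _; rewrite mul0r.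
have su : supported_in `[a, b]%classic u by move=> phi tphi _; exact: u0.
have p0 phi x t : smooth phi -> scaled_pairing u phi x t = 0%R.
  move=> sphi; rewrite /scaled_pairing (pairing_box su (@smooth_rescale R x t phi sphi)).
  have tb : test_function (box_plateau a b) by exact: test_plateau.
  by rewrite (u0 _ (testM tb (@smooth_rescale R x t phi sphi))) mulr0.
have Ul : lojasiewicz U := lojasiewicz_fun_dist _.
have Uv x : point_value U x 0 by exact: (@point_value_fun_dist R _ _ x).
have lower phi x : smooth phi -> 0 <= lower_value u phi x.
  by move=> sphi; apply: lower_value_ge; exists 1%R => // t _ _; rewrite p0.
have upper phi x : smooth phi -> upper_value u phi x <= 0.
  by move=> sphi; apply: upper_value_le; exists 1%R => // t _ _; rewrite p0.
have maj : major_pair a b (fun=> 0) u U.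
  split=> //; exists set0, set0; split=> //; first exact: negligible_set0.
    by move=> x phi _ _ [sphi _ _ _]; exact: lower.
  by move=> x phi _ _ [[sphi _ _ _] _]; apply: lt_le_trans (lower _ _ sphi).
have min : minor_pair a b (fun=> 0) u U.
  split=> //; exists set0, set0; split=> //; first exact: negligible_set0.
    by move=> x phi _ _ [sphi _ _ _]; exact: upper.
  by move=> x phi _ _ [[sphi _ _ _] _]; apply: le_lt_trans (upper _ _ sphi) _.
by split=> e e0; exists u, U, 0%R; split=> //; lra.
Qed.

Lemma dist_integral_has h I : has_integral a b h I -> dist_integral a b h = I%:E.
Proof.
move=> hI; have [hint hsup] := has_integral_sup ab hI.
by rewrite /dist_integral asboolT.
Qed.

(** Let S be the excess of g over h. If S were integrable, then being nonnegative it would be in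
    L^1, and h + S would be integrable. So if g is not integrable, h' + S is a decomposition of the
    kind that defines the value +oo. *)
Lemma dist_integral_dichotomy h g I : has_integral a b h I -> lmeasurable a b g ->
  {ae mu, forall x, `[a, b]%classic x -> h x <= g x} ->
  (exists J, has_integral a b g J) \/ dist_integral a b g = +oo.
Proof.
move=> hI mg hg; have [gI|gnI] := pselect (dist_integrable a b g).
  by left; exact/has_integralP.
right; rewrite /dist_integral asboolF// asboolT//; split=> //.
have [h' mh hh] := has_integral_measurable ab hI.
have [g' mg' gg] := lmeasurable_ae_borel mg.
pose S x := maxe (g' x - (h' x)%:E) 0.
have mS : measurable_fun setT S.
  by apply: measurable_maxe => //; apply: emeasurable_funB => //; exact/measurable_EFinP.
have S0 x : 0 <= S x by rewrite le_max lexx orbT.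
have h'I : has_integral a b (EFin \o h') I.
  by apply: has_integral_ae ab hI _; apply: (ae_imp hh) => x hx xab; rewrite (hx xab).
have gS : {ae mu, forall x, `[a, b]%classic x -> g x = (EFin \o h') x + S x}.
  apply: (ae_imp2 gg (ae_imp2 hg hh (fun x => @conj _ _))) => x gx [hgx hx] xab.
  have := hgx xab; rewrite (gx xab) (hx xab) => h1.
  rewrite /S max_l; last by rewrite sube_ge0.
  have -> : (EFin \o h') x = (h' x)%:E by [].
  by rewrite addeC subeK.
exists (EFin \o h'), S; split=> //.
- by have [] := has_integral_sup ab h'I.
- by apply: aeW.
- exact: lmeasurable_borel.
move=> /(has_integralP _ ab)[J SJ]; apply: gnI.
have Sfin : \int[mu]_(x in `[a, b]) S x < +oo.
  have H := @has_integral_excess _ S (fun=> 0%R) S _ _ has_integral0 SJ _ (measurable_cst _) mS.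
  have e1 : {ae mu, forall x, `[a, b]%classic x -> 0 <= S x} by apply: aeW.
  have e2 : {ae mu, forall x, `[a, b]%classic x -> 0 = (0 : R)%:E :> \bar R} by apply: aeW.
  have e3 : {ae mu, forall x, `[a, b]%classic x -> S x = S x} by apply: aeW.
  apply: le_lt_trans (ltry (J - 0)); apply: le_trans (H e1 e2 e3).
  rewrite le_eqVlt; apply/orP; left; apply/eqP; apply: eq_integral => x _.
  by rewrite sube0 max_l.
by have [] := has_integral_sup ab (has_integral_add_ereal mS S0 Sfin h'I gS).
Qed.

Lemma fatou_dist_integral h (g : nat -> R -> \bar R) : dist_integrable a b h ->
  (forall n, lmeasurable a b (g n)) ->
  (forall n, {ae mu, forall x, `[a, b]%classic x -> h x <= g n x}) ->
  limn_einf (fun n => dist_integral a b (g n)) < +oo ->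
  exists K, has_integral a b (fun x => limn_einf (fun n => g n x)) K /\
    K%:E <= limn_einf (fun n => dist_integral a b (g n)).
Proof.
move=> /(has_integralP _ ab)[I hI] mg hg Loo.
set L := limn_einf _ in Loo *.
have [h' mh hh] := has_integral_measurable ab hI.
have /choice[g' g'P] : forall n, exists g', measurable_fun setT g' /\
    {ae mu, forall x, `[a, b]%classic x -> g n x = g' x}.
  by move=> n; have [g' ? ?] := lmeasurable_ae_borel (mg n); exists g'.
pose S n x := maxe (g' n x - (h' x)%:E) 0.
have mS n : measurable_fun setT (S n).
  have [mg' _] := g'P n.
  by apply: measurable_maxe => //; apply: emeasurable_funB => //; exact/measurable_EFinP.
have S0 n x : 0 <= S n x by rewrite le_max lexx orbT.
pose T x := limn_einf (S^~ x).
have mT : measurable_fun setT T by exact: measurable_limn_einf.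
have T0 x : 0 <= T x by apply: (@limn_einf_ge _ _ _ 0) => n _.
(* Arbitrarily late indices n have an integral below c, which rules out the value +oo; there the
   excess S n has integral at most c - I. *)
have Tc c : L < c%:E -> \int[mu]_(x in `[a, b]) T x <= (c - I)%:E.
  move=> Lc; apply: le_trans (@fatou _ _ _ mu _ mab S _ _) _.
  - by move=> n; exact: measurable_funTS (mS n).
  - by move=> n x _.
  apply: limn_einf_le => N; have [n Nn nc] := limn_einf_lt Lc N; exists n => //.
  have [[J gJ]|goo] := dist_integral_dichotomy hI (mg n) (hg n); last by rewrite goo in nc.
  have [mg' gg'] := g'P n.
  apply: le_trans (has_integral_excess hI gJ (hg n) mh mg' hh gg') _.
  by move: nc; rewrite (dist_integral_has gJ) lte_fin lee_fin => ?; lra.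
have [c0 c0P] : exists c : R, L < c%:E.
  move: Loo; case: L {Tc} => // [r _|_]; last by exists 0%R; rewrite ltNyr.
  by exists (r + 1)%R; rewrite lte_fin; lra.
have Tfin : \int[mu]_(x in `[a, b]) T x < +oo := le_lt_trans (Tc _ c0P) (ltry _).
have aeg : {ae mu, forall x, forall n, `[a, b]%classic x -> g n x = (h' x)%:E + S n x}.
  apply: ae_forall => n; have [_ gg] := g'P n.
  apply: (ae_imp2 gg (ae_imp2 (hg n) hh (fun x => @conj _ _))) => x gx [hgx hx] xab.
  have := hgx xab; rewrite (gx xab) (hx xab) => h1.
  rewrite /S max_l; last by rewrite sube_ge0.
  by rewrite addeC subeK.
exists (I + fine (\int[mu]_(x in `[a, b]) T x))%R; split.
  apply: (has_integral_add_ereal mT T0 Tfin hI).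
  (* The value h' x is real, so it can be taken out of the lower limit. *)
  apply: (ae_imp2 aeg hh) => x gx hx xab; rewrite (hx xab) -limn_einf_shift//.
  by congr limn_einf; apply/funext => n; exact: gx.
(* The result is compared with every real c above L, which covers all values of L below +oo without
   a separate proof that L is finite. *)
apply: gt_ereal_real => // c /Tc; rewrite lee_fin -lerBrDl.
by rewrite -lee_fin fineK// ge0_fin_numE// integral_ge0.
Qed.

End FatouDistributional.

Local Open Scope ereal_scope.

Theorem theorem9p5 (R : realType) (a b : R) (hab : (a < b)%R)
    (h : R -> \bar R) (g : nat -> R -> \bar R)
    (h_int : dist_integrable a b h)
    (g_meas : forall n, lmeasurable a b (g n))
    (g_ge : forall n, {ae lebesgue_measure,
       forall x : R, `[a, b]%classic x -> h x <= g n x})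
    (g_lim : limn_einf (fun n => dist_integral a b (g n)) < +oo) :
  let gstar := fun x : R => limn_einf (fun n => g n x) in
  dist_integrable a b gstar /\
  dist_integral a b gstar <= limn_einf (fun n => dist_integral a b (g n)).
Proof.
move=> gstar; have ab := ltW hab.
have [K [gK KL]] := fatou_dist_integral ab h_int g_meas g_ge g_lim.
split; first by have [] := has_integral_sup ab gK.
by rewrite (dist_integral_has ab gK).
Qed.
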